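(* For any Courant algebroid $C\to M$, the quadruple $(\mathfrak JC,(\cdot,\cdot)_*,[\cdot,\cdot]_{\mathfrak JC},\rho)$, consisting of the first jet bundle of $C$ with the $T^*M$-valued pairing, bracket and anchor $\rho:\mathfrak JC\to\mathfrak D(T^*M)$ defined in the context, is a $T^*M$-Courant algebroid.
   Context: **Gauge and jet bundles.** For a vector bundle $E\to M$, $\mathfrak DE$ denotes the gauge Lie algebroid: its sections are the $\mathbb R$-linear maps $\mathfrak d:\Gamma(E)\to\Gamma(E)$ for which there is a vector field $j(\mathfrak d)$ with $\mathfrak d(fu)=f\,\mathfrak d(u)+j(\mathfrak d)(f)\,u$; bracket $[\cdot,\cdot]_{\mathfrak D}$ = commutator, anchor $j$. The first jet bundle $\mathfrak JE$ is regarded as $\{\nu\in\mathrm{Hom}(\mathfrak DE,E):\nu(\Phi)=\Phi(\nu(\mathrm{Id}_E))\ \forall\Phi\in\mathfrak{gl}(E)\}$, the jet $[u]_m$ corresponding to $\mathfrak d\mapsto\mathfrak d(u)(m)$; $\mathbf d:\Gamma(E)\to\Gamma(\mathfrak JE)$ is the jet prolongation, $(\mathbf du)(\mathfrak d)=\mathfrak d(u)$. $\mathrm{Hom}(TM,E)=T^*M\otimes E$ is a subbundle of $\mathfrak JE$, with $\mathbf d(fu)=df\otimes u+f\,\mathbf du$. Sections of $\mathfrak JE$ are locally generated over $C^\infty(M)$ by the $\mathbf du$ and $df\otimes u$. **$E$-Courant algebroids.** A Leibniz algebra has a bilinear bracket with $[g_1,[g_2,g_3]]=[[g_1,g_2],g_3]+[g_2,[g_1,g_3]]$.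 An $E$-Courant algebroid is a quadruple $(\mathcal K,(\cdot,\cdot)_E,[\cdot,\cdot]_{\mathcal K},\rho)$: $\mathcal K\to M$ a vector bundle with $(\Gamma(\mathcal K),[\cdot,\cdot]_{\mathcal K})$ a Leibniz algebra; $(\cdot,\cdot)_E:\mathcal K\otimes\mathcal K\to E$ symmetric and nondegenerate; $\rho:\mathcal K\to\mathfrak DE$ a bundle map; with $\rho^\star(\nu)(k)=\nu(\rho(k))$, and for all sections: (EC-1) $\rho[X,Y]_{\mathcal K}=[\rho(X),\rho(Y)]_{\mathfrak D}$; (EC-2) $[X,X]_{\mathcal K}=\rho^\star\mathbf d(X,X)_E$; (EC-3) $\rho(X)(Y,Z)_E=([X,Y]_{\mathcal K},Z)_E+(Y,[X,Z]_{\mathcal K})_E$; (EC-4) $\rho^\star(\mathfrak JE)\subset\mathcal K$, where $\rho^\star(\mu)$ is identified with the element of $\mathcal K$ satisfying $(\rho^\star(\mu),X)_E=\tfrac12\mu(\rho(X))$; (EC-5) $\rho\circ\rho^\star=0$ on $\mathfrak JE$. **Courant algebroids.** A Courant algebroid is a vector bundle $C\to M$ with a nondegenerate symmetric bilinear form $\langle\cdot,\cdot\rangle$, an $\mathbb R$-bilinear bracket $[\![\cdot,\cdot]\!]$ on $\Gamma(C)$ making it a Leibniz algebra, and a bundle map $a:C\to TM$ such that $a[\![X,Y]\!]=[aX,aY]$, $a(X)\langle Y,Z\rangle=\langle[\![X,Y]\!],Z\rangle+\langle Y,[\![X,Z]\!]\rangle$, $[\![X,X]\!]=a^*(d\langle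 X,X\rangle)$, $a\circ a^*=0$. Here $a^*:T^*M\to C$ is defined by $\langle a^*\xi,X\rangle=\tfrac12\xi(a(X))$. **Structures on $\mathfrak JC$** (with $X,Y\in\Gamma(C)$, $f,g\in C^\infty(M)$). Pairing (symmetric, $C^\infty(M)$-bilinear, values in $T^*M$): $(\mathbf dX,\mathbf dY)_*=d\langle X,Y\rangle$, $(\mathbf dX,df\otimes Y)_*=\langle X,Y\rangle df$, $(df\otimes X,dg\otimes Y)_*=0$. Anchor ($C^\infty(M)$-linear): $\rho(\mathbf dX)=\mathcal L_{a(X)}$ (Lie derivative on $\Omega^1(M)$), $\rho(df\otimes X)(\xi)=\xi(a(X))\,df$. Bracket: $[\mathbf dX,\mathbf dY]_{\mathfrak JC}=\mathbf d[\![X,Y]\!]$; $[\mathbf dX,df\otimes Y]_{\mathfrak JC}=df\otimes[\![X,Y]\!]+d(a(X)f)\otimes Y$; $[df\otimes Y,\mathbf dX]_{\mathfrak JC}=df\otimes[\![Y,X]\!]-d(a(X)f)\otimes Y+2\langle X,Y\rangle\,\mathbf d(a^*(df))$; $[df\otimes X,dg\otimes Y]_{\mathfrak JC}=a(X)(g)\,df\otimes Y-a(Y)(f)\,dg\otimes X$; extended to all sections $\mu,\nu$ of $\mathfrak JC$ by $[\mu,f\nu]_{\mathfrak JC}=f[\mu,\nu]_{\mathfrak JC}+(j(\rho(\mu))f)\,\nu$ and $[f\mu,\nu]_{\mathfrak JC}=f[\mu,\nu]_{\mathfrak JC}-(j(\rho(\nu))f)\,\mu+2\rho^\star(df\otimes(\mu,\nu)_*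 )$, where $\rho^\star(df\otimes dg)=dg\otimes a^*(df)$.
   Formalization: The base manifold M is assumed to have positive dimension; over a point T*M = 0 and the jet bundle is C itself, so the T*M-valued pairing is degenerate for any nonzero quadratic Lie algebra C and the claim fails. *)

(* Defs.v *)
From HB Require Import structures.
From mathcomp Require Import all_boot all_order all_algebra.
From mathcomp Require Import all_classical all_reals all_analysis.
From mathcomp Require Import ring.

Set Implicit Arguments.
Unset Strict Implicit.
Unset Printing Implicit Defensive.

Import Order.TTheory GRing.Theory Num.Theory.
Import numFieldNormedType.Exports.

Local Open Scope classical_set_scope.
Local Open Scope ring_scope.

Section SmoothOn.
Context {R : realType} {V : normedModType R}.

(* Only meaningful for open U. *)
Fixpoint Ck_on (k : nat) (U : set V) (f : V -> R) : Prop :=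
  (forall x, U x -> {for x, continuous f}) /\
  match k with
  | 0 => True
  | k'.+1 => forall v, (forall x, U x -> derivable f x v) /\
                       Ck_on k' U (fun x => 'D_v f x)
  end.

Definition smooth_on (U : set V) (f : V -> R) := forall k, Ck_on k U f.

Lemma Ck_onS k U f : Ck_on k.+1 U f -> Ck_on k U f.
Proof.
elim: k f => [|k IH] f [fc fd]; split => // v.
by have [fv Df] := fd v; split => //; apply: IH.
Qed.

Lemma eq_Ck_on k (U : set V) f g : open U ->
  (forall x, U x -> f x = g x) -> Ck_on k U f -> Ck_on k U g.
Proof.
move=> oU; elim: k f g => [|k IH] f g fg [fc fd]; split => //.
- move=> x Ux; have := fc x Ux; rewrite /prop_for /continuous_at -(fg x Ux).
  by apply: cvg_trans; apply: near_eq_cvg; near=> y; apply: fg; near: y;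
    apply: open_nbhs_nbhs.
- move=> x Ux; have := fc x Ux; rewrite /prop_for /continuous_at -(fg x Ux).
  by apply: cvg_trans; apply: near_eq_cvg; near=> y; apply: fg; near: y;
    apply: open_nbhs_nbhs.
- have nfg x : U x -> \near x, f x = g x.
    by move=> Ux; near=> y; apply: fg; near: y; apply: open_nbhs_nbhs.
  move=> v; have [fv Df] := fd v; split=> [x Ux|].
    by apply: near_eq_derivable (fv x Ux); apply: nfg.
  by apply: IH Df => x Ux; apply: near_eq_derive; apply: nfg.
Unshelve. all: by end_near. Qed.

Lemma Ck_on_cst k (U : set V) (c : R) : open U -> Ck_on k U (cst c).
Proof.
move=> oU; elim: k c => [|k IH] c; split => //.
- by move=> x _; exact: cvg_cst.
- by move=> x _; exact: cvg_cst.
move=> v; split=> [x _|]; first exact: derivable_cst.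
by apply: eq_Ck_on (IH 0) => // x _; rewrite derive_cst.
Qed.

Lemma Ck_onD k (U : set V) (f g : V -> R) : open U ->
  Ck_on k U f -> Ck_on k U g -> Ck_on k U (f \+ g).
Proof.
move=> oU; elim: k f g => [|k IH] f g [fc fd] [gc gd]; split => //.
- by move=> x Ux; apply: cvgD; [apply: fc|apply: gc].
- by move=> x Ux; apply: cvgD; [apply: fc|apply: gc].
- move=> v; have [fv Df] := fd v; have [gv Dg] := gd v; split=> [x Ux|].
    by apply: derivableD; [apply: fv|apply: gv].
  apply: eq_Ck_on (IH _ _ Df Dg) => // x Ux /=.
  by rewrite deriveD //; [apply: fv|apply: gv].
Qed.

Lemma Ck_onM k (U : set V) (f g : V -> R) : open U ->
  Ck_on k U f -> Ck_on k U g -> Ck_on k U (f \* g).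
Proof.
move=> oU; elim: k f g => [|k IH] f g Cf Cg; move: (Cf) (Cg);
  move=> [fc fd] [gc gd]; split => //.
- by move=> x Ux; apply: cvgM; [apply: fc|apply: gc].
- by move=> x Ux; apply: cvgM; [apply: fc|apply: gc].
- move=> v; have [fv Df] := fd v; have [gv Dg] := gd v; split=> [x Ux|].
    by apply: derivableM; [apply: fv|apply: gv].
  have := Ck_onD oU (IH _ _ (Ck_onS Cf) Dg) (IH _ _ (Ck_onS Cg) Df).
  apply: eq_Ck_on => // x Ux /=.
  by rewrite deriveM //; [apply: fv|apply: gv].
Qed.

End SmoothOn.

(* A homeomorphism [chart_map] from [chart_dom] onto [chart_img], with inverse
   [chart_inv]; the values of the two functions off these sets are junk. *)
Record chart (R : realType) (n : nat) (M : topologicalType) := Chart {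
  chart_dom : set M;
  chart_img : set 'rV[R]_n;
  chart_map : M -> 'rV[R]_n;
  chart_inv : 'rV[R]_n -> M;
  chart_dom_open : open chart_dom;
  chart_img_open : open chart_img;
  chart_mapP : forall x, chart_dom x -> chart_img (chart_map x);
  chart_invP : forall y, chart_img y -> chart_dom (chart_inv y);
  chart_mapK : forall x, chart_dom x -> chart_inv (chart_map x) = x;
  chart_invK : forall y, chart_img y -> chart_map (chart_inv y) = y;
  chart_map_cont : forall x, chart_dom x -> {for x, continuous chart_map};
  chart_inv_cont : forall y, chart_img y -> {for y, continuous chart_inv}
}.

Definition chart_compat (R : realType) n (M : topologicalType)
    (c c' : chart R n M) :=
  forall i : 'I_n,
    smooth_on (chart_img c `&` chart_inv c @^-1` chart_dom c')
              (fun y => chart_map c' (chart_inv c y) 0 i).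

Record manifold (R : realType) (n : nat) := Manifold {
  mfd_space :> topologicalType;
  mfd_hausdorff : hausdorff_space mfd_space;
  mfd_second_countable : @second_countable mfd_space;
  atlas : set (chart R n mfd_space);
  atlas_cover : forall x, exists2 c, atlas c & chart_dom c x;
  atlas_compat : forall c c', atlas c -> atlas c' -> chart_compat c c'
}.

Section SmoothFunctions.
Context {R : realType} {n : nat}.
Variable M : manifold R n.

(* Only meaningful for open W. *)
Definition msmooth_on (W : set M) (f : M -> R) :=
  forall c, atlas c ->
    smooth_on (chart_img c `&` chart_inv c @^-1` W) (f \o chart_inv c).

Definition msmooth (f : M -> R) := msmooth_on setT f.

Lemma open_chart_part (c : chart R n M) : open (chart_img c `&` chart_inv c @^-1` setT).
Proof. by rewrite preimage_setT setIT; exact: chart_img_open. Qed.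

Lemma msmooth_cst (c : R) : msmooth (cst c).
Proof. by move=> ch _ k; apply: Ck_on_cst; exact: open_chart_part. Qed.

Lemma msmoothD f g : msmooth f -> msmooth g -> msmooth (f \+ g).
Proof.
move=> sf sg c Ac k; apply: (@Ck_onD _ _ k _ (f \o _) (g \o _));
  by [exact: open_chart_part | exact: sf | exact: sg].
Qed.

Lemma msmoothM f g : msmooth f -> msmooth g -> msmooth (f \* g).
Proof.
move=> sf sg c Ac k; apply: (@Ck_onM _ _ k _ (f \o _) (g \o _));
  by [exact: open_chart_part | exact: sf | exact: sg].
Qed.

Definition msmooth_pred : {pred (M -> R)} := fun f => `[< msmooth f >].

Lemma msmooth_subring : subring_closed msmooth_pred.
Proof.
split.
- exact/asboolP/msmooth_cst.
- move=> f g /asboolP sf /asboolP sg; apply/asboolP.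
  have -> : f - g = f \+ (cst (-1) \* g).
    by apply/funext => x /=; rewrite mulN1r.
  by apply: msmoothD => //; apply: msmoothM => //; exact: msmooth_cst.
- by move=> f g /asboolP sf /asboolP sg; apply/asboolP; exact: msmoothM.
Qed.
HB.instance Definition _ :=
  GRing.isSubringClosed.Build (M -> R) msmooth_pred msmooth_subring.

Record smooth_fun := SmoothFun {
  sfun :> M -> R;
  _ : msmooth_pred sfun
}.

HB.instance Definition _ := [isSub for sfun].
HB.instance Definition _ := [Choice of smooth_fun by <:].
HB.instance Definition _ := 
  GRing.SubChoice_isSubComPzRing.Build _ _ smooth_fun msmooth_subring.

Lemma smooth_funP (f : smooth_fun) : msmooth f.
Proof. exact: asboolW (valP f). Qed.

Definition mk_smooth (f : M -> R) (sf : msmooth f) : smooth_fun :=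
  SmoothFun (introT (asboolP _) sf).

Definition cstS (c : R) : smooth_fun := mk_smooth (msmooth_cst c).

Lemma smooth_fun_eq (f g : smooth_fun) : (forall x, f x = g x) -> f = g.
Proof. by move=> fg; apply/val_inj/funext. Qed.

End SmoothFunctions.

(* A family of vector spaces over M together with its smooth sections. It is
   a vector bundle when these are the smooth sections for some atlas of local
   trivializations, see [is_vector_bundle]. *)
Record bundle (R : realType) (n : nat) (M : manifold R n) := Bundle {
  fibre :> M -> lmodType R;
  smooth_section : (forall m, fibre m) -> Prop;
  smooth_section0 : smooth_section (fun m => 0);
  smooth_sectionP : forall (f : smooth_fun M) (s t : forall m, fibre m),
    smooth_section s -> smooth_section t ->
    smooth_section (fun m => f m *: s m + t m)
}.

Record local_triv (R : realType) (n : nat) (M : manifold R n) (E : bundle M) :=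
  LocalTriv {
  triv_dom : set M;
  triv_rank : nat;
  triv_map : forall m, {linear E m -> 'rV[R]_triv_rank};
  triv_inv : forall m, 'rV[R]_triv_rank -> E m;
  triv_dom_open : open triv_dom;
  triv_mapK : forall m, triv_dom m -> cancel (triv_map m) (triv_inv m);
  triv_invK : forall m, triv_dom m -> cancel (triv_inv m) (triv_map m)
}.

Arguments triv_map {R n M E} _ _.
Arguments triv_inv {R n M E} _ _.

Arguments smooth_section {R n M} _ _.

Section VectorBundle.
Context {R : realType} {n : nat} {M : manifold R n}.
Variable E : bundle M.

Definition triv_compat (t t' : local_triv E) :=
  forall (w : 'rV[R]_(triv_rank t)) (k : 'I_(triv_rank t')),
    msmooth_on (triv_dom t `&` triv_dom t')
               (fun m => triv_map t' m (triv_inv t m w) 0 k).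

Definition is_vector_bundle := exists A : set (local_triv E),
  [/\ forall m, exists2 t, A t & triv_dom t m,
      forall t t', A t -> A t' -> triv_compat t t' &
      forall s : forall m, E m,
        smooth_section E s <->
        forall t, A t -> forall k : 'I_(triv_rank t),
          msmooth_on (triv_dom t) (fun m => triv_map t m (s m) 0 k)].

Definition raw_section := forall m : M, E m.
HB.instance Definition _ := gen_eqMixin raw_section.
HB.instance Definition _ := gen_choiceMixin raw_section.

Section RawSection.
Implicit Types (s t u : raw_section) (f g : smooth_fun M).

Let rs0 : raw_section := fun m => 0.
Let rsN s : raw_section := fun m => - s m.
Let rsD s t : raw_section := fun m => s m + t m.
Let rsZ f s : raw_section := fun m => f m *: s m.

Let rsDA : associative rsD.
Proof. by move=> s t u; apply/functional_extensionality_dep => m; exact: addrA. Qed.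
Let rsDC : commutative rsD.
Proof. by move=> s t; apply/functional_extensionality_dep => m; exact: addrC. Qed.
Let rs0D : left_id rs0 rsD.
Proof. by move=> s; apply/functional_extensionality_dep => m; exact: add0r. Qed.
Let rsND : left_inverse rs0 rsN rsD.
Proof. by move=> s; apply/functional_extensionality_dep => m; exact: addNr. Qed.
HB.instance Definition _ :=
  GRing.isZmodule.Build raw_section rsDA rsDC rs0D rsND.

Let rsZA f g s : rsZ f (rsZ g s) = rsZ (f * g) s.
Proof. by apply/functional_extensionality_dep => m; exact: scalerA. Qed.
Let rs1Z : left_id 1 rsZ.
Proof. by move=> s; apply/functional_extensionality_dep => m; exact: scale1r. Qed.
Let rsZDr : right_distributive rsZ +%R.
Proof. by move=> f s t; apply/functional_extensionality_dep => m; exact: scalerDr. Qed.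
Let rsZDl s : {morph rsZ^~ s : f g / f + g}.
Proof. by move=> f g; apply/functional_extensionality_dep => m; exact: scalerDl. Qed.
HB.instance Definition _ :=
  GRing.Zmodule_isLmodule.Build (smooth_fun M) raw_section rsZA rs1Z rsZDr rsZDl.
End RawSection.

Definition section_pred : {pred raw_section} := fun s => `[< smooth_section E s >].

Lemma section_submod : submod_closed section_pred.
Proof.
split; first exact/asboolP/smooth_section0.
by move=> f s t /asboolP ss /asboolP st; exact/asboolP/smooth_sectionP.
Qed.
HB.instance Definition _ :=
  GRing.isSubmodClosed.Build (smooth_fun M) raw_section section_pred section_submod.

(* The smooth_fun M-module of smooth sections of E. *)
Record section := MkSection {
  sec :> forall m, E m;
  _ : section_pred sec
}.

HB.instance Definition _ := [isSub for (sec : section -> raw_section)].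
HB.instance Definition _ := [Choice of section by <:].
HB.instance Definition _ := [SubChoice_isSubLmodule of section by <:].

Lemma sectionP (s : section) : smooth_section E s.
Proof. exact: asboolW (valP s). Qed.

Definition mk_section (s : forall m, E m) (ss : smooth_section E s) : section :=
  MkSection (introT (asboolP _) ss : section_pred s).

Lemma section_eq (s t : section) : (forall m, s m = t m) -> s = t.
Proof. by move=> st; apply/val_inj/functional_extensionality_dep. Qed.

End VectorBundle.

Section Tangent.
Context {R : realType} {n : nat} {M : manifold R n}.
Variable m : M.

(* R-linear derivations at m; R acts on smooth functions through constants. *)
Definition is_derivation_at (v : smooth_fun M -> R) :=
  [/\ forall f g, v (f + g) = v f + v g,
      forall (c : R) f, v (cstS M c * f) = c * v f &
      forall f g, v (f * g) = f m * v g + g m * v f].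

Definition derivation_pred : {pred (smooth_fun M -> R^o)} :=
  fun v => `[< is_derivation_at v >].

Lemma derivation_submod : submod_closed derivation_pred.
Proof.
split; first by apply/asboolP; split=> *; rewrite /= ?(mulr0, addr0).
move=> a v w /asboolP[vD vZ vL] /asboolP[wD wZ wL]; apply/asboolP.
have E h : (a *: v + w) h = a * v h + w h by [].
split.
- by move=> f g; rewrite !E vD wD; ring.
- by move=> c f; rewrite !E vZ wZ; ring.
- by move=> f g; rewrite !E vL wL; ring.
Qed.
HB.instance Definition _ :=
  GRing.isSubmodClosed.Build R (smooth_fun M -> R^o) derivation_pred
    derivation_submod.

Record tangent := Tangent {
  tangent_fun :> smooth_fun M -> R;
  _ : derivation_pred tangent_fun
}.

HB.instance Definition _ :=
  [isSub for (tangent_fun : tangent -> smooth_fun M -> R^o)].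
HB.instance Definition _ := [Choice of tangent by <:].
HB.instance Definition _ := [SubChoice_isSubLmodule of tangent by <:].

Lemma tangentP (v : tangent) : is_derivation_at v.
Proof. exact: asboolW (valP v). Qed.

Definition mk_tangent (v : smooth_fun M -> R) (dv : is_derivation_at v) : tangent :=
  @Tangent v (introT (asboolP _) dv).

Definition is_linear_form (xi : tangent -> R) :=
  forall (a : R) (v w : tangent), xi (a *: v + w) = a * xi v + xi w.

Definition linear_form_pred : {pred (tangent -> R^o)} :=
  fun xi => `[< is_linear_form xi >].

Lemma linear_form_submod : submod_closed linear_form_pred.
Proof.
split; first by apply/asboolP => a v w; rewrite /= mulr0 addr0.
move=> a xi eta /asboolP lxi /asboolP leta; apply/asboolP => b v w.
have E u : (a *: xi + eta) u = a * xi u + eta u by [].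
by rewrite !E lxi leta; ring.
Qed.
HB.instance Definition _ :=
  GRing.isSubmodClosed.Build R (tangent -> R^o) linear_form_pred
    linear_form_submod.

Record cotangent := Cotangent {
  cotangent_fun :> tangent -> R;
  _ : linear_form_pred cotangent_fun
}.

HB.instance Definition _ :=
  [isSub for (cotangent_fun : cotangent -> tangent -> R^o)].
HB.instance Definition _ := [Choice of cotangent by <:].
HB.instance Definition _ := [SubChoice_isSubLmodule of cotangent by <:].

Lemma cotangentP (xi : cotangent) : is_linear_form xi.
Proof. exact: asboolW (valP xi). Qed.

Definition mk_cotangent (xi : tangent -> R) (lxi : is_linear_form xi) : cotangent :=
  @Cotangent xi (introT (asboolP _) lxi).

End Tangent.

Section TangentBundle.
Context {R : realType} {n : nat}.
Variable M : manifold R n.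

Definition smooth_vf (X : forall m : M, tangent m) :=
  forall f : smooth_fun M, msmooth (fun m => X m f).

Lemma smooth_vf0 : smooth_vf (fun m => 0).
Proof. by move=> f; exact: msmooth_cst. Qed.

Lemma smooth_vfP (f : smooth_fun M) (X Y : forall m : M, tangent m) :
  smooth_vf X -> smooth_vf Y -> smooth_vf (fun m => f m *: X m + Y m).
Proof.
move=> sX sY g; apply: (@msmoothD _ _ _ (f \* (fun m => X m g)) (fun m => Y m g)).
- exact/msmoothM/sX/smooth_funP.
- exact: sY.
Qed.

Definition tangent_bundle : bundle M :=
  @Bundle R n M (fun m => tangent m) smooth_vf smooth_vf0 smooth_vfP.

Definition smooth_oneform (xi : forall m : M, cotangent m) :=
  forall X : section tangent_bundle, msmooth (fun m => xi m (X m)).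

Lemma smooth_oneform0 : smooth_oneform (fun m => 0).
Proof. by move=> X; exact: msmooth_cst. Qed.

Lemma smooth_oneformP (f : smooth_fun M) (xi eta : forall m : M, cotangent m) :
  smooth_oneform xi -> smooth_oneform eta ->
  smooth_oneform (fun m => f m *: xi m + eta m).
Proof.
move=> sxi seta X.
apply: (@msmoothD _ _ _ (f \* (fun m => xi m (X m))) (fun m => eta m (X m))).
- exact/msmoothM/sxi/smooth_funP.
- exact: seta.
Qed.

Definition cotangent_bundle : bundle M :=
  @Bundle R n M (fun m => cotangent m) smooth_oneform smooth_oneform0
    smooth_oneformP.

End TangentBundle.

Notation vector_field M := (section (tangent_bundle M)).
Notation oneform M := (section (cotangent_bundle M)).

Section Cartan.
Context {R : realType} {n : nat} {M : manifold R n}.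
Implicit Types (X Y : vector_field M) (xi : oneform M).
Implicit Types f g : smooth_fun M.

Definition vf_app X f : smooth_fun M := mk_smooth (sectionP X f).

Definition contract xi X : smooth_fun M := mk_smooth (sectionP xi X).

Lemma vf_appD X f g : vf_app X (f + g) = vf_app X f + vf_app X g.
Proof. by apply: smooth_fun_eq => m /=; case: (tangentP (X m)) => + _ _; apply. Qed.

Lemma vf_appZ X c f : vf_app X (cstS M c * f) = cstS M c * vf_app X f.
Proof. by apply: smooth_fun_eq => m /=; case: (tangentP (X m)) => _ + _; apply. Qed.

Lemma vf_appM X f g : vf_app X (f * g) = f * vf_app X g + g * vf_app X f.
Proof. by apply: smooth_fun_eq => m /=; case: (tangentP (X m)) => _ _; apply. Qed.

Lemma lie_bracket_subproof X Y m : is_derivation_at m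
  (fun f => X m (vf_app Y f) - Y m (vf_app X f)).
Proof.
have [XD XZ XL] := tangentP (X m); have [YD YZ YL] := tangentP (Y m); split.
- by move=> f g; rewrite !vf_appD XD YD; ring.
- by move=> c f; rewrite !vf_appZ XZ YZ; ring.
- by move=> f g; rewrite !vf_appM XD YD !XL !YL /=; ring.
Qed.

Lemma lie_bracket_smooth X Y :
  smooth_vf (fun m => mk_tangent (lie_bracket_subproof X Y m)).
Proof.
by move=> f; exact: (smooth_funP (vf_app X (vf_app Y f) - vf_app Y (vf_app X f))).
Qed.

Definition lie_bracket X Y : vector_field M :=
  @mk_section _ _ _ (tangent_bundle M) _ (lie_bracket_smooth X Y).

Lemma diff_subproof f (m : M) : is_linear_form (fun v : tangent m => v f).
Proof. by []. Qed.

Lemma diff_smooth f : smooth_oneform (fun m => mk_cotangent (@diff_subproof f m)).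
Proof. by move=> X; exact: sectionP X f. Qed.

Definition diff f : oneform M :=
  @mk_section _ _ _ (cotangent_bundle M) _ (diff_smooth f).

End Cartan.

Section Gauge.
Context {R : realType} {n : nat} {M : manifold R n}.
Variable E : bundle M.
Implicit Types (u v : section E) (f g : smooth_fun M).

(* The vector field j(d) is recorded along with d; it is determined by d
   wherever E has nonzero rank. *)
Definition is_gauge (d : (section E -> section E) * vector_field M) :=
  [/\ forall u v, d.1 (u + v) = d.1 u + d.1 v,
      forall (c : R) u, d.1 (cstS M c *: u) = cstS M c *: d.1 u &
      forall f u, d.1 (f *: u) = f *: d.1 u + vf_app d.2 f *: u].

Definition gauge_pred : {pred (section E -> section E) * vector_field M} :=
  fun d => `[< is_gauge d >].

Lemma gauge_submod : submod_closed gauge_pred.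
Proof.
split.
  apply/asboolP; split=> [u v|c u|f u] /=; rewrite ?addr0 ?scaler0 ?add0r//.
  have -> : vf_app (0 : vector_field M) f = 0 by apply: smooth_fun_eq.
  by rewrite scale0r.
move=> a [D X] [D' X'] /asboolP[DD DZ DL] /asboolP[DD' DZ' DL'].
move: DD DZ DL DD' DZ' DL' => /= DD DZ DL DD' DZ' DL'; apply/asboolP.
have E0 w : (a *: (D, X) + (D', X')).1 w = a *: D w + D' w by [].
split=> [u v|c u|f u]; rewrite !E0.
- by rewrite DD DD' scalerDr addrACA.
- by rewrite DZ DZ' scalerDr !scalerA [a * _]mulrC.
- rewrite DL DL' !scalerDr addrACA !scalerA [a * f]mulrC -scalerDl.
  by congr (_ + _ *: _); exact: smooth_fun_eq.
Qed.
HB.instance Definition _ :=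
  GRing.isSubmodClosed.Build (smooth_fun M)
    ((section E -> section E) * vector_field M)%type gauge_pred gauge_submod.

(* Sections of the gauge Lie algebroid of E. *)
Record gauge := Gauge {
  gauge_val : (section E -> section E) * vector_field M;
  _ : gauge_pred gauge_val
}.

HB.instance Definition _ := [isSub for gauge_val].
HB.instance Definition _ := [Choice of gauge by <:].
HB.instance Definition _ := [SubChoice_isSubLmodule of gauge by <:].

Definition gauge_op (d : gauge) : section E -> section E := (gauge_val d).1.
Coercion gauge_op : gauge >-> Funclass.

Definition symbol (d : gauge) : vector_field M := (gauge_val d).2.

Lemma gaugeP (d : gauge) : is_gauge (gauge_val d).
Proof. exact: asboolW (valP d). Qed.

Definition mk_gauge D X (dP : is_gauge (D, X)) : gauge :=
  @Gauge (D, X) (introT (asboolP _) dP).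

Lemma gaugeD (d : gauge) u v : d (u + v) = d u + d v.
Proof. by case: (gaugeP d) => + _ _; apply. Qed.

Lemma gaugeZ (d : gauge) c u : d (cstS M c *: u) = cstS M c *: d u.
Proof. by case: (gaugeP d) => _ + _; apply. Qed.

Lemma gaugeL (d : gauge) f u : d (f *: u) = f *: d u + vf_app (symbol d) f *: u.
Proof. by case: (gaugeP d) => _ _; apply. Qed.

Lemma gauge_bracket_subproof (d d' : gauge) :
  is_gauge (fun u => d (d' u) - d' (d u), lie_bracket (symbol d) (symbol d')).
Proof.
split=> [u v|c u|f u] /=.
- by rewrite !gaugeD opprD addrACA.
- by rewrite !gaugeZ scalerBr.
- rewrite !gaugeL !gaugeD !gaugeL.
  have -> : vf_app (lie_bracket (symbol d) (symbol d')) f =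
    vf_app (symbol d) (vf_app (symbol d') f) -
    vf_app (symbol d') (vf_app (symbol d) f) by apply: smooth_fun_eq.
  rewrite scalerBr scalerBl.
  have lem (V : zmodType) (x b c e x' e' : V) :
      x + b + (c + e) - (x' + c + (b + e')) = x - x' + (e - e').
    rewrite [c + e]addrC [b + e']addrC [x + b + _]addrACA [x' + c + _]addrACA.
    by rewrite [c + b]addrC [x' + e' + _]addrC addrKA opprD addrACA.
  exact: lem.
Qed.

Definition gauge_bracket (d d' : gauge) : gauge :=
  mk_gauge (gauge_bracket_subproof d d').

(* Sections of gl(E), as bundle endomorphisms. *)
Record endo := Endo {
  endo_map :> forall m : M, {linear E m -> E m};
  endo_smooth : forall u : section E, smooth_section E (fun m => endo_map m (u m))
}.

Lemma gauge_of_endo_subproof (Phi : endo) :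
  is_gauge (fun u => mk_section (endo_smooth Phi u), 0).
Proof.
split=> [u v|c u|f u] /=.
- by apply: section_eq => m; exact: linearD.
- by apply: section_eq => m; exact: linearZ.
have -> : vf_app (0 : vector_field M) f = 0 by apply: smooth_fun_eq.
by rewrite scale0r addr0; apply: section_eq => m; exact: linearZ.
Qed.

Definition gauge_of_endo (Phi : endo) : gauge :=
  mk_gauge (gauge_of_endo_subproof Phi).

Definition endo_id : endo :=
  @Endo (fun m => idfun) (fun u => sectionP u).

Section JetFibre.
Variable m : M.

Definition is_jet (nu : gauge -> E m) :=
  (forall f (d d' : gauge), nu (f *: d + d') = f m *: nu d + nu d') /\
  (forall Phi : endo,
     nu (gauge_of_endo Phi) = Phi m (nu (gauge_of_endo endo_id))).

Definition jet_pred : {pred gauge -> E m} := fun nu => `[< is_jet nu >].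

Lemma jet_submod : submod_closed jet_pred.
Proof.
split.
  have E0 d : (0 : gauge -> E m) d = 0 by [].
  by apply/asboolP; split=> [f d d'|Phi]; rewrite !E0 ?scaler0 ?addr0 ?linear0.
move=> a nu mu /asboolP[nuL nuE] /asboolP[muL muE]; apply/asboolP.
have E0 d : (a *: nu + mu) d = a *: nu d + mu d by [].
split=> [f d d'|Phi]; rewrite !E0.
- by rewrite nuL muL !scalerDr !scalerA mulrC addrACA.
- by rewrite nuE muE linearP.
Qed.
HB.instance Definition _ :=
  GRing.isSubmodClosed.Build R (gauge -> E m) jet_pred jet_submod.

(* A C^oo(M)-linear map from the sections of the gauge algebroid to E m is the
   same as a linear map from the fibre at m of that algebroid. *)
Record jet := Jet {
  jet_fun :> gauge -> E m;
  _ : jet_pred jet_fun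
}.

HB.instance Definition _ := [isSub for jet_fun].
HB.instance Definition _ := [Choice of jet by <:].
HB.instance Definition _ := [SubChoice_isSubLmodule of jet by <:].

Lemma jetP (nu : jet) : is_jet nu.
Proof. exact: asboolW (valP nu). Qed.

Definition mk_jet (nu : gauge -> E m) (nuP : is_jet nu) : jet :=
  @Jet nu (introT (asboolP _) nuP).

End JetFibre.

Definition smooth_jet (nu : forall m : M, jet m) :=
  forall d : gauge, smooth_section E (fun m => nu m d).

Lemma smooth_jet0 : smooth_jet (fun m => 0).
Proof. by move=> d; exact: smooth_section0. Qed.

Lemma smooth_jetP f (nu mu : forall m : M, jet m) :
  smooth_jet nu -> smooth_jet mu -> smooth_jet (fun m => f m *: nu m + mu m).
Proof. by move=> snu smu d; exact: (smooth_sectionP f (snu d) (smu d)). Qed.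

Definition jet_bundle : bundle M :=
  @Bundle R n M (fun m => jet m) smooth_jet smooth_jet0 smooth_jetP.

Lemma prolong_subproof u m : is_jet (fun d : gauge => d u m).
Proof. by []. Qed.

Lemma prolong_smooth u : smooth_jet (fun m => mk_jet (prolong_subproof u m)).
Proof. by move=> d; exact: sectionP. Qed.

Definition prolong u : section jet_bundle :=
  @mk_section _ _ _ jet_bundle _ (prolong_smooth u).

Lemma tens_subproof (xi : oneform M) u m :
  is_jet (fun d : gauge => xi m (symbol d m) *: u m).
Proof.
split=> [f d d'|Phi].
- have -> : symbol (f *: d + d') m = f m *: symbol d m + symbol d' m by [].
  by rewrite cotangentP scalerDl scalerA.
- have x0 : xi m 0 = 0.
    have := cotangentP (xi m) (-1) 0 0.
    by rewrite scaler0 addr0 mulN1r addNr.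
  have -> Psi : symbol (gauge_of_endo Psi) m = 0 by [].
  by rewrite x0 !scale0r linear0.
Qed.

Lemma tens_smooth (xi : oneform M) u :
  smooth_jet (fun m => mk_jet (tens_subproof xi u m)).
Proof.
by move=> d; exact: (sectionP (contract xi (symbol d) *: u)).
Qed.

(* The one-form xi (x) u with values in E, as a section of the jet bundle. *)
Definition tens (xi : oneform M) u : section jet_bundle :=
  @mk_section _ _ _ jet_bundle _ (tens_smooth xi u).

End Gauge.

Section Pairing.
Context {R : realType} {n : nat} {M : manifold R n}.

Lemma trivial_section0 : @msmooth R n M (fun m => 0).
Proof. exact: msmooth_cst. Qed.

Lemma trivial_sectionP (f : smooth_fun M) (s t : M -> R^o) :
  msmooth s -> msmooth t -> msmooth (fun m => f m *: s m + t m).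
Proof.
by move=> ss st; exact: (msmoothD (msmoothM (smooth_funP f) ss) st).
Qed.

Definition trivial_line : bundle M :=
  @Bundle R n M (fun=> R^o) (@msmooth R n M) trivial_section0 trivial_sectionP.

Record pairing (K E : bundle M) := Pairing {
  pair_map :> forall m, K m -> K m -> E m;
  pair_linearl : forall m a x x' y,
    @pair_map m (a *: x + x') y = a *: @pair_map m x y + @pair_map m x' y;
  pair_linearr : forall m a x y y',
    @pair_map m x (a *: y + y') = a *: @pair_map m x y + @pair_map m x y';
  pair_smooth : forall s t : section K,
    smooth_section E (fun m => @pair_map m (s m) (t m))
}.

Definition pair_sec K E (p : pairing K E) (s t : section K) : section E :=
  mk_section (pair_smooth p s t).

Definition pair_fun K (p : pairing K trivial_line) (s t : section K) :
  smooth_fun M := mk_smooth (pair_smooth p s t).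

Definition symmetric_pairing K E (p : pairing K E) :=
  forall m x y, p m x y = p m y x.

Definition nondegenerate_pairing K E (p : pairing K E) :=
  forall m x, (forall y, p m x y = 0) -> x = 0.

Record leibniz_algebra (K : bundle M)
    (br : section K -> section K -> section K) : Prop := LeibnizAlgebra {
  leibniz_addl : forall X Y Z, br (X + Y) Z = br X Z + br Y Z;
  leibniz_addr : forall X Y Z, br X (Y + Z) = br X Y + br X Z;
  leibniz_scalel : forall (c : R) X Y,
    br (cstS M c *: X) Y = cstS M c *: br X Y;
  leibniz_scaler : forall (c : R) X Y,
    br X (cstS M c *: Y) = cstS M c *: br X Y;
  leibniz_jacobi : forall X Y Z, br X (br Y Z) = br (br X Y) Z + br Y (br X Z)
}.

End Pairing.

(* Vector bundle morphisms to TM and to the gauge algebroid are given by the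
   induced C^oo(M)-linear maps of sections. *)
Record courant_data (R : realType) (n : nat) (M : manifold R n) :=
  CourantData {
  ca_bundle :> bundle M;
  ca_form : pairing ca_bundle trivial_line;
  ca_bracket : section ca_bundle -> section ca_bundle -> section ca_bundle;
  ca_anchor : {linear section ca_bundle -> vector_field M}
}.

Arguments ca_bracket {R n M} _ _ _.

Section Courant.
Context {R : realType} {n : nat} {M : manifold R n}.
Variable C : courant_data M.

Definition is_coanchor (xi : oneform M) (s : section C) :=
  forall (X : section C) (m : M),
    ca_form C m (s m) (X m) = 2^-1 * xi m (ca_anchor C X m).

(* The section s such that <s, X> = 1/2 xi(a(X)) for all X: it is unique and
   exists because the form is nondegenerate. *)
Definition coanchor (xi : oneform M) : section C := xget 0 (is_coanchor xi).

Record is_courant : Prop := IsCourant {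
  ca_vector_bundle : is_vector_bundle C;
  ca_sym : symmetric_pairing (ca_form C);
  ca_nondeg : nondegenerate_pairing (ca_form C);
  ca_leibniz : leibniz_algebra (ca_bracket C);
  ca_anchor_bracket : forall X Y,
    ca_anchor C (ca_bracket C X Y) = lie_bracket (ca_anchor C X) (ca_anchor C Y);
  ca_invariant : forall X Y Z,
    vf_app (ca_anchor C X) (pair_fun (ca_form C) Y Z) =
    pair_fun (ca_form C) (ca_bracket C X Y) Z +
    pair_fun (ca_form C) Y (ca_bracket C X Z);
  ca_square : forall X,
    ca_bracket C X X = coanchor (diff (pair_fun (ca_form C) X X));
  ca_anchor_coanchor : forall xi, ca_anchor C (coanchor xi) = 0
}.

End Courant.

Record ecourant_data (R : realType) (n : nat) (M : manifold R n)
    (E K : bundle M) := ECourantData {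
  ec_pairing : pairing K E;
  ec_bracket : section K -> section K -> section K;
  ec_anchor : {linear section K -> gauge E}
}.

Arguments ec_bracket {R n M E K} _ _ _.

Section ECourant.
Context {R : realType} {n : nat} {M : manifold R n}.
Variables (E K : bundle M) (S : ecourant_data E K).

Definition is_rho_star (mu : section (jet_bundle E)) (k : section K) :=
  forall (X : section K) (m : M),
    ec_pairing S m (k m) (X m) = 2^-1 *: mu m (ec_anchor S X).

(* rho^*(mu), identified with a section of K; it exists under axiom
   [ec_rho_star_in] below. *)
Definition rho_star (mu : section (jet_bundle E)) : section K :=
  xget 0 (is_rho_star mu).

Record is_ecourant : Prop := IsECourant {
  ec_vector_bundle_coef : is_vector_bundle E;
  ec_vector_bundle : is_vector_bundle K;
  ec_sym : symmetric_pairing (ec_pairing S);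
  ec_nondeg : nondegenerate_pairing (ec_pairing S);
  ec_leibniz : leibniz_algebra (ec_bracket S);
  ec_anchor_bracket : forall X Y,
    ec_anchor S (ec_bracket S X Y) = gauge_bracket (ec_anchor S X) (ec_anchor S Y);
  ec_square : forall X,
    ec_bracket S X X = rho_star (prolong (pair_sec (ec_pairing S) X X));
  ec_invariant : forall X Y Z,
    ec_anchor S X (pair_sec (ec_pairing S) Y Z) =
    pair_sec (ec_pairing S) (ec_bracket S X Y) Z +
    pair_sec (ec_pairing S) Y (ec_bracket S X Z);
  ec_rho_star_in : forall mu, exists k, is_rho_star mu k;
  ec_anchor_rho_star : forall mu, ec_anchor S (rho_star mu) = 0
}.

End ECourant.

Section JetCourant.
Context {R : realType} {n : nat} {M : manifold R n}.
Variable C : courant_data M.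

Local Notation a := (ca_anchor C).
Local Notation "<[ X , Y ]>" := (pair_fun (ca_form C) X Y).
Local Notation "[[ X , Y ]]" := (ca_bracket C X Y).

Record is_jet_courant
    (S : ecourant_data (cotangent_bundle M) (jet_bundle C)) : Prop :=
  IsJetCourant {
  jc_pair_sym : symmetric_pairing (ec_pairing S);
  jc_pair_dd : forall X Y : section C,
    pair_sec (ec_pairing S) (prolong X) (prolong Y) = diff <[X, Y]>;
  jc_pair_dt : forall (X Y : section C) f,
    pair_sec (ec_pairing S) (prolong X) (tens (diff f) Y) = <[X, Y]> *: diff f;
  jc_pair_tt : forall (X Y : section C) f g,
    pair_sec (ec_pairing S) (tens (diff f) X) (tens (diff g) Y) = 0;

  (* rho(dX) is the Lie derivative along a(X), by its defining formula
     (L_V xi)(Y) = V(xi(Y)) - xi([V, Y]). *)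
  jc_anchor_d : forall (X : section C) (xi : oneform M) (Y : vector_field M),
    contract (ec_anchor S (prolong X) xi) Y =
    vf_app (a X) (contract xi Y) - contract xi (lie_bracket (a X) Y);
  jc_anchor_t : forall (X : section C) f (xi : oneform M),
    ec_anchor S (tens (diff f) X) xi = contract xi (a X) *: diff f;

  jc_bracket_dd : forall X Y : section C,
    ec_bracket S (prolong X) (prolong Y) = prolong [[X, Y]];
  jc_bracket_dt : forall (X Y : section C) f,
    ec_bracket S (prolong X) (tens (diff f) Y) =
    tens (diff f) [[X, Y]] + tens (diff (vf_app (a X) f)) Y;
  jc_bracket_td : forall (X Y : section C) f,
    ec_bracket S (tens (diff f) Y) (prolong X) =
    tens (diff f) [[Y, X]] - tens (diff (vf_app (a X) f)) Y +
    (<[X, Y]> *+ 2) *: prolong (coanchor C (diff f));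
  jc_bracket_tt : forall (X Y : section C) f g,
    ec_bracket S (tens (diff f) X) (tens (diff g) Y) =
    vf_app (a X) g *: tens (diff f) Y - vf_app (a Y) f *: tens (diff g) X;

  jc_bracket_addl : forall mu mu' nu,
    ec_bracket S (mu + mu') nu = ec_bracket S mu nu + ec_bracket S mu' nu;
  jc_bracket_addr : forall mu nu nu',
    ec_bracket S mu (nu + nu') = ec_bracket S mu nu + ec_bracket S mu nu';
  jc_bracket_scaler : forall f mu nu,
    ec_bracket S mu (f *: nu) =
    f *: ec_bracket S mu nu + vf_app (symbol (ec_anchor S mu)) f *: nu;
  (* The last term is 2 rho^*(df (x) (mu, nu)), where
     rho^*(df (x) xi) = xi (x) a^*(df). *)
  jc_bracket_scalel : forall f mu nu,
    ec_bracket S (f *: mu) nu =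
    f *: ec_bracket S mu nu - vf_app (symbol (ec_anchor S nu)) f *: mu +
    tens (pair_sec (ec_pairing S) mu nu) (coanchor C (diff f)) *+ 2
}.

End JetCourant.

(* Main.v *)
From HB Require Import structures.
Require Import Defs.
From mathcomp Require Import all_boot all_order all_algebra.
From mathcomp Require Import all_classical all_reals all_analysis.
From mathcomp Require Import ring lra.

Set Implicit Arguments.
Unset Strict Implicit.
Unset Printing Implicit Defensive.

Import Order.TTheory GRing.Theory Num.Theory.
Import numFieldNormedType.Exports.
(* From here on [diff f] is the one-form df, not a differential between normed
   spaces. *)
Import Defs.

Local Open Scope classical_set_scope.
Local Open Scope ring_scope.

(** A section of the jet bundle of a vector bundle E is the same as a pair
    (X, w) of a section X of E and a C^oo(M)-linear map w from vector fields to
    sections of E (the Spencer decomposition): the jet is d X + w, and it sends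
    a derivation D of E with symbol V to D X + w V. In these terms the
    structure on the jets of C is given by closed formulas. For mu = d X + w
    and nu = d Y + z, and with a the anchor of C and V a vector field,
    - (mu, nu)(V) = V<X, Y> + <X, z V> + <w V, Y>;
    - rho(mu)(xi)(V) = a(X)(xi V) - xi [a X, V] + xi (a (w V));
    - [d X, d Y] = d [X, Y], [d X, z] = L_X z with
      (L_X z) V = [X, z V] - z [a X, V], [w, z] = z a w - w a z, and
      [w, d X] = - [d X, w] + 2 rho^* d <w, X>,
    where rho^* d xi = d (a^* xi) - a^* (iota_V d xi). The last clause builds
    the symmetric part [mu, nu] + [nu, mu] = 2 rho^* d (mu, nu) into the
    definition ([jbracket_sym]). With these formulas the invariance of the
    pairing ([jpair_invariant]), the compatibility of anchor and bracket
    ([rho_bracket]), rho rho^* d = 0 ([rho_rho_star_d]) and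
    (rho^* d xi, nu) = 1/2 rho(nu) xi ([jpair_rho_star_d]) are direct
    computations with the axioms of C.

    The other axioms follow formally, because the pairing is nondegenerate.
    The Leibniz rules come from invariance. Invariance and the compatibility of
    anchor and bracket give [mu, rho^* d xi] = rho^* d (rho(mu) xi), hence
    [rho^* d xi, mu] = 0. These two facts make the Jacobiator antisymmetric in
    its three arguments, so that it has to be computed only on triples of the
    forms (d, d, d), (d, d, w), (d, w, w) and (w, w, w), where the simple
    formulas for the bracket apply.

    Uniqueness holds since the jets d X and df (x) X span every fibre
    ([jet_generated]) and a C^oo(M)-linear map that vanishes on them vanishes
    ([tensorial]): this applies to the difference of two candidates for the
    pairing, then for the anchor, then for the bracket, whose two Leibniz rules
    involve only the pairing and the anchor. The symbol of the anchor is
    determined by its action on one-forms because M has positive dimension.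

    All of this works with global sections. The passage from sections to fibres
    uses bump functions ([bump_exists]), which turn a local trivialization into
    global sections that form a frame near a given point ([local_frame]), and
    local coordinates in which every derivation at a point is a combination
    of partial derivatives ([local_coordinates]). The latter needs Hadamard's
    lemma, and with it the smoothness in y of int_0^1 h(y0 + t(y - y0)) dt
    for smooth h. *)

(** * Functions of class C^k on an open set *)

Lemma eq_double0 (V : zmodType) (x : V) : x = x + x -> x = 0.
Proof. by move=> /eqP; rewrite -subr_eq0 opprD addNKr oppr_eq0 => /eqP. Qed.

Section CkGeneral.
Context {R : realType} {V : normedModType R}.
Implicit Types (U W : set V) (f g : V -> R) (k : nat).

Lemma Ck_on_subset k U W f : U `<=` W -> Ck_on k W f -> Ck_on k U f.
Proof.
move=> UW; elim: k f => [|k IH] f [fc fd]; split=> //; try by move=> x /UW/fc.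
by move=> v; have [fv Df] := fd v; split=> [x /UW/fv//|]; exact: IH.
Qed.

Lemma Ck_on_local k U f :
  (forall x, U x -> exists2 W, W x & Ck_on k W f) -> Ck_on k U f.
Proof.
elim: k f => [|k IH] f loc; split=> //.
- by move=> x /loc[W Wx [fc _]]; exact: fc.
- by move=> x /loc[W Wx [fc _]]; exact: fc.
move=> v; split.
  by move=> x /loc[W Wx [_ /(_ v)[fd _]]]; exact: fd.
by apply: IH => x /loc[W Wx [_ /(_ v)[_ Df]]]; exists W.
Qed.

Lemma Ck_on_weaken k l U f : (k <= l)%N -> Ck_on l U f -> Ck_on k U f.
Proof.
move=> kl; rewrite -(subnK kl); elim: (l - k)%N => [|j IH] //.
by rewrite addSn => /Ck_onS.
Qed.

Lemma Ck_on_continuous k U f x : Ck_on k U f -> U x -> {for x, continuous f}.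
Proof. by case: k => [|k] [fc _]; exact: fc. Qed.

Lemma Ck_on_sum k U (I : Type) (r : seq I) (F : I -> V -> R) : open U ->
  (forall i, Ck_on k U (F i)) -> Ck_on k U (fun x => \sum_(i <- r) F i x).
Proof.
move=> oU CF; elim: r => [|i r IH].
  by apply: eq_Ck_on (Ck_on_cst k 0 oU) => // x _; rewrite big_nil.
apply: eq_Ck_on (Ck_onD oU (CF i) IH) => // x _.
by rewrite big_cons.
Qed.

Lemma Ck_onMl k U c f : open U -> Ck_on k U f -> Ck_on k U (fun x => c * f x).
Proof. by move=> oU Cf; exact: (Ck_onM oU (Ck_on_cst k c oU) Cf). Qed.

Lemma Ck_onV k U f : open U -> (forall x, U x -> f x != 0) ->
  Ck_on k U f -> Ck_on k U (fun x => (f x)^-1).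
Proof.
move=> oU f0; elim: k => [|k IH] Cf; move: (Cf) => [fc fd]; split => //.
- by move=> x Ux; apply: cvgV; [exact: f0|exact: fc].
- by move=> x Ux; apply: cvgV; [exact: f0|exact: fc].
move=> v; have [fv Df] := fd v; split=> [x Ux|].
  by apply: derivableV; [exact: f0|exact: fv].
have CV := IH (Ck_onS Cf).
apply: eq_Ck_on (Ck_onM oU (Ck_onMl (-1) oU (Ck_onM oU CV CV)) Df) => //.
move=> x Ux /=.
rewrite deriveV ?f0//; last exact: fv.
by rewrite expr2 invfM mulN1r.
Qed.

Lemma line_derive f (a v : V) (t : R) : derivable f (a + t *: v) v ->
  is_derive t 1 (fun s : R => f (a + s *: v)) ('D_v f (a + t *: v)).
Proof.
move=> df.
have E : (fun h : R => h^-1 *: (f (a + (h *: 1 + t) *: v) - f (a + t *: v))) =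
         (fun h : R => h^-1 *: (f (h *: v + (a + t *: v)) - f (a + t *: v))).
  apply/funext => h; rewrite [h *: 1]mulr1 scalerDl addrCA.
  by [].
apply: DeriveDef.
  by rewrite /derivable /= E.
by rewrite /derive /= E.
Qed.

End CkGeneral.

(** * From partial derivatives to the chain rule *)

Section MeanValue.
Context {R : realType}.

(** The interval between 0 and c, whatever the sign of c: this is the form
    needed to move along a coordinate axis. *)
Lemma MVT_signed (f df : R -> R) (c : R) :
  (forall t : R, `|t| <= `|c| -> is_derive t (1 : R) f (df t)) ->
  exists2 t, `|t| <= `|c| & f c - f 0 = df t * c.
Proof.
move=> d.
have cont a b : (forall t, t \in `[a, b] -> `|t| <= `|c|) ->
    {within `[a, b], continuous f}.
  move=> h; apply: derivable_within_continuous => t /h /d [].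
  by [].
have [c0|c0] := leP 0 c.
  have h t : t \in `[0, c] -> `|t| <= `|c|.
    by rewrite in_itv/= => /andP[t0 tc]; rewrite !ger0_norm.
  have [||t tc E] := @MVT_segment R f df 0 c c0.
  - move=> t tc; apply/d/h; move: tc; rewrite !in_itv/= => /andP[/ltW-> /ltW->].
    by [].
  - by apply: cont.
  - by exists t; [exact: h|rewrite E subr0].
have h t : t \in `[c, 0] -> `|t| <= `|c|.
  rewrite in_itv/= => /andP[t0 tc]; rewrite !ler0_norm ?(ltW c0)//.
  by rewrite lerN2.
have [||t tc E] := @MVT_segment R f df c 0 (ltW c0).
- move=> t tc; apply/d/h; move: tc; rewrite !in_itv/= => /andP[/ltW-> /ltW->].
  by [].
- by apply: cont.
- exists t; first exact: h.
  by rewrite -opprB E sub0r mulrN opprK.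
Qed.

End MeanValue.

(** An explicit candidate for the differential, with an epsilon bound in place
    of a little-o. *)
Lemma differentiable_of_bound (R : realType) (V W : normedModType R)
    (f : V -> W) (df : {linear V -> W}) (x : V) : continuous df ->
  (forall e : R, 0 < e ->
     \forall h \near (0 : V), `|f (h + x) - (f x + df h)| <= e * `|h|) ->
  differentiable f x.
Proof.
move=> cdf H.
have key : f \o shift x = cst (f x) + df +o_ 0 id.
  by apply/eqaddoP => e /H.
by apply/diff_locallyP; rewrite (diff_unique cdf key).
Qed.

Section RowSpace.
Context {R : realType} {n : nat}.
Local Notation V := 'rV[R]_n.
Implicit Types (U W : set V) (f g : V -> R).

Local Notation e_ i := (delta_mx 0 i : V).

Lemma row_norm_le (x : V) i : `|x 0 i| <= `|x|.
Proof.
rewrite [leRHS]/Num.Def.normr/= mx_normrE.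
by apply: le_trans (le_bigmax _ _ (0, i)).
Qed.

Lemma row_norm_leP (x : V) r : 0 <= r -> (forall i, `|x 0 i| <= r) -> `|x| <= r.
Proof.
move=> r0 H; rewrite [leLHS]/Num.Def.normr/= mx_normrE.
by apply: bigmax_le => // -[i j] _; rewrite ord1.
Qed.

Lemma derive_coord (x v : V) i :
  is_derive x v (fun y : V => y 0 i) (v 0 i).
Proof.
have dl := @differentiable_coord R _ _ x 0 i.
apply: DeriveDef; first exact: diff_derivable.
rewrite deriveE//.
pose L : V -> R := fun y => y 0 i.
have lL : linear L by move=> a y z; rewrite /L !mxE.
pose LL : {linear V -> R} :=
  HB.pack L (GRing.isLinear.Build _ _ _ _ L lL).
by have := @diff_lin _ _ _ LL x; move=> ->//; exact: coord_continuous.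
Qed.

Lemma Ck_on_coord k U i : open U -> Ck_on k U (fun y : V => y 0 i).
Proof.
move=> oU; case: k => [|k]; split=> //.
- by move=> x _; exact: coord_continuous.
- by move=> x _; exact: coord_continuous.
move=> v; split=> [x Ux|]; first by have [] := derive_coord x v i.
apply: eq_Ck_on (Ck_on_cst k (v 0 i) oU) => // x _ /=.
by have [_ ->] := derive_coord x v i.
Qed.

(* The first k coordinates of h: the vertices of the path from x to x + h. *)
Let trunc (h : V) (k : nat) : V := \row_i (if (i < k)%N then h 0 i else 0).

(** Moving from x to x + h one coordinate at a time, the mean value theorem
    expresses each step as h_i times a partial derivative at a point within |h|
    of x, and the partial derivatives are continuous. *)
Lemma C1_differentiable U f (x : V) : open U -> U x -> Ck_on 1 U f ->
  differentiable f x.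
Proof.
move=> oU Ux Cf.
pose D (i : 'I_n) (y : V) := 'D_(e_ i) f y.
have [fc fd] := Cf.
have Dc i : {for x, continuous (D i)}.
  by have [_ [Dc _]] := fd (e_ i); exact: Dc.
pose L : V -> R := fun h => \sum_i h 0 i * D i x.
have lL : linear L.
  move=> a y z; rewrite /L scaler_sumr -big_split/=.
  by apply: eq_bigr => i _; rewrite !mxE mulrDl -scalerAl.
pose LL : {linear V -> R} :=
  HB.pack L (GRing.isLinear.Build _ _ _ _ L lL).
have cL : continuous LL.
  have CL : Ck_on 0 setT L.
    apply: Ck_on_sum => [|i]; first exact: openT.
    apply: (Ck_onM openT (Ck_on_coord 0 i openT) (Ck_on_cst 0 _ openT)).
  by move=> y; exact: (Ck_on_continuous CL).
apply: (@differentiable_of_bound _ _ _ f LL) => // e e0.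
(* Each of the n steps may contribute e / (n + 1) times |h|. *)
pose e' := e / n.+1%:R.
have e'0 : 0 < e' by rewrite divr_gt0.
have : \forall y \near x, U y /\ forall i, `|D i x - D i y| < e'.
  have nU : nbhs x U by exact: open_nbhs_nbhs.
  have nD : nbhs x (fun y => forall i : 'I_n, `|D i x - D i y| < e').
    have := @filter_forall V 'I_n (fun i y => `|D i x - D i y| < e') (nbhs x) _.
    apply => i.
    by move: (Dc i) => /cvgrPdist_lt/(_ _ e'0).
  exact: filterI nU nD.
move=> /nbhs_ballP[d /= d0 Hd].
near=> h.
have hd : `|h| < d.
  by near: h; apply/nbhs_ballP; exists d => // y; rewrite
    mx_norm_ball /ball_/= sub0r normrN.
have inb y : `|y| <= `|h| -> U (x + y) /\ forall i, `|D i x - D i (x + y)| < e'.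
  move=> yh; apply: Hd; rewrite mx_norm_ball /ball_/=.
  by rewrite opprD addNKr normrN (le_lt_trans yh).
have step (i : 'I_n) :
    `|f (x + trunc h i.+1) - f (x + trunc h i) - h 0 i * D i x| <= e' * `|h|.
  have E : trunc h i.+1 = trunc h i + h 0 i *: e_ i.
    apply/rowP => j; rewrite !mxE ltnS leq_eqVlt eqxx/=.
    have [->|ne] := eqVneq j i; first by rewrite eqxx ltnn add0r mulr1.
    by rewrite -val_eqE/= in ne; rewrite (negbTE ne)/= mulr0 addr0.
  have tb t : `|t| <= `|h 0 i| -> `|trunc h i + t *: e_ i| <= `|h|.
    move=> th; apply: row_norm_leP => // j; rewrite !mxE.
    have [->|ne] := eqVneq j i.
      by rewrite ltnn add0r mulr1 (le_trans th)// row_norm_le.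
    rewrite mulr0 addr0; case: ifP => _; first exact: row_norm_le.
    by rewrite normr0.
  have [|t th] := @MVT_signed R (fun t => f ((x + trunc h i) + t *: e_ i))
      (fun t => D i ((x + trunc h i) + t *: e_ i)) (h 0 i).
    move=> t th; apply: line_derive.
    have [dd _] := fd (e_ i); apply: dd.
    by rewrite -addrA; apply: (inb _ _).1; exact: tb.
  rewrite scale0r addr0 -addrA -E => ->.
  rewrite [D i _ * _]mulrC -mulrBr normrM mulrC.
  apply: ler_pM => //; last exact: row_norm_le.
  rewrite distrC ltW//.
  rewrite -addrA; apply: (inb _ _).2; exact: tb.
have tel : f (h + x) - (f x + L h) =
    \sum_(i < n) (f (x + trunc h i.+1) - f (x + trunc h i) - h 0 i * D i x).
  rewrite big_split/= sumrN -/(L h) opprD addrA; congr (_ - _).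
  rewrite -(big_mkord xpredT (fun i => f (x + trunc h i.+1) - f (x + trunc h i))).
  rewrite telescope_sumr//; congr (_ - f _); last first.
    by rewrite (_ : trunc h 0 = 0) ?addr0//; apply/rowP => j; rewrite !mxE.
  congr f; rewrite addrC; congr (_ + _).
  by apply/rowP => j; rewrite !mxE ltn_ord.
rewrite tel.
apply: le_trans (ler_norm_sum _ _ _) _.
apply: le_trans (ler_sum _ (fun i _ => step i)) _.
rewrite sumr_const card_ord -mulr_natl mulrA ler_wpM2r//.
rewrite /e' mulrCA ler_piMr ?ltW//= ltr_pdivrMr ?ltr0n// mul1r.
by rewrite ltr_nat.
Unshelve. all: by end_near. Qed.

End RowSpace.

Section Chain.
Context {R : realType} {V : normedModType R}.

Lemma derive_along_line (W : normedModType R) (f : V -> W) (x v : V) :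
  'D_1 (fun h : R => f (h *: v + x)) 0 = 'D_v f x.
Proof.
rewrite /derive; set g1 := fun h => h^-1 *: _; set g2 := fun h => h^-1 *: _.
suff -> : g1 = g2 by [].
by rewrite funeqE /g1 /g2 => h /=; rewrite addr0 scale0r add0r [_%:A]mulr1.
Qed.

Lemma is_derive_comp1 (f : V -> R) (phi : R -> R) (d df : R) (x v : V) :
  is_derive x v f df -> is_derive (f x) (1 : R) phi d ->
  is_derive x v (phi \o f) (d * df).
Proof.
move=> [fd fE] [pd pE].
pose l (h : R) := f (h *: v + x).
have l0 : l 0 = f x by rewrite /l scale0r add0r.
have ld : differentiable l (0 : R).
  by apply/derivable1_diffP; move: fd => /derivable1P.
have pld : differentiable phi (l 0) by apply/derivable1_diffP; rewrite l0.
apply: DeriveDef.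
  apply/derivable1P/derivable1_diffP.
  exact: (differentiable_comp ld pld).
rewrite -derive_along_line deriveE; last exact: (differentiable_comp ld pld).
rewrite (@diff_comp _ _ _ _ l phi)//= -[X in 'd phi _ X]mulr1.
rewrite -[_ * 1]/(_ *: 1) linearZ/= -!deriveE//= derive_along_line fE l0 pE.
by rewrite [LHS]mulrC.
Qed.

Lemma is_derive_comp_row n (F : V -> 'rV[R]_n) (g : 'rV[R]_n -> R) (x v : V) :
  (forall i, derivable (fun y => F y 0 i) x v) -> differentiable g (F x) ->
  is_derive x v (g \o F)
    (\sum_i 'D_(delta_mx 0 i) g (F x) * 'D_v (fun y => F y 0 i) x).
Proof.
move=> Fd gd.
pose l (h : R) := F (h *: v + x).
have l0 : l 0 = F x by rewrite /l scale0r add0r.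
have Fd' : derivable F x v by apply/derivable_mxP => i j; rewrite ord1.
have ld : differentiable l (0 : R).
  by apply/derivable1_diffP; move: Fd' => /derivable1P.
have gld : differentiable g (l 0) by rewrite l0.
apply: DeriveDef.
  by apply/derivable1P/derivable1_diffP; exact: (differentiable_comp ld gld).
rewrite -derive_along_line deriveE; last exact: (differentiable_comp ld gld).
rewrite (@diff_comp _ _ _ _ l g)//=.
have -> : 'd l (0 : R) 1 = 'D_v F x by rewrite -deriveE// derive_along_line.
rewrite derive_mx// l0; set w := (X in 'd g _ X).
rewrite (row_sum_delta w) linear_sum; apply: eq_bigr => i _.
by rewrite linearZ /= -deriveE// mxE [LHS]mulrC.
Qed.

Lemma continuous_row n (F : V -> 'rV[R]_n) (x : V) :
  (forall i, {for x, continuous (fun y => F y 0 i)}) -> {for x, continuous F}.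
Proof.
move=> Fc; apply/cvgrPdist_le => e e0.
have H : nbhs x (fun y => forall i : 'I_n, `|F x 0 i - F y 0 i| <= e).
  have := @filter_forall V 'I_n (fun i y => `|F x 0 i - F y 0 i| <= e) (nbhs x) _.
  by apply => i; move: (Fc i) => /cvgrPdist_le/(_ _ e0).
apply: filterS H => y H; apply: row_norm_leP; first exact: ltW.
by move=> i; rewrite !mxE.
Qed.

(** The chain rule writes a derivative of g o F as a polynomial in first partial
    derivatives of g, composed with F, and derivatives of the components of F,
    so that k drops by one on both sides of the induction. *)
Lemma Ck_on_comp n k (U : set V) (W : set 'rV[R]_n) (F : V -> 'rV[R]_n)
    (g : 'rV[R]_n -> R) : open U -> open W -> (forall x, U x -> W (F x)) ->
  (forall i, Ck_on k U (fun y => F y 0 i)) -> Ck_on k W g ->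
  Ck_on k U (g \o F).
Proof.
move=> oU oW UW.
elim: k g => [|k IH] g CF Cg.
  split=> // x Ux; apply: continuous_comp.
    by apply: continuous_row => i; exact: Ck_on_continuous (CF i) Ux.
  exact: Ck_on_continuous Cg (UW _ Ux).
have gF x v : U x -> is_derive x v (g \o F)
    (\sum_i 'D_(delta_mx 0 i) g (F x) * 'D_v (fun y => F y 0 i) x).
  move=> Ux; apply: is_derive_comp_row.
    by move=> i; have [_ /(_ v)[+ _]] := CF i; apply.
  by apply: (C1_differentiable oW (UW _ Ux)); exact: Ck_on_weaken Cg.
split=> [x Ux|v].
  apply: continuous_comp.
    by apply: continuous_row => i; exact: Ck_on_continuous (CF i) Ux.
  exact: Ck_on_continuous Cg (UW _ Ux).
split=> [x Ux|]; first by have [] := gF x v Ux.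
have key : Ck_on k U (fun x =>
    \sum_i 'D_(delta_mx 0 i) g (F x) * 'D_v (fun y => F y 0 i) x).
  apply: Ck_on_sum => // i; apply: (Ck_onM oU).
    apply: (IH (fun y => 'D_(delta_mx 0 i) g y)) => [j|]; first exact: Ck_onS (CF j).
    by have [_ /(_ (delta_mx 0 i))[]] := Cg.
  by have [_ /(_ v)[]] := CF i.
by apply: eq_Ck_on key => // x Ux; have [_ ->] := gF x v Ux.
Qed.

End Chain.

(** * Smooth cutoffs *)

Section Flat.
Context {R : realType}.

(** x^-j exp(-1/x) on the positive half-line, extended by 0. The family over all
    j is closed under differentiation, which is what makes an induction
    prove that each member is smooth. *)
Definition flat (j : nat) (x : R) : R :=
  if 0 < x then x^-1 ^+ j * expR (- x^-1) else 0.

Lemma flat_ge0 j x : 0 <= flat j x.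
Proof.
rewrite /flat; case: ifP => // x0.
by rewrite mulr_ge0 ?expR_ge0// exprn_ge0// invr_ge0 ltW.
Qed.

Lemma flat_gt0 j x : 0 < x -> 0 < flat j x.
Proof. by move=> x0; rewrite /flat x0 mulr_gt0 ?expR_gt0// exprn_gt0// invr_gt0. Qed.

Lemma flat_le0 j x : x <= 0 -> flat j x = 0.
Proof. by rewrite /flat leNgt => /negbTE ->. Qed.

(** exp(y) dominates y^(j+2) / (j+2)!, with y = 1/x. The square is what gives
    a zero derivative at the origin. *)
Lemma flat_bound j x : flat j x <= (j.+2)`!%:R * x ^+ 2.
Proof.
rewrite /flat; case: ifP => x0; last by rewrite mulr_ge0// sqr_ge0.
have xN0 : x != 0 by rewrite gt_eqF.
have y0 : 0 < x^-1 by rewrite invr_gt0.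
have := @expR_ge1Dxn R (x^-1) j.+1 (ltW y0).
have f0 : 0 < (j.+2)`!%:R :> R by rewrite ltr0n fact_gt0.
move=> H.
have {}H : x^-1 ^+ j.+2 <= (j.+2)`!%:R * expR (x^-1).
  rewrite mulrC -ler_pdivrMr//; apply: le_trans H.
  by rewrite lerDr.
rewrite expRN ler_pdivrMr ?expR_gt0//.
rewrite mulrAC -ler_pdivrMr ?exprn_gt0//.
by apply: le_trans H; rewrite -exprVn -exprD addn2.
Qed.

Lemma is_derive_flat j (x : R) :
  is_derive x (1 : R) (flat j) (- j%:R * flat j.+1 x + flat j.+2 x).
Proof.
have [x0|x0|x0] := ltgtP x 0.
- rewrite !flat_le0 ?ltW// mulr0 addr0.
  apply: (@near_eq_is_derive _ _ _ (cst 0)).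
  by near=> y; rewrite flat_le0// ltW//; near: y; exact: lt_nbhsl.
- have xN0 : x != 0 by rewrite gt_eqF.
  apply: (@near_eq_is_derive _ _ _ (fun x : R => x^-1 ^+ j * expR (- x^-1))).
    by near=> y; rewrite /flat ifT//; near: y; exact: lt_nbhsr.
  have dV : is_derive x (1 : R) (fun y : R => y^-1) (- x ^- 2).
    apply: DeriveDef; first by apply: derivableV.
    by rewrite deriveV// derive_id [_ *: _]mulr1.
  have dE : is_derive x (1 : R) (expR \o (fun y : R => - y^-1))
      (expR (- x^-1) * (- - x ^- 2)).
    apply: is_derive1_comp; exact: is_deriveN.
  have dM := is_deriveM (is_deriveX j dV) dE.
  have E : (fun x : R => x^-1 ^+ j * expR (- x^-1)) =
      (fun y : R => y^-1) ^+ j * (expR \o (fun y : R => - y^-1)).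
    by apply/funext => y; rewrite !fctE.
  rewrite E; apply: is_derive_eq.
  rewrite opprK.
  rewrite /flat x0 /= !fctE /=.
  rewrite -![_ *: _]/(_ * _).
  rewrite -!exprVn; set t := x^-1; set u := expR _.
  case: j {dM E} => [|j]; rewrite ?mulr0n ?oppr0 -?natr1 /=. ring.
  by rewrite !exprS expr0; set w := t ^+ j; set c := _ + 1; ring.
- rewrite x0 !flat_le0// mulr0 addr0.
  have key : h^-1 *: (flat j (h *: 1 + 0) - flat j 0) @[h --> (0 : R)^'] --> (0 : R).
    apply/cvgrPdist_le => e e0; near=> h.
    have hN0 : h != 0 by near: h; exact: nbhs_dnbhs_neq.
    rewrite sub0r normrN addr0 [_ *: 1]mulr1 (flat_le0 j (lexx 0)) subr0 normrM.
    rewrite normfV ler_pdivrMl ?normr_gt0//.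
    rewrite ger0_norm ?flat_ge0//; apply: le_trans (flat_bound j h) _.
    rewrite -normr_id -[h ^+ 2]real_normK ?num_real// normr_id expr2 mulrA [leRHS]mulrC.
    rewrite ler_wpM2r// mulrC -ler_pdivlMr ?ltr0n ?fact_gt0//.
    near: h; apply: dnbhs0_le; rewrite divr_gt0// ltr0n fact_gt0//.
  apply: DeriveDef; first by apply/cvg_ex; exists 0.
  exact: cvg_lim key.
Unshelve. all: by end_near. Qed.

Lemma Ck_on_flat {V : normedModType R} (k j : nat) (U : set V) (f : V -> R) :
  open U -> Ck_on k U f -> Ck_on k U (fun x => flat j (f x)).
Proof.
move=> oU; elim: k j => [|k IH] j Cf.
  split=> // x Ux; apply: continuous_comp (Ck_on_continuous Cf Ux) _.
  by apply/differentiable_continuous/derivable1_diffP; have [] := is_derive_flat j (f x).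
split=> [x Ux|v].
  apply: continuous_comp (Ck_on_continuous Cf Ux) _.
  by apply/differentiable_continuous/derivable1_diffP; have [] := is_derive_flat j (f x).
have [_ /(_ v)[fd Df]] := Cf.
have H x : U x -> is_derive x v (flat j \o f)
    ((- j%:R * flat j.+1 (f x) + flat j.+2 (f x)) * 'D_v f x).
  by move=> Ux; apply: is_derive_comp1 (is_derive_flat _ _); exact/derivableP/fd.
split=> [x Ux|]; first by have [] := H x Ux.
have CS := Ck_onS Cf.
have CD := Ck_onD oU (Ck_onMl (- j%:R) oU (IH j.+1 CS)) (IH j.+2 CS).
apply: eq_Ck_on (Ck_onM oU CD Df) => //.
by move=> x Ux; have [_ ->] := H x Ux.
Qed.

End Flat.

Section Cutoff.
Context {R : realType}.

(** 1 up to 1/2 and 0 from 1 on. *)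
Definition cutoff (s : R) : R :=
  flat 0 (1 - s) / (flat 0 (1 - s) + flat 0 (s - 2^-1)).

Lemma cutoff_den (s : R) : flat 0 (1 - s) + flat 0 (s - 2^-1) != 0.
Proof.
rewrite gt_eqF//.
have [s1|s1] := ltP s 1.
  by rewrite ltr_pwDl ?flat_ge0// flat_gt0// subr_gt0.
apply: ltr_wpDl; first exact: flat_ge0.
apply: flat_gt0; rewrite subr_gt0; apply: lt_le_trans s1.
by rewrite invf_lt1// ltr1n.
Qed.

Lemma cutoff1 s : s <= 2^-1 -> cutoff s = 1.
Proof.
move=> s1; have := cutoff_den s; rewrite /cutoff.
by rewrite (@flat_le0 _ 0 (s - 2^-1)) ?subr_le0// addr0 => /divff.
Qed.

Lemma cutoff0 s : 1 <= s -> cutoff s = 0.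
Proof. by move=> s1; rewrite /cutoff flat_le0 ?mul0r// subr_le0. Qed.

Lemma Ck_on_cutoff {V : normedModType R} k (U : set V) (f : V -> R) :
  open U -> Ck_on k U f -> Ck_on k U (fun x => cutoff (f x)).
Proof.
move=> oU Cf.
have C1 : Ck_on k U (fun x => flat 0 (1 - f x)).
  apply: Ck_on_flat => //; apply: eq_Ck_on
    (Ck_onD oU (Ck_on_cst k 1 oU) (Ck_onMl (-1) oU Cf)) => // x _ /=.
  by rewrite mulN1r.
have C2 : Ck_on k U (fun x => flat 0 (f x - 2^-1)).
  apply: Ck_on_flat => //; apply: eq_Ck_on
    (Ck_onD oU Cf (Ck_on_cst k (- 2^-1) oU)) => // x _ /=.
apply: (Ck_onM oU C1); apply: Ck_onV => //; last exact: (Ck_onD oU C1 C2).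
by move=> x _; exact: cutoff_den.
Qed.

End Cutoff.

Section Bump.
Context {R : realType} {n : nat}.
Local Notation V := 'rV[R]_n.

Definition row_bump (p : V) (r : R) (y : V) : R :=
  cutoff (\sum_i (y 0 i - p 0 i) ^+ 2 / r ^+ 2).

Lemma Ck_on_row_bump k U p r : open U -> Ck_on k U (row_bump p r).
Proof.
move=> oU; apply: Ck_on_cutoff => //; apply: Ck_on_sum => // i.
apply: (Ck_onM oU _ (Ck_on_cst k _ oU)).
have C : Ck_on k U (fun y : V => y 0 i - p 0 i).
  exact: (Ck_onD oU (Ck_on_coord k i oU) (Ck_on_cst k _ oU)).
exact: (Ck_onM oU C C).
Qed.

Lemma row_bump0 p r y : 0 < r -> r < `|y - p| -> row_bump p r y = 0.
Proof.
move=> r0 ry; apply: cutoff0; rewrite leNgt; apply/negP => H.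
move: ry; apply/negP; rewrite -leNgt.
apply: row_norm_leP; first exact: ltW.
move=> i; rewrite !mxE -(@ler_pXn2r _ 2)// ?nnegrE ?(ltW r0)//.
rewrite real_normK ?num_real//.
rewrite -[leRHS]mul1r -ler_pdivrMr ?exprn_gt0//.
apply: le_trans (ltW H); rewrite (bigD1 i)//= lerDl sumr_ge0// => j _.
by rewrite divr_ge0// ?sqr_ge0.
Qed.

Lemma row_bump1 p r : 0 < r -> \forall y \near p, row_bump p r y = 1.
Proof.
move=> r0.
have c : {for p, continuous (fun y : V => \sum_i (y 0 i - p 0 i) ^+ 2 / r ^+ 2)}.
  apply: (@Ck_on_continuous _ _ 0 setT) => //.
  apply: Ck_on_sum => [|i]; first exact: openT.
  apply: (Ck_onM openT _ (Ck_on_cst 0 _ openT)).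
  have C : Ck_on 0 setT (fun y : V => y 0 i - p 0 i).
    exact: (Ck_onD openT (Ck_on_coord 0 i openT) (Ck_on_cst 0 _ openT)).
  exact: (Ck_onM openT C C).
have h0 : 0 < 2^-1 :> R by rewrite invr_gt0.
move/cvgrPdist_le : c => /(_ _ h0); apply: filterS => y.
rewrite big1 => [|i _]; last by rewrite subrr expr0n mul0r.
rewrite sub0r normrN => H; apply: cutoff1; apply: le_trans H; exact: ler_norm.
Qed.

End Bump.

Lemma continuous_of_dist (R : realType) (V W : normedModType R) (f : V -> W) (x : V) :
  (forall e : R, 0 < e ->
     exists2 A : set V, nbhs x A & forall y, A y -> `|f x - f y| <= e) ->
  {for x, continuous f}.
Proof.
move=> H; apply/cvgrPdist_le => e /H[A nA HA].
exact: filterS HA nA.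
Qed.

(** * Hadamard's lemma *)

Section Hadamard.
Context {R : realType} {n : nat}.
Local Notation V := 'rV[R]_n.
Variables (y0 : V) (r : R).
Hypothesis r0 : 0 < r.
Local Notation mu := (@lebesgue_measure R).

Let B : set V := [set y | `|y - y0| < r].

Let oB : open B.
Proof.
have -> : B = ball y0 r.
  by apply/seteqP; split => y; rewrite /B /= mx_norm_ball /ball_/= distrC.
exact: ball_open.
Qed.

Let path (y : V) (t : R) : V := y0 + t *: (y - y0).

Let path_B y t : B y -> 0 <= t <= 1 -> B (path y t).
Proof.
rewrite /B /path /= => yB /andP[t0 t1].
rewrite addrAC subrr add0r normrZ ger0_norm//.
by apply: le_lt_trans yB; rewrite ler_piMl.
Qed.

Let path_cont (y : V) (t : R) : {for (t, y), continuous (fun z : R * V => path z.2 z.1)}.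
Proof.
rewrite /path => /=.
apply: cvgD; first exact: cvg_cst.
apply: cvgZ; first exact: cvg_fst.
apply: cvgB; [exact: cvg_snd|exact: cvg_cst].
Qed.

(** For j = 0, the average of h on the segment from y0 to y. The weights t^j make
    the family closed under differentiation in y: a derivative along v of the
    j-th average of h is the (j+1)-st average of the derivative of h along v. *)
Definition ray_int (j : nat) (h : V -> R) (y : V) : R :=
  \int[mu]_(t in `[0, 1]) (t ^+ j * h (path y t)).

Let ray_cont (h : V -> R) (y : V) : (forall z, B z -> {for z, continuous h}) ->
  B y -> forall t : R, 0 <= t <= 1 -> {for t, continuous (fun s => h (path y s))}.
Proof.
move=> hc yB t t01.
apply: (@continuous_comp _ _ _ (path y) h); last exact/hc/path_B.
rewrite /path; apply: cvgD; first exact: cvg_cst.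
by apply: cvgZr_tmp.
Qed.

Let ray_near (h : V -> R) (y : V) (e : R) :
  (forall z, B z -> {for z, continuous h}) -> B y -> 0 < e ->
  \forall z \near y, B z /\ forall t, 0 <= t <= 1 ->
     `|h (path z t) - h (path y t)| <= e.
Proof.
move=> hc yB e0.
have := (compact_near_coveringP _).1 (@segment_compact R 0 1) V (nbhs y)
  (fun z t => `|h (path z t) - h (path y t)| <= e) _.
have nB : nbhs y B by exact: open_nbhs_nbhs.
move=> H; have {}H : \forall z \near y,
    `[0, 1]%classic `<=` (fun t => `|h (path z t) - h (path y t)| <= e).
  apply: H => t; rewrite /= in_itv/= => t01.
  have c : {for (t, y), continuous (fun z : R * V => h (path z.2 z.1))}.
    by apply: (continuous_comp (@path_cont y t)); exact/hc/path_B.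
  have c' : {for t, continuous (fun s => h (path y s))}.
    exact: (ray_cont hc yB).
  have e2 : 0 < e / 2 by rewrite divr_gt0.
  move/cvgrPdist_le: c => /(_ _ e2) c; move/cvgrPdist_le: c' => /(_ _ e2) c'.
  have [[P Q] /= [nP nQ] PQ] := c.
  exists (P `&` [set s | `|h (path y t) - h (path y s)| <= e / 2], Q).
    by split=> //=; exact: filterI.
  case=> s z /= [[Ps s1] Qz].
  have /= s2 := PQ (s, z) (conj Ps Qz).
  rewrite -(subrKA (h (path y t))) (splitr e).
  by rewrite (le_trans (ler_normD _ _))// lerD// distrC.
apply: filterI nB _; apply: filterS H => z Hz t t01.
by apply: Hz; rewrite /= in_itv.
Qed.

Let int_of_cont (f : R -> R) : (forall t : R, 0 <= t <= 1 -> {for t, continuous f}) ->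
  mu.-integrable `[0, 1] (EFin \o f).
Proof.
move=> fc; apply: continuous_compact_integrable; first exact: segment_compact.
apply: continuous_in_subspaceT => t; rewrite inE /= in_itv /=.
exact: fc.
Qed.

Let ray_term_cont j (h : V -> R) (y : V) :
  (forall z, B z -> {for z, continuous h}) -> B y ->
  forall t : R, 0 <= t <= 1 -> {for t, continuous (fun t : R => t ^+ j * h (path y t))}.
Proof.
move=> hc yB t t01; apply: cvgM; last exact: (ray_cont hc yB).
exact: exprn_continuous.
Qed.

Let ray_integrable j (h : V -> R) (y : V) :
  (forall z, B z -> {for z, continuous h}) -> B y ->
  mu.-integrable `[0, 1] (EFin \o (fun t : R => t ^+ j * h (path y t))).
Proof.
by move=> hc yB; apply: int_of_cont; exact: ray_term_cont.
Qed.

Let int01_cst (c : R) : \int[mu]_(t in `[0, 1]) c = c.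
Proof.
by rewrite Rintegral_cst//= lebesgue_measure_itv /= lte_fin ltr01 oppr0 adde0 mulr1.
Qed.

Lemma ray_int_continuous j (h : V -> R) (y : V) :
  (forall z, B z -> {for z, continuous h}) -> B y ->
  {for y, continuous (ray_int j h)}.
Proof.
move=> hc yB; apply: continuous_of_dist => e e0.
eexists; first exact: (ray_near hc yB e0).
move=> z [zB H].
rewrite /ray_int -RintegralB//; try exact: ray_integrable.
pose d (t : R) := t ^+ j * h (path y t) - t ^+ j * h (path z t).
have dc (t : R) : 0 <= t <= 1 -> {for t, continuous d}.
  by move=> t01; apply: cvgB; exact: ray_term_cont.
apply: le_trans (le_normr_Rintegral _ (int_of_cont dc)) _ => //.
rewrite -[leRHS]int01_cst; apply: le_Rintegral => //.
- by apply: int_of_cont => t t01; apply: cvg_norm; exact: dc.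
- by apply: int_of_cont => t _; exact: cvg_cst.
move=> t /=; rewrite in_itv /= => t01; have /andP[t0 t1] := t01.
rewrite /d -mulrBr normrM distrC -[leRHS]mul1r.
apply: ler_pM => //; last exact: H.
by rewrite ger0_norm ?exprn_ge0// exprn_ile1.
Qed.

(** Differentiation under the integral sign; the dominating function is the
    derivative of h along the segment to y, plus 1, which bounds the
    derivatives along the nearby segments by compactness of [0, 1]. *)
Lemma is_derive_ray_int j (h : V -> R) (y v : V) : Ck_on 1 B h -> B y ->
  is_derive y v (ray_int j h) (ray_int j.+1 (fun z => 'D_v h z) y).
Proof.
move=> [hc hd] yB; have [hv [hvc _]] := hd v.
have D_near := ray_near hvc yB ltr01.
have [d /= d0 Hd] : exists2 d : R, 0 < d & forall s : R, `|s| < d ->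
    B (y + s *: v) /\ forall t, 0 <= t <= 1 ->
     `|'D_v h (path (y + s *: v) t) - 'D_v h (path y t)| <= 1.
  have c : (fun s : R => y + s *: v) @ (0 : R) --> y.
    rewrite -[X in _ --> X]addr0 -(scale0r v).
    by apply: cvgD; [exact: cvg_cst|exact: cvgZr_tmp].
  have /nbhs_ballP[d /= d0 H] := c _ D_near.
  by exists d => // s sd; apply: H; rewrite /ball /= sub0r normrN.
pose f (s t : R) := t ^+ j * h (path (y + s *: v) t).
have I0 : `]-d, d[%classic (0 : R) by rewrite /= in_itv/= oppr_lt0 d0.
have Id s : `]-d, d[%classic s -> `|s| < d by rewrite /= in_itv/= ltr_norml.
have pE s t : path (y + s *: v) t = path y t + (t * s) *: v.
  by rewrite /path addrAC scalerDr scalerA addrA.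
have fd (s t : R) : `|s| < d -> 0 <= t <= 1 ->
    is_derive s (1 : R) (f ^~ t) (t ^+ j.+1 * 'D_v h (path (y + s *: v) t)).
  move=> sd t01.
  have E : (f ^~ t) = (fun u : R => t ^+ j * u) \o
       ((fun u : R => h (path y t + u *: v)) \o (fun u : R => t * u)).
    by apply/funext => u; rewrite /f /= pE.
  have d1 : is_derive s (1 : R) (fun u : R => t * u) (t * 1).
    exact: is_deriveZ.
  have d2 : is_derive (t * s) (1 : R) (fun u : R => h (path y t + u *: v))
      ('D_v h (path y t + (t * s) *: v)).
    by apply: line_derive; apply: hv; rewrite -pE; apply: path_B => //; apply: (Hd _ sd).1.
  have d3 := is_derive1_comp d2 d1.
  have d4 := @is_deriveZ _ _ _ _ (t ^+ j) _ _ _ d3.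
  rewrite E; apply: (is_derive_eq d4).
  by rewrite -pE exprSr mulr1 -mulrA [t * _]mulrC.
have cG : forall t : R, 0 <= t <= 1 ->
    {for t, continuous (fun t => `|'D_v h (path y t)| + 1)}.
  move=> t t01; apply: cvgD; last exact: cvg_cst.
  by apply: cvg_norm; exact: (ray_cont hvc yB).
have intf x : `]-d, d[%classic x -> mu.-integrable `[0, 1] (EFin \o f x).
  by move=> /Id/Hd[xB _]; exact: ray_integrable.
have derf x t : `]-d, d[%classic x -> `[0, 1]%classic t -> derivable (f ^~ t) x 1.
  by move=> /Id xd; rewrite /= in_itv/= => t01; have [] := fd _ _ xd t01.
have G0 (t : R) : 0 <= `|'D_v h (path y t)| + 1 by rewrite addr_ge0.
have Gub x t : `]-d, d[%classic x -> `[0, 1]%classic t ->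
    `|partial1of2 f x t| <= `|'D_v h (path y t)| + 1.
  move=> /Id xd; rewrite /= in_itv/= => t01.
  rewrite partial1of2E; have [_ ->] := fd _ _ xd t01.
  have /andP[t0 t1] := t01.
  have Hx := (Hd _ xd).2 _ t01.
  rewrite normrM -[leRHS]mul1r; apply: ler_pM => //.
    by rewrite ger0_norm ?exprn_ge0// exprn_ile1.
  rewrite -lerBlDl; apply: le_trans Hx; exact: lerB_dist.
have m01 : measurable (`[0, 1]%classic : set (measurableTypeR R)) by exact: measurable_itv.
have D1 := @derivable_under_integral R _ _ mu f _ m01 0 (-d) d I0 intf derf
  _ G0 (int_of_cont cG) Gub.
have D2 := @differentiation_under_integral R _ _ mu f _ m01 0 (-d) d I0 intf derf
  _ G0 (int_of_cont cG) Gub.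
have E : (fun x' : R => \int[mu]_(t in `[0, 1]) f x' t) =
   (fun s : R => ray_int j h (s *: v + y)).
  by apply/funext => s; rewrite /ray_int /f addrC.
rewrite E in D1 D2.
apply: DeriveDef; first exact/derivable1P.
rewrite -derive_along_line -derive1E D2.
apply: eq_Rintegral => t; rewrite inE /= in_itv /= => t01.
have n0 : `|0 : R| < d by rewrite normr0.
rewrite partial1of2E; have [_ ->] := fd _ _ n0 t01.
by rewrite scale0r addr0.
Qed.

Lemma Ck_on_ray_int k j (h : V -> R) : Ck_on k.+1 B h -> Ck_on k B (ray_int j h).
Proof.
elim: k j h => [|k IH] j h Ch.
  by split=> // y yB; apply: ray_int_continuous => // z zB; have [+ _] := Ch; apply.
have C1 : Ck_on 1 B h by exact: Ck_on_weaken Ch.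
split=> [y yB|v].
  by apply: ray_int_continuous => // z zB; have [+ _] := Ch; apply.
split=> [y yB|]; first by have [] := is_derive_ray_int j v C1 yB.
have [_ /(_ v)[_ Dh]] := Ch.
by apply: eq_Ck_on (IH j.+1 _ Dh) => // y yB; have [_ ->] := is_derive_ray_int j v C1 yB.
Qed.

Lemma ray_int_center (h : V -> R) : ray_int 0 h y0 = h y0.
Proof.
rewrite /ray_int -[RHS]int01_cst; apply: eq_Rintegral => t _.
by rewrite expr0 mul1r /path subrr scaler0 addr0.
Qed.

Lemma derive_row_sum (h : V -> R) (z v : V) : differentiable h z ->
  'D_v h z = \sum_i v 0 i * 'D_(delta_mx 0 i) h z.
Proof.
move=> dh; rewrite deriveE// {1}(row_sum_delta v) linear_sum.
by apply: eq_bigr => i _; rewrite linearZ/= -deriveE.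
Qed.

(** The fundamental theorem of calculus along the segment from y0 to y. *)
Lemma hadamard (h : V -> R) (y : V) : Ck_on 1 B h -> B y ->
  h y = h y0 + \sum_i (y 0 i - y0 0 i) * ray_int 0 (fun z => 'D_(delta_mx 0 i) h z) y.
Proof.
move=> Ch yB; have [hc hd] := Ch.
pose v := y - y0; pose F t := h (path y t).
have dF (t : R) : 0 <= t <= 1 -> is_derive t (1 : R) F ('D_v h (path y t)).
  by move=> t01; apply: line_derive; have [hv _] := hd v; exact/hv/path_B.
have [hv [hvc _]] := hd v.
have FT : (\int[mu]_(t in `[0%R, 1%R]) ('D_v h (path y t))%:E = (F 1)%:E - (F 0)%:E)%E.
  apply: continuous_FTC2 => //.
  - apply: continuous_in_subspaceT => t; rewrite inE /= in_itv /=.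
    exact: (ray_cont hvc yB).
  - split.
    + move=> t; rewrite in_itv/= => /andP[t0 t1].
      have t01 : 0 <= t <= 1 by rewrite !ltW.
      by have [] := dF _ t01.
    + apply: cvg_at_right_filter; apply: (ray_cont hc yB); rewrite lexx ler01//.
    + apply: cvg_at_left_filter; apply: (ray_cont hc yB); rewrite lexx ler01//.
  - move=> t; rewrite in_itv/= => /andP[t0 t1].
    have t01 : 0 <= t <= 1 by rewrite !ltW.
    by rewrite derive1E; have [_ ->] := dF _ t01.
have F1 : F 1 = h y by rewrite /F /path scale1r addrC subrK.
have F0 : F 0 = h y0 by rewrite /F /path scale0r addr0.
have -> : h y = h y0 + \int[mu]_(t in `[0, 1]) 'D_v h (path y t).
  by rewrite /Rintegral FT -EFinB F1 F0 /= addrCA subrr addr0.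
congr (_ + _).
have Di i := ((hd (delta_mx 0 i)).2).1.
transitivity (\int[mu]_(t in `[0, 1])
    (\sum_i v 0 i * 'D_(delta_mx 0 i) h (path y t))).
  apply: eq_Rintegral => t; rewrite inE /= in_itv /= => t01.
  by apply: derive_row_sum; exact: (C1_differentiable oB (path_B yB t01) Ch).
have cD i (t : R) : 0 <= t <= 1 ->
    {for t, continuous (fun t : R => v 0 i * 'D_(delta_mx 0 i) h (path y t))}.
  by move=> t01; apply: cvgM; [exact: cvg_cst|exact: (ray_cont (Di i) yB)].
pose G (s : seq 'I_n) (t : R) := \sum_(i <- s) v 0 i * 'D_(delta_mx 0 i) h (path y t).
have G0 : G [::] = cst 0 by apply/funext => t; rewrite /G big_nil.
have GS i s : G (i :: s) = (fun t : R => v 0 i * 'D_(delta_mx 0 i) h (path y t) + G s t).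
  by apply/funext => t; rewrite /G big_cons.
have key (s : seq 'I_n) :
  (forall t : R, 0 <= t <= 1 -> {for t, continuous (G s)}) /\
  \int[mu]_(t in `[0, 1]) G s t =
  \sum_(i <- s) v 0 i * ray_int 0 (fun z => 'D_(delta_mx 0 i) h z) y.
  elim: s => [|i s [IH1 IH2]].
    by rewrite G0 int01_cst big_nil; split=> // t _; exact: cvg_cst.
  rewrite GS; split.
    by move=> t t01; apply: cvgD; [exact: cD|exact: IH1].
  rewrite RintegralD//; [|exact/int_of_cont/cD|exact: int_of_cont].
  rewrite IH2 big_cons; congr (_ + _).
  rewrite RintegralZl//; last exact/int_of_cont/(ray_cont (Di i) yB).
  congr (_ * _).
  by apply: eq_Rintegral => t _; rewrite expr0 mul1r.
rewrite -/(G _) (key _).2; apply: eq_bigr => i _.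
by rewrite !mxE.
Qed.

End Hadamard.

(** * Smooth functions and tangent vectors on a manifold *)

Section Local.
Context {R : realType} {n : nat} {M : manifold R n}.
Implicit Types (c : chart R n M) (U V W : set M) (f g : M -> R).

Lemma open_chart_inv c W : open W -> open (chart_img c `&` chart_inv c @^-1` W).
Proof.
move=> oW; rewrite openE => y [cy Wy].
have cc := chart_inv_cont cy.
apply: filterI; first by apply: open_nbhs_nbhs; split => //; exact: chart_img_open.
by apply: cc; exact: open_nbhs_nbhs.
Qed.

Lemma open_chart_map c (O : set 'rV[R]_n) :
  open O -> open (chart_dom c `&` chart_map c @^-1` O).
Proof.
move=> oO; rewrite openE => x [cx Ox].
have cc := chart_map_cont cx.
apply: filterI; first by apply: open_nbhs_nbhs; split => //; exact: chart_dom_open.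
by apply: cc; exact: open_nbhs_nbhs.
Qed.

Lemma msmooth_on_subset U W f : U `<=` W -> msmooth_on W f -> msmooth_on U f.
Proof.
move=> UW sf c Ac k; apply: Ck_on_subset (sf c Ac k) => y [cy Uy].
by split => //; exact: UW.
Qed.

Lemma msmooth_on_local U f :
  (forall m, U m -> exists2 V, V m & msmooth_on V f) -> msmooth_on U f.
Proof.
move=> loc c Ac k; apply: Ck_on_local => y [cy Uy].
have [V Vy sV] := loc _ Uy.
by exists (chart_img c `&` chart_inv c @^-1` V) => //; exact: sV.
Qed.

Lemma eq_msmooth_on U f g : open U -> (forall x, U x -> f x = g x) ->
  msmooth_on U f -> msmooth_on U g.
Proof.
move=> oU fg sf c Ac k; apply: eq_Ck_on (sf c Ac k); first exact: open_chart_inv.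
by move=> y [_ Uy] /=; exact: fg.
Qed.

Lemma msmooth_onM U f g : open U -> msmooth_on U f -> msmooth_on U g ->
  msmooth_on U (f \* g).
Proof.
move=> oU sf sg c Ac k; apply: (@Ck_onM _ _ k _ (f \o _) (g \o _));
  by [exact: open_chart_inv|exact: sf|exact: sg].
Qed.

Lemma smooth_fun_on U (f : smooth_fun M) : msmooth_on U f.
Proof. by apply: msmooth_on_subset (smooth_funP f). Qed.

Lemma msmooth_on_chart c (O : set 'rV[R]_n) (h : 'rV[R]_n -> R) :
  atlas c -> open O -> smooth_on O h ->
  msmooth_on (chart_dom c `&` chart_map c @^-1` O) (h \o chart_map c).
Proof.
move=> Ac oO sh c' Ac' k.
set U := _ `&` _.
have oU : open U by apply: open_chart_inv; exact: open_chart_map.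
apply: (@Ck_on_comp _ _ _ k U O (chart_map c \o chart_inv c')) => //.
- by move=> y [_ []].
- move=> i; apply: Ck_on_subset (atlas_compat Ac' Ac i k).
  by move=> y [? []].
Qed.

(** The open sets U and ~ K cover M. *)
Lemma msmooth_extend U (K : set M) f : open U -> closed K -> K `<=` U ->
  msmooth_on U f -> (forall x, ~ K x -> f x = 0) -> msmooth f.
Proof.
move=> oU cK KU sf f0; apply: msmooth_on_local => m _.
have [Km|nKm] := pselect (K m); first by exists U => //; exact: KU.
exists (~` K) => //; apply: (@eq_msmooth_on _ (cst 0)).
- exact: closed_openC.
- by move=> x nKx; rewrite f0.
- by apply: msmooth_on_subset (msmooth_cst 0).
Qed.

(** In a chart, a cutoff of the squared distance to the image of m. The closed
    ball that contains its support is compact, so its image in the Hausdorff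
    space M is closed and the extension by 0 is smooth. *)
Lemma bump_exists (m : M) U : open U -> U m ->
  exists (chi : smooth_fun M) V (K : set M),
    [/\ open V, V m, closed K, K `<=` U &
        (forall x, V x -> chi x = 1) /\ (forall x, ~ K x -> chi x = 0)].
Proof.
move=> oU Um; have [c Ac cm] := atlas_cover m.
pose p := chart_map c m.
have oO := @open_chart_inv c _ oU.
have Op : (chart_img c `&` chart_inv c @^-1` U) p.
  by split; [exact: chart_mapP|rewrite /= chart_mapK].
have [r r0 rO] : exists2 r : R, 0 < r &
    forall y, `|y - p| <= r -> (chart_img c `&` chart_inv c @^-1` U) y.
  have /nbhs_ballP[d /= d0 H] := open_nbhs_nbhs (conj oO Op).
  exists (d / 2); first by rewrite divr_gt0.
  move=> y yd; apply: H; rewrite mx_norm_ball /ball_/= distrC.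
  by apply: le_lt_trans yd _; rewrite ltr_pdivrMr// ltr_pMr// ltr1n.
pose D : set 'rV[R]_n := [set y | `|y - p| <= r].
have cD : compact D.
  apply: bounded_closed_compact.
    exists (r + `|p|); split; first exact: num_real.
    move=> s sr y yD; apply: le_trans (ltW sr).
    by rewrite -[y](subrK p) (le_trans (ler_normD _ _))// lerD2r.
  rewrite (_ : D = closed_ball p r).
    exact: closed_ball_closed.
  rewrite closed_ballE//; apply/seteqP; split=> y; rewrite /D /closed_ball_ /=.
    by rewrite distrC.
  by rewrite distrC.
pose K := chart_inv c @` D.
have cK : closed K.
  apply: compact_closed; first exact: mfd_hausdorff.
  apply: continuous_compact cD; apply: continuous_in_subspaceT => y /[!inE] yD.
  by apply: chart_inv_cont; have [] := rO _ yD.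
have KU : K `<=` U by move=> _ [y yD <-]; have [] := rO _ yD.
have Kc : K `<=` chart_dom c.
  by move=> _ [y yD <-]; apply: chart_invP; have [] := rO _ yD.
pose b (x : M) : R := if `[< chart_dom c x >] then row_bump p r (chart_map c x) else 0.
have bE x : chart_dom c x -> b x = row_bump p r (chart_map c x).
  by move=> cx; rewrite /b asboolT.
have b0 x : ~ K x -> b x = 0.
  move=> nK; rewrite /b; case: asboolP => // cx.
  apply: row_bump0 => //; rewrite ltNge; apply/negP => H; apply: nK.
  by exists (chart_map c x) => //; exact: chart_mapK.
have sb : msmooth b.
  apply: (msmooth_extend (chart_dom_open c) cK Kc _ b0).
  apply: (@eq_msmooth_on _ (row_bump p r \o chart_map c)).
  - exact: chart_dom_open.
  - by move=> x cx; rewrite bE.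
  - have := @msmooth_on_chart c setT (row_bump p r) Ac openT.
    rewrite preimage_setT setIT; apply => k.
    by apply: Ck_on_row_bump; exact: openT.
exists (mk_smooth sb).
have /nbhs_ballP[d /= d0 HW] := row_bump1 p r0.
pose W := ball p d.
have oW : open W by exact: ball_open.
have Wp : W p by exact: ballxx.
exists (chart_dom c `&` chart_map c @^-1` W), K; split => //.
- exact: open_chart_map.
- by split => // x [cx Wx] /=; rewrite bE//; exact: HW.
Qed.

Lemma bump_plateau (chi : M -> R) V (K : set M) :
  (forall x, V x -> chi x = 1) -> (forall x, ~ K x -> chi x = 0) -> V `<=` K.
Proof.
move=> chi1 chi0 x Vx; apply: contrapT => /chi0; rewrite chi1// => /eqP.
by rewrite oner_eq0.
Qed.

End Local.

Section Derivations.
Context {R : realType} {n : nat} {M : manifold R n}.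
Implicit Types (f g : smooth_fun M).

Lemma smfD f g m : (f + g) m = f m + g m. Proof. by []. Qed.
Lemma smfM f g m : (f * g) m = f m * g m. Proof. by []. Qed.
Lemma smfB f g m : (f - g) m = f m - g m. Proof. by []. Qed.
Lemma smf0 m : (0 : smooth_fun M) m = 0. Proof. by []. Qed.
Lemma smf1 m : (1 : smooth_fun M) m = 1. Proof. by []. Qed.
Lemma smf_sum (I : Type) (r : seq I) (F : I -> smooth_fun M) m :
  (\sum_(i <- r) F i) m = \sum_(i <- r) F i m.
Proof.
elim: r => [|i r IH]; first by rewrite !big_nil.
by rewrite !big_cons smfD IH.
Qed.

Section AtPoint.
Context {m : M}.
Implicit Types v : tangent m.

Lemma tangD v f g : v (f + g) = v f + v g.
Proof. by have [+ _ _] := tangentP v; apply. Qed.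

Lemma tangM v f g : v (f * g) = f m * v g + g m * v f.
Proof. by have [_ _] := tangentP v; apply. Qed.

(** Since v 1 = v (1 * 1) = 2 v 1. *)
Lemma tang_cst v a : v (cstS M a) = 0.
Proof.
have v1 : v 1 = 0.
  have := tangM v 1 1; rewrite mulr1 !mul1r => /eq_double0 //.
have [_ vZ _] := tangentP v.
by have := vZ a 1; rewrite mulr1 v1 mulr0.
Qed.

Lemma tang0 v : v 0 = 0.
Proof. by have := tangD v 0 0; rewrite addr0 => /eq_double0. Qed.

Lemma tangN v f : v (- f) = - v f.
Proof. by apply/eqP; rewrite -addr_eq0 -tangD addNr tang0. Qed.

Lemma tang_sum v (I : Type) (r : seq I) (F : I -> smooth_fun M) :
  v (\sum_(i <- r) F i) = \sum_(i <- r) v (F i).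
Proof.
elim: r => [|i r IH]; first by rewrite !big_nil tang0.
by rewrite !big_cons tangD IH.
Qed.

(** Leibniz' rule applied to (f - g) chi = 0, for a bump function chi supported
    in V and equal to 1 at m. *)
Lemma tang_local v f g (V : set M) : open V -> V m ->
  (forall x, V x -> f x = g x) -> v f = v g.
Proof.
move=> oV Vm fg; have [chi [W [K [_ Wm _ KV [chi1 chi0]]]]] := bump_exists oV Vm.
have E : (f - g) * chi = 0.
  apply: smooth_fun_eq => x; rewrite smfM smfB smf0.
  have [Vx|nVx] := pselect (V x); first by rewrite fg// subrr mul0r.
  by rewrite chi0 ?mulr0// => /KV.
have := tangM v (f - g) chi.
rewrite E tang0 smfB fg// subrr mul0r add0r chi1// mul1r tangD tangN.
by move=> /esym/eqP; rewrite subr_eq0 => /eqP.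
Qed.

Lemma tangent_eq (v w : tangent m) : (forall f, v f = w f) -> v = w.
Proof. by move=> vw; apply/val_inj/funext. Qed.

Lemma tangDE (v w : tangent m) f : (v + w) f = v f + w f. Proof. by []. Qed.
Lemma tang_sumE (I : Type) (r : seq I) (F : I -> tangent m) f :
  (\sum_(i <- r) F i) f = \sum_(i <- r) F i f.
Proof.
elim: r => [|i r IH]; first by rewrite !big_nil.
by rewrite !big_cons tangDE IH.
Qed.

End AtPoint.

(** The functions x_i are the coordinates of a chart and the D_i its partial
    derivatives, both cut off away from m0. A derivation v at m is
    determined by its values v(x_i): near m, Hadamard's lemma writes
    f = f(m) + sum_i (x_i - x_i(m)) G_i with G_i smooth and G_i(m) = D_i f(m). *)
Lemma local_coordinates (m0 : M) :
  exists (V : set M) (x : 'I_n -> smooth_fun M) (D : 'I_n -> vector_field M),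
    [/\ open V, V m0,
        forall m (v : tangent m), V m -> v = \sum_i v (x i) *: D i m &
        forall i j m, V m -> D i m (x j) = (i == j)%:R].
Proof.
have [c Ac cm] := atlas_cover m0.
have [chi [V [K [oV Vm cK KU [chi1 chi0]]]]] := bump_exists (chart_dom_open c) cm.
pose ext (h : 'rV[R]_n -> R) (z : M) : R :=
  if `[< chart_dom c z >] then chi z * h (chart_map c z) else 0.
have extE h z : chart_dom c z -> ext h z = chi z * h (chart_map c z).
  by move=> cz; rewrite /ext asboolT.
have ext0 h z : ~ K z -> ext h z = 0.
  by move=> nK; rewrite /ext; case: asboolP => // _; rewrite chi0// mul0r.
have exts h : smooth_on (chart_img c) h -> msmooth (ext h).
  move=> sh; apply: (msmooth_extend (chart_dom_open c) cK KU _ (ext0 h)).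
  apply: (@eq_msmooth_on _ _ _ _ (chi \* (h \o chart_map c))).
  - exact: chart_dom_open.
  - by move=> z cz; rewrite extE.
  - apply: msmooth_onM; [exact: chart_dom_open|exact: smooth_fun_on|].
    have := @msmooth_on_chart _ _ _ c (chart_img c) h Ac (@chart_img_open _ _ _ c) sh.
    apply: msmooth_on_subset => z cz; split => //; exact: chart_mapP.
have Vc z : V z -> chart_dom c z.
  move=> Vz; apply: KU; exact: (bump_plateau chi1 chi0).
have scoord i : smooth_on (chart_img c) (fun y : 'rV[R]_n => y 0 i).
  by move=> k; apply: Ck_on_coord; exact: chart_img_open.
pose x i := mk_smooth (exts _ (scoord i)).
have xE i z : V z -> x i z = chart_map c z 0 i.
  by move=> Vz; rewrite /= extE ?chi1 ?mul1r//; exact: Vc.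
have sf (f : smooth_fun M) k : Ck_on k (chart_img c) (f \o chart_inv c).
  by have := smooth_funP f Ac k; rewrite preimage_setT setIT.
have fd (f : smooth_fun M) v z : chart_dom c z ->
    derivable (f \o chart_inv c) (chart_map c z) v.
  move=> cz; have [_ /(_ v)[+ _]] := sf f 1; apply; exact: chart_mapP.
pose d i z (f : smooth_fun M) : R :=
  ext (fun y => 'D_(delta_mx 0 i) (f \o chart_inv c) y) z.
have ds i f : msmooth (d i ^~ f).
  by apply: (exts _) => k; have [_ /(_ (delta_mx 0 i))[_]] := sf f k.+1.
have dd i z : is_derivation_at z (d i z).
  rewrite /d /ext; case: asboolP => cz; last by split=> *; rewrite ?(mulr0, addr0).
  have cK' := chart_mapK cz.
  split.
  - move=> f g; rewrite (_ : (f + g) \o _ = (f \o chart_inv c) + (g \o chart_inv c))//.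
    by rewrite deriveD ?mulrDr//; exact: fd.
  - move=> a f.
    rewrite (_ : (cstS M a * f) \o _ = a \*: (f \o chart_inv c))//.
    by rewrite deriveZ; [rewrite -[_ *: _]/(_ * _) mulrCA|exact: fd].
  - move=> f g; rewrite (_ : (f * g) \o _ = (f \o chart_inv c) * (g \o chart_inv c))//.
    rewrite deriveM; [|exact: fd|exact: fd].
    by rewrite -![_ *: _]/(_ * _) /= cK' mulrDr; congr (_ + _); rewrite mulrCA.
pose D i : vector_field M :=
  @mk_section _ _ _ (tangent_bundle M) (fun z => mk_tangent (dd i z)) (ds i).
have DE i z f : D i z f = d i z f by [].
have dE i z f : V z -> D i z f = 'D_(delta_mx 0 i) (f \o chart_inv c) (chart_map c z).
  by move=> Vz; rewrite DE /d extE ?chi1 ?mul1r//; exact: Vc.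
exists V, x, D; split => //.
- move=> m v Vm'.
  apply: tangent_eq => f; rewrite tang_sumE.
  have cm' := Vc _ Vm'.
  pose y0 := chart_map c m.
  have oO := @open_chart_inv _ _ _ c _ oV.
  have Oy0 : (chart_img c `&` chart_inv c @^-1` V) y0.
    by split; [exact: chart_mapP|rewrite /= chart_mapK].
  have /nbhs_ballP[r /= r0 Hr] := open_nbhs_nbhs (conj oO Oy0).
  pose B : set 'rV[R]_n := [set y | `|y - y0| < r].
  have BO y : B y -> (chart_img c `&` chart_inv c @^-1` V) y.
    by move=> By; apply: Hr; rewrite mx_norm_ball /ball_/= distrC.
  have oB : open B.
    rewrite (_ : B = ball y0 r); first exact: ball_open.
    by apply/seteqP; split => y; rewrite /B /= mx_norm_ball /ball_/= distrC.
  have By0 : B y0 by rewrite /B /= subrr normr0.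
  pose h := f \o chart_inv c.
  have Ch k : Ck_on k B h by apply: Ck_on_subset (sf f k) => y /BO[].
  pose g i := ray_int y0 0 (fun z => 'D_(delta_mx 0 i) h z).
  have sg i : smooth_on B (g i).
    by move=> k; apply: Ck_on_ray_int => //; have [_ /(_ (delta_mx 0 i))[_]] := Ch k.+2.
  have oU := @open_chart_map _ _ _ c _ oB.
  have [chi' [V' [K' [oV' Vm'' cK' KU' [chi1' chi0']]]]] :=
    bump_exists oU (conj cm' By0).
  pose G0 i (z : M) : R := if `[< chart_dom c z >] then chi' z * g i (chart_map c z) else 0.
  have G0E i z : chart_dom c z -> G0 i z = chi' z * g i (chart_map c z).
    by move=> cz; rewrite /G0 asboolT.
  have Gs i : msmooth (G0 i).
    apply: (msmooth_extend oU cK' KU').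
      apply: (@eq_msmooth_on _ _ _ _ (chi' \* (g i \o chart_map c))) => //.
        by move=> z [cz _]; rewrite G0E.
      apply: msmooth_onM => //; first exact: smooth_fun_on.
      exact: msmooth_on_chart.
    by move=> z nK; rewrite /G0; case: asboolP => // _; rewrite chi0'// mul0r.
  pose G i := mk_smooth (Gs i).
  have fE : v f = v (cstS M (f m) + \sum_i (x i - cstS M (y0 0 i)) * G i).
    apply: (tang_local _ oV') => // z Vz.
    have [cz Bz] : (chart_dom c `&` chart_map c @^-1` B) z.
      apply: KU'; exact: (bump_plateau chi1' chi0').
    have Vzz : V z by have [_] := BO _ Bz; rewrite /= chart_mapK.
    have -> : f z = f m + \sum_i (chart_map c z 0 i - y0 0 i) * g i (chart_map c z).
      by have := hadamard (Ch 1%N) Bz; rewrite /h /= !chart_mapK.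
    rewrite smfD smf_sum; congr (_ + _).
    apply: eq_bigr => i _.
    by rewrite smfM smfB xE//= G0E// chi1'// mul1r.
  rewrite fE tangD tang_cst add0r tang_sum; apply: eq_bigr => i _.
  have -> : v ((x i - cstS M (y0 0 i)) * G i) = g i y0 * v (x i - cstS M (y0 0 i)).
    rewrite tangM; have -> : G i m = g i y0 by rewrite /= G0E// chi1'// mul1r.
    by rewrite smfB xE// subrr mul0r add0r.
  rewrite tangD tangN tang_cst subr0 mulrC -[RHS]/(v (x i) * D i m f).
  by rewrite dE// /g ray_int_center.
- move=> i j m Vm'; rewrite dE//.
  transitivity ('D_(delta_mx 0 i) (fun y : 'rV[R]_n => y 0 j) (chart_map c m)).
    apply: near_eq_derive.
    have oO := @open_chart_inv _ _ _ c _ oV.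
    have Op : (chart_img c `&` chart_inv c @^-1` V) (chart_map c m).
      by split; [exact/chart_mapP/Vc|rewrite /= chart_mapK//; exact: Vc].
    apply: filterS (open_nbhs_nbhs (conj oO Op)) => y [cy Vy].
    have -> : (x j \o chart_inv c) y = x j (chart_inv c y) by [].
    by rewrite xE// chart_invK.
  have [_ ->] := derive_coord (chart_map c m) (delta_mx 0 i) j.
  by rewrite mxE eqxx /= eq_sym.
Qed.

End Derivations.

(** * Vector bundles through local frames *)

Section Frames.
Context {R : realType} {n : nat} {M : manifold R n}.
Implicit Types (E : bundle M) (V : set M).

Lemma secD E (s t : section E) m : (s + t) m = s m + t m. Proof. by []. Qed.
Lemma secB E (s t : section E) m : (s - t) m = s m - t m. Proof. by []. Qed.
Lemma sec0 E m : (0 : section E) m = 0. Proof. by []. Qed.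
Lemma secZ E (f : smooth_fun M) (s : section E) m : (f *: s) m = f m *: s m.
Proof. by []. Qed.
Lemma sec_sum E (I : Type) (r : seq I) (F : I -> section E) m :
  (\sum_(i <- r) F i) m = \sum_(i <- r) F i m.
Proof.
elim: r => [|i r IH]; first by rewrite !big_nil.
by rewrite !big_cons secD IH.
Qed.

Definition local_sections E := forall s : forall m, E m,
  (forall m, exists V (t : section E),
     [/\ open V, V m & forall x, V x -> s x = t x]) -> smooth_section E s.

(** The sections e k and the coordinate forms th k are globally defined and
    smooth, although they are dual to each other only over V. This keeps all
    later computations among global sections. *)
Record local_frame E V (I : finType) (e : I -> section E)
    (th : I -> forall m, E m -> R) : Prop := LocalFrame {
  lf_open : open V;
  lf_linear : forall k m a x y, th k m (a *: x + y) = a * th k m x + th k m y;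
  lf_smooth : forall k (s : section E), msmooth (fun m => th k m (s m));
  lf_span : forall m x, V m -> x = \sum_k th k m x *: e k m;
  lf_dual : forall j k m, V m -> th j m (e k m) = (j == k)%:R
}.

Definition has_frames E := forall m, exists V (I : finType) (e : I -> section E)
  (th : I -> forall m, E m -> R), V m /\ local_frame V e th.

Definition framed E := local_sections E /\ has_frames E.

(** A local trivialization is cut off by a bump function. *)
Lemma vector_bundle_framed E : is_vector_bundle E -> framed E.
Proof.
move=> [A [cov compat sm]]; split.
  move=> s loc; apply/sm => t At k; apply: msmooth_on_local => m tm.
  have [V [s' [oV Vm ss']]] := loc m.
  exists (triv_dom t `&` V) => //.
  have oW : open (triv_dom t `&` V) by apply: openI => //; exact: triv_dom_open.
  apply: (@eq_msmooth_on _ _ _ _ (fun m => triv_map t m (s' m) 0 k)) => //.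
    by move=> x [_ Vx]; rewrite ss'.
  apply: msmooth_on_subset (iffLR (sm _) (sectionP s') t At k).
  by move=> x [].
move=> m0; have [t At tm] := cov m0.
have [chi [V [K [oV Vm cK KU [chi1 chi0]]]]] := bump_exists (triv_dom_open t) tm.
have Vt m : V m -> triv_dom t m.
  move=> Vx; apply: KU; exact: (bump_plateau chi1 chi0).
pose e0 k m : E m := chi m *: triv_inv t m (delta_mx 0 k).
have es k : smooth_section E (e0 k).
  apply/sm => t' At' k'; apply: msmooth_on_local => m tm'.
  have [Km|nK] := pselect (K m).
    have oW : open (triv_dom t `&` triv_dom t').
      by apply: openI; exact: triv_dom_open.
    exists (triv_dom t `&` triv_dom t'); first by split => //; exact: KU.
    apply: eq_msmooth_on (msmooth_onM oW (smooth_fun_on _ chi)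
      (compat t t' At At' (delta_mx 0 k) k')) => // x _ /=.
    by rewrite linearZ mxE.
  exists (~` K) => //.
  apply: (@eq_msmooth_on _ _ _ _ (cst 0)); first exact: closed_openC.
    by move=> x nKx; rewrite /e0 chi0// scale0r linear0 mxE.
  by apply: msmooth_on_subset (msmooth_cst 0).
pose e k := mk_section (es k).
pose th (k : 'I_(triv_rank t)) m (x : E m) : R := chi m * triv_map t m x 0 k.
exists V, 'I_(triv_rank t), e, th; split => //; split => //.
- by move=> k m a x y; rewrite /th linearP !mxE; ring.
- move=> k s; apply: (@msmooth_extend _ _ _ _ _ _ (triv_dom_open t) cK KU).
    apply: msmooth_onM; [exact: triv_dom_open|exact: smooth_fun_on|].
    exact: (iffLR (sm _) (sectionP s) t At k).
  by move=> x nK; rewrite /th chi0// mul0r.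
- move=> m x Vx; apply: (can_inj (triv_mapK (Vt _ Vx))).
  rewrite linear_sum {1}(row_sum_delta (triv_map t m x)).
  apply: eq_bigr => k _.
  by rewrite linearZ/= /th /e0 chi1// mul1r scale1r triv_invK//; exact: Vt.
- move=> j k m Vx; rewrite /th /e/= /e0 chi1// mul1r scale1r triv_invK//; last exact: Vt.
  by rewrite mxE eqxx.
Qed.

Lemma frame_th_sum E V (J : finType) (e : J -> section E) th m (I : Type) (s : seq I)
    (a : I -> R) (F : I -> E m) j : local_frame V e th ->
  th j m (\sum_(i <- s) a i *: F i) = \sum_(i <- s) a i * th j m (F i).
Proof.
move=> [_ lin _ _ _]; elim: s => [|i s IH].
  rewrite !big_nil; have := lin j m 1 0 0; rewrite scaler0 addr0 mul1r => /eq_double0 //.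
by rewrite !big_cons lin IH.
Qed.

Lemma frame_thZ E V (J : finType) (e : J -> section E) th m (a : R) (x : E m) j :
  local_frame V e th -> th j m (a *: x) = a * th j m x.
Proof.
move=> lf; have := @frame_th_sum _ _ _ _ _ m unit [:: tt] (fun=> a) (fun=> x) j lf.
by rewrite !big_seq1.
Qed.

(** The trivializations are all those whose coordinates are smooth on smooth
    sections and whose constant sections extend to global ones; any
    two of them are compatible. *)
Lemma framed_vector_bundle E : framed E -> is_vector_bundle E.
Proof.
move=> [loc fr].
exists [set t : local_triv E |
  (forall (s : section E) k, msmooth_on (triv_dom t) (fun m => triv_map t m (s m) 0 k)) /\
  (forall w, exists e : section E, forall m, triv_dom t m -> triv_inv t m w = e m)].
have triv m0 : exists2 t : local_triv E,
  (forall (s : section E) k, msmooth_on (triv_dom t) (fun m => triv_map t m (s m) 0 k)) /\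
  (forall w, exists e : section E, forall m, triv_dom t m -> triv_inv t m w = e m) &
  triv_dom t m0.
  have [V [r [e [th [Vm0 [oV lin sm span dual]]]]]] := fr m0.
  have lf : local_frame V e th by [].
  pose tm m (x : E m) : 'rV[R]_#|r| := \row_k th (enum_val k) m x.
  have ltm m : linear (@tm m).
    by move=> a x y; apply/rowP => k; rewrite !mxE lin.
  pose tml m : {linear E m -> 'rV[R]_#|r|} :=
    HB.pack (@tm m) (GRing.isLinear.Build _ _ _ _ (@tm m) (@ltm m)).
  pose ti m (w : 'rV[R]_#|r|) : E m := \sum_k w 0 k *: e (enum_val k) m.
  have tmK m : V m -> cancel (tml m) (ti m).
    move=> Vm x; rewrite /ti [RHS](span m x Vm).
    rewrite [RHS](reindex _ (onW_bij _ (@enum_val_bij r))); apply: eq_bigr => k _.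
    by rewrite /= mxE.
  have tiK m : V m -> cancel (ti m) (tml m).
    move=> Vm w; apply/rowP => k; rewrite /= mxE /ti (@frame_th_sum _ _ _ _ _ _ _ _ _ _ _ lf).
    rewrite (bigD1 k)//= dual// eqxx mulr1 big1 ?addr0// => j jk.
    by rewrite dual// (inj_eq enum_val_inj) eq_sym (negbTE jk) mulr0.
  exists (LocalTriv oV tmK tiK) => //=; split.
    move=> s k; have -> : (fun m => tm m (s m) 0 k) = (fun m => th (enum_val k) m (s m)).
      by apply/funext => m; rewrite mxE.
    exact: msmooth_on_subset (sm _ s).
  move=> w; exists (\sum_k cstS M (w 0 k) *: e (enum_val k)) => m _.
  by rewrite sec_sum.
split.
- by move=> m; have [t At tm] := triv m; exists t.
- move=> t t' [_ Ate] [At's _] w k; have [e te] := Ate w.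
  have oW : open (triv_dom t `&` triv_dom t').
    by apply: openI; exact: triv_dom_open.
  apply: (@eq_msmooth_on _ _ _ _ (fun m => triv_map t' m (e m) 0 k)) => //.
    by move=> m [tm _]; rewrite te.
  by apply: msmooth_on_subset (At's e k) => m [].
- move=> s; split=> [ss t [At _] k|H]; first exact: (At (mk_section ss)).
  apply: loc => m0; have [t [At Ae] tm0] := triv m0.
  have [chi [V [K [oV Vm cK KU [chi1 chi0]]]]] := bump_exists (triv_dom_open t) tm0.
  have Vt m : V m -> triv_dom t m.
    move=> Vx; apply: KU; exact: (bump_plateau chi1 chi0).
  have fs k : msmooth (fun m => chi m * triv_map t m (s m) 0 k).
    apply: (@msmooth_extend _ _ _ _ _ _ (triv_dom_open t) cK KU).
      apply: msmooth_onM; [exact: triv_dom_open|exact: smooth_fun_on|].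
      exact: H.
    by move=> x nK; rewrite chi0// mul0r.
  have [e eE] := choice (fun k => Ae (delta_mx 0 k)).
  exists V, (\sum_k mk_smooth (fs k) *: e k); split => // m Vx.
  apply: (can_inj (triv_mapK (Vt _ Vx))).
  rewrite sec_sum linear_sum {1}(row_sum_delta (triv_map t m (s m))).
  apply: eq_bigr => k _.
  rewrite secZ linearZ -eE; last exact: Vt.
  by rewrite triv_invK/= ?chi1 ?mul1r//; exact: Vt.
Qed.

Lemma framed_extend E m (x : E m) : framed E -> exists s : section E, s m = x.
Proof.
move=> [_ /(_ m)[V [r [e [th [Vm [_ _ _ span _]]]]]]].
exists (\sum_k cstS M (th k m x) *: e k).
by rewrite [RHS](span m x Vm) sec_sum; apply: eq_bigr.
Qed.

(** Near m a section is a combination of the frame with coefficients that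
    vanish at m; a bump function makes this an identity of global
    sections. *)
Lemma tensorial0 E (W : lmodType R) m (F : section E -> W) (s : section E) :
  framed E -> (forall f s t, F (f *: s + t) = f m *: F s + F t) ->
  s m = 0 -> F s = 0.
Proof.
move=> [_ /(_ m)[V [r [e [th [Vm lf]]]]]] Flin sm0; have [oV _ sm span _] := lf.
have F0 : F 0 = 0.
  have := Flin 1 0 0; rewrite scaler0 addr0 smf1 scale1r => /eq_double0 //.
have FZ f t : F (f *: t) = f m *: F t by rewrite -[f *: t]addr0 Flin F0 addr0.
have Fsum (I : Type) (l : seq I) (f : I -> smooth_fun M) t :
    F (\sum_(i <- l) f i *: t i) = \sum_(i <- l) f i m *: F (t i).
  by elim: l => [|i l IH]; [rewrite !big_nil|rewrite !big_cons Flin IH].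
have [chi [U [K [_ Um _ KV [chi1 chi0]]]]] := bump_exists oV Vm.
have E1 : chi *: s = \sum_k (chi * mk_smooth (sm k s)) *: e k.
  apply: section_eq => x; rewrite sec_sum secZ.
  have [Vx|nVx] := pselect (V x).
    rewrite {1}(span x (s x) Vx) scaler_sumr; apply: eq_bigr => k _.
    by rewrite secZ smfM scalerA.
  have chix : chi x = 0 by apply: chi0 => /KV.
  by rewrite chix scale0r big1// => k _; rewrite secZ smfM chix mul0r scale0r.
have := FZ chi s; rewrite chi1// scale1r E1 Fsum => <-.
rewrite big1// => k _; rewrite smfM /= sm0.
have -> : th k m 0 = 0 by rewrite -(scale0r 0) (@frame_thZ _ _ _ _ _ _ _ _ _ lf) mul0r.
by rewrite mulr0 scale0r.
Qed.

Lemma tensorial E (W : lmodType R) m (F : section E -> W) (s t : section E) :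
  framed E -> (forall f s t, F (f *: s + t) = f m *: F s + F t) ->
  s m = t m -> F s = F t.
Proof.
move=> fE Flin st.
have := @tensorial0 _ _ m F (-1 *: s + t) fE Flin.
rewrite Flin secD secZ st => H.
have m1 : (-1 : smooth_fun M) m = -1 by [].
move: H; rewrite m1 !scaleN1r addNr => /(_ erefl)/eqP.
by rewrite addrC subr_eq0 => /eqP.
Qed.

(** A section specified by a pointwise condition with unique solutions is smooth
    if the condition has smooth local solutions. *)
Lemma patch_section E (P : forall m, E m -> Prop) : local_sections E ->
  (forall m x y, P m x -> P m y -> x = y) ->
  (forall m, exists V (t : section E), [/\ open V, V m & forall x, V x -> P x (t x)]) ->
  exists s : section E, forall m, P m (s m).
Proof.
move=> loc uniq ex.
have exP m : exists x, P m x by have [V [t [_ Vm VP]]] := ex m; exists (t m); exact: VP.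
pose s0 m : E m := sval (cid (exP m)).
have s0P m : P m (s0 m) := svalP (cid (exP m)).
have ss : smooth_section E s0.
  apply: loc => m; have [V [t [oV Vm VP]]] := ex m; exists V, t; split => // x Vx.
  by apply: uniq (s0P x) _; exact: VP.
by exists (mk_section ss).
Qed.

(** Used to invert a Gram determinant. *)
Lemma inverse_near (f : smooth_fun M) m : f m != 0 ->
  exists V (g : smooth_fun M), [/\ open V, V m & forall x, V x -> f x * g x = 1].
Proof.
move=> fm; have [c Ac cm] := atlas_cover m.
pose h := f \o chart_inv c.
have Ch k : Ck_on k (chart_img c) h.
  by have := smooth_funP f Ac k; rewrite preimage_setT setIT.
pose O := chart_img c `&` [set y | h y != 0].
have oO : open O.
  rewrite openE => y [cy hy].
  apply: filterI; first by apply: open_nbhs_nbhs; split => //; exact: chart_img_open.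
  have hc := Ck_on_continuous (Ch 0%N) cy.
  apply: (hc [set z | z != 0]); apply: open_nbhs_nbhs; split; last exact: hy.
  exact: open_neq.
have sO : smooth_on O (fun y => (h y)^-1).
  by move=> k; apply: Ck_onV => //; [move=> y []|apply: Ck_on_subset (Ch k) => y []].
have oU := @open_chart_map _ _ _ c _ oO.
have Um : (chart_dom c `&` chart_map c @^-1` O) m.
  by split => //; split; [exact: chart_mapP|rewrite /= /h /= chart_mapK].
have [chi [V [K [oV Vm cK KU [chi1 chi0]]]]] := bump_exists oU Um.
pose g0 x := chi x / f x.
have gs : msmooth g0.
  apply: (msmooth_extend oU cK KU).
    apply: msmooth_onM; [exact: oU|exact: smooth_fun_on|].
    apply: eq_msmooth_on (msmooth_on_chart Ac oO sO) => //.
    by move=> x [cx _] /=; rewrite /h /= chart_mapK.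
  by move=> x nK; rewrite /g0 chi0// mul0r.
exists V, (mk_smooth gs); split => // x Vx.
have [cx [_]] : (chart_dom c `&` chart_map c @^-1` O) x.
  apply: KU; exact: (bump_plateau chi1 chi0).
rewrite /= /h /= chart_mapK// => fx.
by rewrite /g0 chi1// mul1r divff.
Qed.

End Frames.

(** * The tangent and cotangent bundles *)

Section TangentFrames.
Context {R : realType} {n : nat} {M : manifold R n}.

Lemma msmooth_local (f : M -> R) : (forall m, exists V (g : M -> R),
    [/\ open V, V m, msmooth g & forall x, V x -> f x = g x]) -> msmooth f.
Proof.
move=> loc; apply: msmooth_on_local => m _.
have [V [g [oV Vm sg fg]]] := loc m; exists V => //.
apply: (@eq_msmooth_on _ _ _ _ g) => //; first by move=> x Vx; rewrite fg.
exact: msmooth_on_subset sg.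
Qed.

Lemma tangent_framed : framed (tangent_bundle M).
Proof.
split.
  move=> X loc f; apply: msmooth_local => m.
  have [V [Y [oV Vm XY]]] := loc m.
  exists V, (fun m => Y m f); split => //; first exact: (sectionP Y f).
  by move=> x Vx; rewrite XY.
move=> m; have [V [x [D [oV Vm span dual]]]] := local_coordinates m.
exists V, 'I_n, D, (fun k m (v : tangent m) => v (x k)); split => //; split => //.
- by move=> k X; exact: (sectionP X (x k)).
- by move=> j k m' Vm'; rewrite dual// eq_sym.
Qed.

Lemma cotangent_framed : framed (cotangent_bundle M).
Proof.
split.
  move=> xi loc X; apply: msmooth_local => m.
  have [V [eta [oV Vm XY]]] := loc m.
  exists V, (fun m => eta m (X m)); split => //; first exact: (sectionP eta X).
  by move=> x Vx; rewrite XY.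
move=> m; have [V [x [D [oV Vm span dual]]]] := local_coordinates m.
exists V, 'I_n, (fun k => diff (x k)), (fun k m (xi : cotangent m) => xi (D k m)).
split => //; split => //.
- by move=> k xi; exact: (sectionP xi (D k)).
- move=> m' xi Vm'; apply/val_inj/funext => v.
  pose xiL : {linear tangent m' -> R^o} :=
    HB.pack (xi : tangent m' -> R^o)
      (GRing.isLinear.Build _ _ _ _ (xi : tangent m' -> R^o) (cotangentP xi)).
  have sumE (l : seq 'I_n) (a : 'I_n -> R) :
      (\sum_(i <- l) a i *: diff (x i) m' : cotangent m') v =
      \sum_(i <- l) a i * v (x i).
    elim: l => [|i l IH]; first by rewrite !big_nil.
    by rewrite !big_cons -IH.
  etransitivity; last exact: (esym (sumE _ (fun i => xi (D i m')))).
  rewrite {1}(span m' v Vm') -[LHS]/(xiL _) linear_sum.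
  apply: eq_bigr => i _; rewrite linearZ /=.
  by rewrite [LHS]mulrC.
Qed.

Lemma oneform_eq (xi eta : oneform M) :
  (forall X, contract xi X = contract eta X) -> xi = eta.
Proof.
move=> H; apply: section_eq => m; apply/val_inj/funext => v.
have [X <-] := @framed_extend _ _ _ (tangent_bundle M) m v tangent_framed.
by have := H X => /(congr1 (fun f : smooth_fun M => f m)).
Qed.

Lemma vf_eq (X Y : vector_field M) : (forall f, vf_app X f = vf_app Y f) -> X = Y.
Proof.
move=> H; apply: section_eq => m; apply/val_inj/funext => f.
by have := H f => /(congr1 (fun f : smooth_fun M => f m)).
Qed.

(** A C^oo(M)-linear form on vector fields is tensorial, hence comes from a
    linear form on each tangent space. *)
Lemma oneform_of (F : vector_field M -> smooth_fun M) :
  (forall f X Y, F (f *: X + Y) = f * F X + F Y) ->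
  exists xi : oneform M, forall X, contract xi X = F X.
Proof.
move=> Flin.
have Fl m f X Y : (F (f *: X + Y) m : R^o) = f m *: (F X m : R^o) + F Y m.
  by rewrite Flin.
have tens m (X Y : vector_field M) : X m = Y m -> F X m = F Y m.
  exact: (@tensorial _ _ _ _ R^o m (fun X => F X m) X Y tangent_framed (Fl m)).
have [ext extE] := choice (fun mv : {m : M & tangent m} =>
  @framed_extend _ _ _ (tangent_bundle M) (projT1 mv) (projT2 mv) tangent_framed).
pose xi0 m (v : tangent m) : R := F (ext (existT _ m v)) m.
have xi0E m (X : vector_field M) : xi0 m (X m) = F X m by apply: tens; rewrite extE.
have lxi m : is_linear_form (xi0 m).
  move=> a v w.
  have [X Xv] := @framed_extend _ _ _ (tangent_bundle M) m v tangent_framed.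
  have [Y Yw] := @framed_extend _ _ _ (tangent_bundle M) m w tangent_framed.
  rewrite -Xv -Yw !xi0E.
  rewrite -[a *: _ + _]/((cstS M a *: X + Y) m) xi0E Flin.
  by [].
have sxi : smooth_oneform (fun m => mk_cotangent (lxi m)).
  move=> X; have -> : (fun m => mk_cotangent (lxi m) (X m)) = F X.
    by apply/funext => m; exact: xi0E.
  exact: smooth_funP.
exists (@mk_section _ _ _ (cotangent_bundle M) _ sxi) => X.
by apply: smooth_fun_eq => m; exact: xi0E.
Qed.

End TangentFrames.

(** * The jet bundle and the Spencer decomposition *)

Section JetSections.
Context {R : realType} {n : nat} {M : manifold R n} {E : bundle M}.
Hypothesis fE : framed E.
Implicit Types (d : gauge E) (X Y : vector_field M) (s t : section E).

Lemma gaugeDE d d' s : (d + d') s = d s + d' s. Proof. by []. Qed.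
Lemma gaugeZE (f : smooth_fun M) d s : (f *: d) s = f *: d s. Proof. by []. Qed.
Lemma gaugeNE d s : (- d) s = - d s. Proof. by []. Qed.
Lemma symbolD d d' : symbol (d + d') = symbol d + symbol d'. Proof. by []. Qed.
Lemma symbolN d : symbol (- d) = - symbol d. Proof. by []. Qed.
Lemma symbolZ (f : smooth_fun M) d : symbol (f *: d) = f *: symbol d. Proof. by []. Qed.

Lemma gauge_sumE (I : Type) (r : seq I) (F : I -> gauge E) s :
  (\sum_(i <- r) F i) s = \sum_(i <- r) F i s.
Proof.
elim: r => [|i r IH]; first by rewrite !big_nil.
by rewrite !big_cons gaugeDE IH.
Qed.

Lemma symbol_sum (I : Type) (r : seq I) (F : I -> gauge E) :
  symbol (\sum_(i <- r) F i) = \sum_(i <- r) symbol (F i).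
Proof.
elim: r => [|i r IH]; first by rewrite !big_nil.
by rewrite !big_cons symbolD IH.
Qed.

Lemma gauge_eq d d' : (forall s, d s = d' s) -> symbol d = symbol d' -> d = d'.
Proof.
move=> H S; apply: val_inj; move: H S; rewrite /gauge_op /symbol /=.
case: (gauge_val d) => D X; case: (gauge_val d') => D' X' /= H ->.
by congr (_, _); apply/funext.
Qed.

Section JetPoint.
Context {m : M}.
Implicit Types nu : jet E m.

Lemma jet_linear nu (f : smooth_fun M) d d' : nu (f *: d + d') = f m *: nu d + nu d'.
Proof. by have [+ _] := jetP nu; apply. Qed.

Lemma jet0 nu : nu 0 = 0.
Proof.
have := jet_linear nu 1 0 0; rewrite scaler0 addr0 smf1 scale1r => /eq_double0 //.
Qed.

Lemma jetD nu d d' : nu (d + d') = nu d + nu d'.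
Proof. by have := jet_linear nu 1 d d'; rewrite !scale1r. Qed.

Lemma jetZ nu f d : nu (f *: d) = f m *: nu d.
Proof. by have := jet_linear nu f d 0; rewrite jet0 !addr0. Qed.

Lemma jetN nu d : nu (- d) = - nu d.
Proof. by apply/eqP; rewrite -addr_eq0 -jetD addNr jet0. Qed.

Lemma jet_sum nu (I : Type) (r : seq I) (F : I -> gauge E) :
  nu (\sum_(i <- r) F i) = \sum_(i <- r) nu (F i).
Proof.
elim: r => [|i r IH]; first by rewrite !big_nil jet0.
by rewrite !big_cons jetD IH.
Qed.

End JetPoint.

Lemma gauge_tensorial d m s t : symbol d = 0 -> s m = t m -> d s m = d t m.
Proof.
move=> d0; apply: (@tensorial _ _ _ _ (E m) m (fun s => d s m) s t fE).
move=> f u v; rewrite gaugeD gaugeL d0.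
have -> : vf_app (0 : vector_field M) f = 0 by apply: smooth_fun_eq.
by rewrite scale0r addr0.
Qed.

(** A derivation with zero symbol is C^oo(M)-linear, hence acts fibrewise. *)
Lemma gauge_symbol0_endo d : symbol d = 0 -> exists Phi : endo E, gauge_of_endo Phi = d.
Proof.
move=> d0.
have [ext extE] := choice (fun mx : {m : M & E m} => framed_extend (projT2 mx) fE).
pose F m (x : E m) : E m := d (ext (existT _ m x)) m.
have FE m s : F m (s m) = d s m.
  by apply: gauge_tensorial => //; exact: (extE (existT _ m (s m))).
have lF m : linear (F m).
  move=> a x y.
  have [s sx] := framed_extend x fE; have [t ty] := framed_extend y fE.
  rewrite -sx -ty -[a *: s m]/((cstS M a *: s) m) -secD !FE gaugeD gaugeZ.
  by [].
pose Fl m : {linear E m -> E m} :=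
  HB.pack (F m) (GRing.isLinear.Build _ _ _ _ (F m) (@lF m)).
have sF s : smooth_section E (fun m => Fl m (s m)).
  have -> : (fun m => Fl m (s m)) = d s.
    by apply: functional_extensionality_dep => m; exact: FE.
  exact: sectionP.
exists (Endo sF); apply: gauge_eq; last by rewrite d0.
by move=> s; apply: section_eq => m; exact: FE.
Qed.

(** Componentwise differentiation along X in a frame, multiplied by a bump
    function chi supported where the frame is one; so the symbol is chi X, and
    the members of the frame are parallel over V. *)
Lemma local_connection m0 V (I : finType) (e : I -> section E)
    (th : I -> forall m, E m -> R) : V m0 -> local_frame V e th ->
  exists W (chi : smooth_fun M) (D : vector_field M -> gauge E),
    [/\ open W, W m0, W `<=` V, (forall m, W m -> chi m = 1) &
        (forall X, symbol (D X) = chi *: X) /\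
        (forall X k m, V m -> D X (e k) m = 0)].
Proof.
move=> Vm0 [oV lin sm span dual].
have [chi [W [K [oW Wm _ KV [chi1 chi0]]]]] := bump_exists oV Vm0.
have WV : W `<=` V.
  move=> x Wx; apply: KV; exact: (bump_plateau chi1 chi0).
pose c k s : smooth_fun M := mk_smooth (sm k s).
have cD k s t : c k (s + t) = c k s + c k t.
  apply: smooth_fun_eq => m.
  by have := lin k m 1 (s m) (t m); rewrite scale1r mul1r.
have cZ k f s : c k (f *: s) = f * c k s.
  apply: smooth_fun_eq => m.
  have th0 : th k m 0 = 0.
    have := lin k m 1 0 0; rewrite scaler0 addr0 mul1r => /eq_double0 //.
  by have := lin k m (f m) (s m) 0; rewrite addr0 th0 addr0.
pose op X s : section E := \sum_k (chi * vf_app X (c k s)) *: e k.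
have gop X : is_gauge (op X, chi *: X).
  split=> [s t|a s|f s] /=.
  - rewrite /op -big_split; apply: eq_bigr => k _ /=.
    by rewrite cD vf_appD mulrDr scalerDl.
  - rewrite /op scaler_sumr; apply: eq_bigr => k _.
    by rewrite cZ vf_appZ mulrCA scalerA.
  - have E1 : vf_app (chi *: X) f *: s = \sum_k (chi * (c k s * vf_app X f)) *: e k.
      apply: section_eq => m; rewrite secZ sec_sum.
      have E2 : vf_app (chi *: X) f m = chi m * vf_app X f m by [].
      rewrite E2; have [Vm|nV] := pselect (V m).
        rewrite {1}(span m (s m) Vm) scaler_sumr; apply: eq_bigr => k _.
        rewrite secZ smfM (_ : (c k s * vf_app X f) m = th k m (s m) * vf_app X f m)//.
        by rewrite scalerA -mulrA [_ * th _ _ _]mulrC.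
      have chim : chi m = 0 by apply: chi0 => /KV.
      rewrite chim mul0r scale0r big1// => k _.
      by rewrite secZ smfM chim mul0r scale0r.
    rewrite E1 /op scaler_sumr -big_split; apply: eq_bigr => k _ /=.
    by rewrite cZ vf_appM mulrDr scalerDl mulrCA scalerA.
exists W, chi, (fun X => mk_gauge (gop X)); split => //; split => // X k m Vm.
rewrite -[LHS]/(op X (e k) m) /op sec_sum big1// => j _.
rewrite secZ smfM.
have -> : vf_app X (c j (e k)) m = 0.
  rewrite -(tang_cst (X m) (j == k)%:R).
  apply: (tang_local _ oV Vm) => x Vx.
  by rewrite /= dual.
by rewrite mulr0 scale0r.
Qed.

Lemma gauge_exists X m : exists d, symbol d m = X m.
Proof.
have [_ /(_ m)[V [I [e [th [Vm lf]]]]]] := fE.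
have [W [chi [D [_ Wm _ chi1 [sD _]]]]] := local_connection Vm lf.
by exists (D X); rewrite sD secZ chi1// scale1r.
Qed.

(** Subtracting from d the combination of local connections with the same
    symbol and cutting off gives a derivation with zero symbol, that is, an
    endomorphism of E; and on endomorphisms a jet is determined by its
    value at the identity. *)
Lemma jet_symbol0 m (nu : jet E m) d s : symbol d m = 0 ->
  s m = nu (gauge_of_endo (endo_id E)) -> nu d = d s m.
Proof.
move=> d0 sm.
have [V [x [Y [oV Vm span dual]]]] := local_coordinates m.
have [_ /(_ m)[V' [I [e [th [V'm lf]]]]]] := fE.
have [W [chi [D [oW Wm _ chi1 [sD _]]]]] := local_connection V'm lf.
(* The coefficients of the sum vanish at m. *)
pose d' := d - \sum_i vf_app (symbol d) (x i) *: D (Y i).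
have [chi' [U [K [oU Um _ KVW [chi1' chi0']]]]] :=
  bump_exists (openI oV oW) (conj Vm Wm).
have S0 : symbol (chi' *: d') = 0.
  apply: section_eq => z; rewrite symbolZ secZ.
  have [[Vz Wz]|nVW] := pselect ((V `&` W) z); last first.
    by rewrite chi0' ?scale0r// => /KVW.
  suff -> : symbol d' z = 0 by rewrite scaler0.
  rewrite /d' symbolD symbolN symbol_sum secB sec_sum.
  rewrite [X in X - _](span z (symbol d z) Vz).
  apply/eqP; rewrite subr_eq0; apply/eqP; apply: eq_bigr => i _.
  by rewrite symbolZ sD !secZ chi1// scale1r.
have [Phi PhiE] := gauge_symbol0_endo S0.
have c0 i : vf_app (symbol d) (x i) m = 0.
  by rewrite -[LHS]/(symbol d m (x i)) d0.
have E1 : nu (chi' *: d') = nu d.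
  rewrite jetZ chi1'// scale1r /d' jetD jetN jet_sum big1 ?subr0// => i _.
  by rewrite jetZ c0 scale0r.
have E2 : (chi' *: d') s m = d s m.
  rewrite gaugeZE secZ chi1'// scale1r /d' gaugeDE gaugeNE gauge_sumE secB sec_sum.
  by rewrite big1 ?subr0// => i _; rewrite gaugeZE secZ c0 scale0r.
have [_ nuPhi] := jetP nu.
by rewrite -E1 -E2 -PhiE nuPhi -sm.
Qed.

(** With a frame e of E and coordinates x, the jets d e_k and dx_i (x) e_k form a
    frame. The dual coordinates of nu are those of nu(Id) and of nu(D_i), where D_i is
    the local connection of the frame along the i-th coordinate
    field. *)
Lemma jet_frame_exists m0 : exists V (I : finType)
    (e : I -> section (jet_bundle E)) (th : I -> forall m, jet_bundle E m -> R),
  [/\ V m0, local_frame V e th & forall k,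
     (exists s, e k = prolong s) \/ (exists f s, e k = tens (diff f) s)].
Proof.
have [V [x [Y [oV Vm span dual]]]] := local_coordinates m0.
have [_ /(_ m0)[V' [I [e [th [V'm lf]]]]]] := fE.
have [W [chi [D [oW Wm WV' chi1 [sD De]]]]] := local_connection V'm lf.
pose Id : gauge E := gauge_of_endo (endo_id E).
exists (V `&` W), (I + 'I_n * I)%type.
exists (fun k => match k with
  | inl k => prolong (e k)
  | inr ik => tens (diff (x ik.1)) (e ik.2) end).
exists (fun k m (nu : jet E m) => match k with
  | inl k => th k m (nu Id)
  | inr ik => th ik.2 m (nu (D (Y ik.1))) end).
split => //; last first.
  by case=> [k|[i k]]; [left; exists (e k)|right; exists (x i), (e k)].
have [_ lin sm spanE dualE] := lf.
split.
- exact: openI.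
- by case=> [k|[i k]] m a nu mu; rewrite -lin.
- move=> [k|[i k]] nu; first exact: (sm k (mk_section (sectionP nu Id))).
  exact: (sm k (mk_section (sectionP nu (D (Y i))))).
- move=> m nu [Vx Wx]; apply/val_inj/funext => d.
  have V'x := WV' _ Wx.
  pose s := \sum_k cstS M (th k m (nu Id)) *: e k.
  have s_nu : s m = nu Id by rewrite [RHS](spanE m _ V'x) /s sec_sum; apply: eq_bigr.
  pose d' := d - \sum_i vf_app (symbol d) (x i) *: D (Y i).
  have S0 : symbol d' m = 0.
    rewrite /d' symbolD symbolN symbol_sum secB sec_sum.
    rewrite [X in X - _](span m (symbol d m) Vx).
    apply/eqP; rewrite subr_eq0; apply/eqP; apply: eq_bigr => i _.
    by rewrite symbolZ sD !secZ chi1// scale1r.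
  have := jet_symbol0 S0 s_nu.
  rewrite /d' jetD jetN jet_sum gaugeDE gaugeNE gauge_sumE secB sec_sum.
  rewrite [X in _ = _ - X]big1 ?subr0; last first.
    move=> i _; rewrite gaugeZE secZ /s.
    have -> : D (Y i) (\sum_k cstS M (th k m (nu Id)) *: e k) m = 0.
      elim: (index_enum I) => [|k l IH].
        rewrite big_nil; have := gaugeZ (D (Y i)) 0 0.
        rewrite scaler0 => ->; rewrite secZ.
        by rewrite (_ : cstS M 0 m = 0)// scale0r.
      by rewrite big_cons gaugeD gaugeZ secD IH secZ De// scaler0 addr0.
    by rewrite scaler0.
  move/eqP; rewrite subr_eq => /eqP nud; rewrite -[LHS]/(nu d) nud.
  have ev (l : seq (I + 'I_n * I)) (a : I + 'I_n * I -> R) (F : I + 'I_n * I -> jet E m) :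
     (\sum_(i <- l) a i *: F i : jet E m) d = \sum_(i <- l) a i *: F i d.
    elim: l => [|i l IH]; first by rewrite !big_nil.
    by rewrite !big_cons -IH.
  etransitivity; last exact: (esym (ev _ _ _)).
  rewrite big_sumType /=; congr (_ + _).
    rewrite /s; elim: (index_enum I) => [|k l IH].
      rewrite !big_nil; have := gaugeZ d 0 0.
      rewrite scaler0 => ->; rewrite secZ.
      by rewrite (_ : cstS M 0 m = 0)// scale0r.
    by rewrite !big_cons gaugeD gaugeZ secD IH secZ.
  rewrite -(pair_big xpredT xpredT (fun i k =>
    th k m (nu (D (Y i))) *: (tens (diff (x i)) (e k) m d))) /=.
  apply: eq_bigr => i _; rewrite jetZ.
  rewrite {1}(spanE m (nu (D (Y i))) V'x) scaler_sumr; apply: eq_bigr => k _.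
  by rewrite scalerA mulrC -scalerA.
- move=> [j|[j j']] [k|[k k']] m [Vx Wx]; have V'x := WV' _ Wx.
  + by have := dualE j k m V'x; rewrite (inj_eq inl_inj).
  + have E0 : (tens (diff (x k)) (e k') m : jet E m) Id = (0 : R) *: e k' m by [].
    by rewrite E0 (@frame_thZ _ _ _ _ _ _ _ _ _ _ _ _ lf) mul0r.
  + have E0 : (prolong (e k) m : jet E m) (D (Y j)) = (0 : R) *: e k m.
      by rewrite -[LHS]/(D (Y j) (e k) m) De// scale0r.
    by rewrite E0 (@frame_thZ _ _ _ _ _ _ _ _ _ _ _ _ lf) mul0r.
  + have E0 : (tens (diff (x k)) (e k') m : jet E m) (D (Y j)) =
        (j == k)%:R *: e k' m.
      rewrite -[LHS]/(symbol (D (Y j)) m (x k) *: e k' m) sD.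
      have -> : (chi *: Y j) m (x k) = chi m * Y j m (x k) by [].
      by rewrite chi1// mul1r dual.
    rewrite E0 (@frame_thZ _ _ _ _ _ _ _ _ _ _ _ _ lf) dualE// -natrM mulnb.
    by rewrite (inj_eq inr_inj) xpair_eqE.
Qed.

Lemma jet_framed : framed (jet_bundle E).
Proof.
split.
  move=> mu loc d; have [locE _] := fE; apply: locE => m.
  have [V [nu [oV Vm munu]]] := loc m.
  exists V, (mk_section (sectionP nu d)); split => //.
  by move=> x Vx; rewrite munu.
move=> m0; have [V [I [e [th [Vm lf _]]]]] := jet_frame_exists m0.
by exists V, I, e, th.
Qed.

(** This reduces the comparison of two structures to the generators d s and
    df (x) s. *)
Lemma jet_generated (W : lmodType R) m (F : section (jet_bundle E) -> W) :
  (forall f mu nu, F (f *: mu + nu) = f m *: F mu + F nu) ->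
  (forall s, F (prolong s) = 0) -> (forall f s, F (tens (diff f) s) = 0) ->
  forall mu, F mu = 0.
Proof.
move=> Flin F1 F2 mu.
have [V [I [e [th [Vm [_ _ _ span _] gen]]]]] := jet_frame_exists m.
have Fe k : F (e k) = 0 by have [[s ->]|[f [s ->]]] := gen k.
rewrite (@tensorial _ _ _ _ W m F mu (\sum_k cstS M (th k m (mu m)) *: e k) jet_framed Flin).
  elim: (index_enum I) => [|k l IH]; last by rewrite big_cons Flin Fe scaler0 add0r.
  rewrite big_nil; have := Flin 1 0 0; rewrite scaler0 addr0 smf1 scale1r => /eq_double0 //.
by rewrite {1}(span m (mu m) Vm) sec_sum.
Qed.

(** The component X of the Spencer decomposition d X + w. *)
Definition jet_base (mu : section (jet_bundle E)) : section E :=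
  mk_section (sectionP mu (gauge_of_endo (endo_id E))).

(** At m the value of w on X is nu(d) - d(base)(m) for any derivation d whose symbol
    at m is X m. By [jet_symbol0] the choice of d does not matter, and a local
    connection gives a choice that is smooth. *)
Lemma jet_form_exists (mu : section (jet_bundle E)) :
  exists w : vector_field M -> section E, forall X d m,
    symbol d m = X m -> w X m = mu m d - d (jet_base mu) m.
Proof.
have ex X : exists wX : section E, forall m, forall d,
    symbol d m = X m -> wX m = mu m d - d (jet_base mu) m.
  have [locE _] := fE.
  apply: (patch_section (P := fun m x => forall d,
      symbol d m = X m -> x = mu m d - d (jet_base mu) m)) => //.
    move=> m x y Hx Hy; have [d dX] := gauge_exists X m.
    by rewrite (Hx d dX) (Hy d dX).
  move=> m0; have [_ /(_ m0)[V [I [e [th [Vm lf]]]]]] := fE.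
  have [W [chi [D [oW Wm _ chi1 [sD _]]]]] := local_connection Vm lf.
  exists W, (mk_section (sectionP mu (D X)) - D X (jet_base mu)); split => //.
  move=> m Wx d dX; rewrite secB /=.
  have S0 : symbol (D X - d) m = 0.
    by rewrite symbolD symbolN secB sD secZ chi1// scale1r dX subrr.
  have := jet_symbol0 (nu := mu m) (s := jet_base mu) S0 erefl.
  rewrite jetD jetN gaugeDE gaugeNE secB => H.
  have swap (a b c e' : E m) : a - b = c - e' -> a - c = b - e'.
    by move=> abc; rewrite -[a](subrK b) abc addrC !addrA addNr add0r addrC.
  exact: swap H.
have [w wP] := choice ex.
by exists w => X d m; exact: wP.
Qed.

Lemma jet_decomposition (mu : section (jet_bundle E)) :
  exists w : {linear vector_field M -> section E},
    forall d m, mu m d = d (jet_base mu) m + w (symbol d) m.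
Proof.
have [w wP] := jet_form_exists mu.
have lw : linear w.
  move=> f X Y; apply: section_eq => m; rewrite secD secZ.
  have [d dX] := gauge_exists X m; have [d' dY] := gauge_exists Y m.
  rewrite (wP X d)// (wP Y d')// (wP _ (f *: d + d')); last first.
    by rewrite symbolD symbolZ secD secZ dX dY.
  rewrite jet_linear gaugeDE gaugeZE secD secZ.
  by rewrite opprD addrACA scalerBr.
exists (HB.pack w (GRing.isLinear.Build _ _ _ _ w lw) : {linear _ -> _}).
by move=> d m /=; rewrite (wP _ d)// addrC subrK.
Qed.

Lemma mkjet_subproof s (w : {linear vector_field M -> section E}) m :
  is_jet (fun d : gauge E => d s m + w (symbol d) m).
Proof.
split=> [f d d'|Phi].
  rewrite gaugeDE gaugeZE symbolD symbolZ linearD linearZ !secD !secZ.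
  by rewrite addrACA scalerDr.
rewrite -![symbol _]/(0 : vector_field M) linear0 !sec0 !addr0.
by [].
Qed.

Lemma mkjet_smooth s (w : {linear vector_field M -> section E}) :
  smooth_jet (fun m => mk_jet (mkjet_subproof s w m)).
Proof. by move=> d; exact: (sectionP (d s + w (symbol d))). Qed.

(** The inverse of the Spencer decomposition. *)
Definition mkjet s (w : {linear vector_field M -> section E}) : section (jet_bundle E) :=
  @mk_section _ _ _ (jet_bundle E) _ (mkjet_smooth s w).

Lemma jet_section_eq (mu nu : section (jet_bundle E)) :
  (forall m d, mu m d = nu m d) -> mu = nu.
Proof. by move=> H; apply: section_eq => m; apply/val_inj/funext => d; exact: H. Qed.

Lemma mkjetE s w m d : mkjet s w m d = d s m + w (symbol d) m.
Proof. by []. Qed.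

Lemma mkjet_surj mu : exists s w, mu = mkjet s w.
Proof.
have [w wE] := jet_decomposition mu; exists (jet_base mu), w.
by apply: jet_section_eq => m d; rewrite mkjetE wE.
Qed.

End JetSections.

(** * Calculus of vector fields and one-forms *)

Section VectorFieldAlgebra.
Context {R : realType} {n : nat} {M : manifold R n}.
Implicit Types (f g : smooth_fun M) (X Y Z : vector_field M) (xi eta : oneform M).

Lemma vf_appDl X Y f : vf_app (X + Y) f = vf_app X f + vf_app Y f.
Proof. exact: smooth_fun_eq. Qed.
Lemma vf_appZl g X f : vf_app (g *: X) f = g * vf_app X f.
Proof. exact: smooth_fun_eq. Qed.
Lemma vf_appNl X f : vf_app (- X) f = - vf_app X f.
Proof. exact: smooth_fun_eq. Qed.
Lemma vf_app0l f : vf_app (0 : vector_field M) f = 0.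
Proof. exact: smooth_fun_eq. Qed.
Lemma vf_app0 X : vf_app X 0 = 0.
Proof. by apply: smooth_fun_eq => m; exact: tang0. Qed.
Lemma vf_appN X f : vf_app X (- f) = - vf_app X f.
Proof. by apply: smooth_fun_eq => m; exact: tangN. Qed.
Lemma vf_app_cst X c : vf_app X (cstS M c) = 0.
Proof. by apply: smooth_fun_eq => m; exact: tang_cst. Qed.

Lemma contractDl xi eta X : contract (xi + eta) X = contract xi X + contract eta X.
Proof. exact: smooth_fun_eq. Qed.
Lemma contractZl f xi X : contract (f *: xi) X = f * contract xi X.
Proof. exact: smooth_fun_eq. Qed.
Lemma contractNl xi X : contract (- xi) X = - contract xi X.
Proof. exact: smooth_fun_eq. Qed.
Lemma contract0l X : contract 0 X = 0.
Proof. exact: smooth_fun_eq. Qed.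
Lemma contract_lin xi f X Y : contract xi (f *: X + Y) = f * contract xi X + contract xi Y.
Proof. by apply: smooth_fun_eq => m; exact: cotangentP. Qed.
Lemma contract0 xi : contract xi 0 = 0.
Proof.
have := contract_lin xi 1 0 0; rewrite scaler0 addr0 mul1r => /eq_double0 //.
Qed.
Lemma contractD xi X Y : contract xi (X + Y) = contract xi X + contract xi Y.
Proof. by have := contract_lin xi 1 X Y; rewrite scale1r mul1r. Qed.
Lemma contractZ xi f X : contract xi (f *: X) = f * contract xi X.
Proof. by have := contract_lin xi f X 0; rewrite contract0 !addr0. Qed.
Lemma contractN xi X : contract xi (- X) = - contract xi X.
Proof. by rewrite -scaleN1r contractZ mulN1r. Qed.
Lemma contract_diff f X : contract (diff f) X = vf_app X f.
Proof. exact: smooth_fun_eq. Qed.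

Lemma lie_app X Y f :
  vf_app (lie_bracket X Y) f = vf_app X (vf_app Y f) - vf_app Y (vf_app X f).
Proof. exact: smooth_fun_eq. Qed.

Lemma lie_anti X Y : lie_bracket X Y = - lie_bracket Y X.
Proof. by apply: vf_eq => f; rewrite vf_appNl !lie_app opprB. Qed.

Lemma lieDr X Y Z : lie_bracket X (Y + Z) = lie_bracket X Y + lie_bracket X Z.
Proof.
by apply: vf_eq => f; rewrite !(lie_app, vf_appDl, vf_appD); ring.
Qed.

Lemma lieZr X f Y : lie_bracket X (f *: Y) = f *: lie_bracket X Y + vf_app X f *: Y.
Proof.
apply: vf_eq => g; rewrite !(lie_app, vf_appDl, vf_appZl, vf_appM); ring.
Qed.


Lemma lie_jacobi X Y Z : lie_bracket (lie_bracket X Y) Z =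
  lie_bracket X (lie_bracket Y Z) - lie_bracket Y (lie_bracket X Z).
Proof.
apply: vf_eq => f.
rewrite !(lie_app, vf_appDl, vf_appNl, vf_appD, vf_appN); ring.
Qed.

(** The constant function 1/2, so that the identities that involve it can be
    normalized in the ring of smooth functions. *)
Definition half : smooth_fun M := cstS M 2^-1.

Lemma half2 f : half * f + half * f = f.
Proof.
apply: smooth_fun_eq => m; rewrite smfD smfM /=.
by rewrite -mulrDl -div1r -splitr mul1r.
Qed.

Lemma half_inj f g : f + f = g + g -> f = g.
Proof. by move=> fg; rewrite -(half2 f) -(half2 g) -!mulrDr fg. Qed.

Definition smf_eval (m : M) (f : smooth_fun M) : R := f m.
HB.instance Definition _ m :=
  GRing.isZmodMorphism.Build _ _ (smf_eval m) (fun f g => erefl).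
HB.instance Definition _ m :=
  GRing.isMonoidMorphism.Build _ _ (smf_eval m) (conj erefl (fun f g => erefl)).

End VectorFieldAlgebra.

(** * The algebra of a Courant algebroid *)

Section CourantAlgebra.
Context {R : realType} {n : nat} {M : manifold R n}.
Variable C : courant_data M.
Hypothesis HC : is_courant C.
Implicit Types (f g : smooth_fun M) (X Y Z : section C) (U V : vector_field M).
Implicit Types (xi eta : oneform M).

Local Notation an := (ca_anchor C).
Local Notation "<[ X , Y ]>" := (pair_fun (ca_form C) X Y).
Local Notation br := (ca_bracket C).

Lemma courant_framed : framed C.
Proof. exact/vector_bundle_framed/ca_vector_bundle. Qed.

Lemma pf_linl f X Y Z : <[f *: X + Y, Z]> = f * <[X, Z]> + <[Y, Z]>.
Proof.
by apply: smooth_fun_eq => m; exact: (pair_linearl (ca_form C) (f m) (X m) (Y m) (Z m)).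
Qed.
Lemma pfC X Y : <[X, Y]> = <[Y, X]>.
Proof. by apply: smooth_fun_eq => m; exact: (ca_sym HC). Qed.
Lemma pf0l Y : <[0, Y]> = 0.
Proof.
have := pf_linl 1 0 0 Y; rewrite scaler0 addr0 mul1r => /eq_double0 //.
Qed.
Lemma pfDl X Y Z : <[X + Y, Z]> = <[X, Z]> + <[Y, Z]>.
Proof. by have := pf_linl 1 X Y Z; rewrite scale1r mul1r. Qed.
Lemma pfZl f X Z : <[f *: X, Z]> = f * <[X, Z]>.
Proof. by have := pf_linl f X 0 Z; rewrite pf0l !addr0. Qed.
Lemma pfNl X Z : <[- X, Z]> = - <[X, Z]>.
Proof. by rewrite -scaleN1r pfZl mulN1r. Qed.
Lemma pf0r Y : <[Y, 0]> = 0. Proof. by rewrite pfC pf0l. Qed.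
Lemma pfDr X Y Z : <[Z, X + Y]> = <[Z, X]> + <[Z, Y]>.
Proof. by rewrite !(pfC Z) pfDl. Qed.
Lemma pfZr f X Z : <[Z, f *: X]> = f * <[Z, X]>.
Proof. by rewrite !(pfC Z) pfZl. Qed.
Lemma pfNr X Z : <[Z, - X]> = - <[Z, X]>.
Proof. by rewrite !(pfC Z) pfNl. Qed.

Definition pfE := (pfDl, pfDr, pfNl, pfNr, pfZl, pfZr, pf0l, pf0r).

Lemma form_nondeg m (x y : C m) :
  (forall X, ca_form C m x (X m) = ca_form C m y (X m)) -> x = y.
Proof.
move=> H; apply/eqP; rewrite -subr_eq0; apply/eqP.
apply: (ca_nondeg HC) => z; have [X <-] := framed_extend z courant_framed.
have := pair_linearl (ca_form C) (-1) y x (X m).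
by rewrite !scaleN1r addrC => ->; rewrite H addNr.
Qed.

Lemma pf_nondeg X Y : (forall Z, <[X, Z]> = <[Y, Z]>) -> X = Y.
Proof.
move=> H; apply: section_eq => m; apply: form_nondeg => Z.
exact: (congr1 (fun f : smooth_fun M => f m) (H Z)).
Qed.

(** In a local frame e, the coordinates of the section solve a linear system
    whose matrix is the Gram matrix G of e. As the form is
    nondegenerate, det G does not vanish at m0, and the adjugate matrix
    divided by det G gives a smooth solution nearby. *)
Lemma coanchor_exists xi : exists s, @is_coanchor _ _ _ C xi s.
Proof.
have [| |m0|s sP] := @patch_section _ _ _ C (fun m x => forall X : section C,
  ca_form C m x (X m) = 2^-1 * xi m (an X m)).
- by have [] := courant_framed.
- move=> m x y Hx Hy; apply: form_nondeg => X; by rewrite Hx Hy.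
- have [_ /(_ m0)[V [I [e0 [th0 [Vm lf]]]]]] := courant_framed.
  have [oV lin sm span dual] := lf.
  pose r := #|I|; pose e (k : 'I_r) := e0 (enum_val k).
  pose th (k : 'I_r) := th0 (enum_val k).
  have spanr m (x : C m) : V m -> x = \sum_k th k m x *: e k m.
    move=> Vx; rewrite {1}(span m x Vx).
    exact: (reindex _ (onW_bij _ (@enum_val_bij I))).
  have dualr j k m : V m -> th j m (e k m) = (j == k)%:R.
    by move=> Vx; rewrite /th /e dual// (inj_eq enum_val_inj).
  pose G : 'M[smooth_fun M]_r := \matrix_(j, k) <[e j, e k]>.
  pose b : 'rV[smooth_fun M]_r := \row_k (half * contract xi (an (e k))).
  have pfsum m (l : seq 'I_r) (a : 'I_r -> R) (y : C m) :
      ca_form C m (\sum_(j <- l) a j *: e j m) y =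
      \sum_(j <- l) a j * ca_form C m (e j m) y.
    elim: l => [|j l IH].
      rewrite !big_nil; have := pair_linearl (ca_form C) 1 0 0 y.
      rewrite scaler0 addr0 scale1r => /eq_double0 //.
    by rewrite !big_cons pair_linearl IH.
  have det0 : \det G m0 != 0.
    rewrite -[\det G m0]/(smf_eval m0 (\det G)) -det_map_mx -unitfE.
    rewrite -[_ \is a _]/(map_mx (smf_eval m0) G \in unitmx) -row_free_unit.
    apply: inj_row_free => c c0.
    have z0 : \sum_j c 0 j *: e j m0 = 0 :> C m0.
      apply: form_nondeg => X; rewrite pfsum.
      have := pair_linearl (ca_form C) 1 0 0 (X m0).
      rewrite scaler0 addr0 scale1r => /eq_double0 ->.
      have E k : \sum_j c 0 j * ca_form C m0 (e j m0) (e k m0) = 0.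
        transitivity ((c *m map_mx (smf_eval m0) G) 0 k); last by rewrite c0 mxE.
        by rewrite mxE; apply: eq_bigr => j _; rewrite !mxE.
      have Es (l : seq 'I_r) (a : 'I_r -> R) :
          \sum_j c 0 j * ca_form C m0 (e j m0) (\sum_(k <- l) a k *: e k m0) = 0.
        elim: l => [|k l IH].
          rewrite big1// => j _; rewrite big_nil.
          have := pair_linearr (ca_form C) 1 (e j m0) 0 0.
          by rewrite scaler0 addr0 scale1r => /eq_double0 ->; rewrite mulr0.
        under eq_bigr do rewrite big_cons pair_linearr mulrDr.
        rewrite big_split /= IH addr0.
        transitivity (a k * \sum_j c 0 j * ca_form C m0 (e j m0) (e k m0)).
          by rewrite mulr_sumr; apply: eq_bigr => j _; rewrite mulrCA.
        by rewrite E mulr0.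
      by rewrite (spanr m0 (X m0) Vm) Es.
    apply/rowP => k; rewrite mxE.
    have := congr1 (th0 (enum_val k) m0) z0.
    rewrite (@frame_th_sum _ _ _ _ _ _ _ _ _ _ _ _ _ _ lf) (bigD1 k)//= big1 ?addr0.
      rewrite -/(th k m0 (e k m0)) dualr// eqxx mulr1 => ->.
      by rewrite -(scale0r 0) (@frame_thZ _ _ _ _ _ _ _ _ _ _ _ _ lf) mul0r.
    move=> j jk; rewrite -/(th k m0 (e j m0)) dualr//.
    by rewrite eq_sym (negbTE jk) mulr0.
  have [W [g [oW Wm gP]]] := inverse_near det0.
  pose c : 'rV[smooth_fun M]_r := b *m \adj G.
  exists (V `&` W), (\sum_j (g * c 0 j) *: e j); split => //; first exact: openI.
  move=> m [Vx Wx] X.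
  have key k : <[\sum_j (g * c 0 j) *: e j, e k]> m = b 0 k m.
    have -> : <[\sum_j (g * c 0 j) *: e j, e k]> = g * (c *m G) 0 k.
      rewrite mxE mulr_sumr; elim: (index_enum _) => [|j l IH].
        by rewrite !big_nil pf0l.
      have GE : G j k = <[e j, e k]> by rewrite mxE.
      by rewrite !big_cons pfDl IH pfZl GE mulrA.
    rewrite /c -mulmxA mul_adj_mx mul_mx_scalar mxE !smfM mulrA.
    by rewrite mulrC [g m * _]mulrC gP// mulr1.
  pose a k := th k m (X m).
  have tX : X m = (\sum_k cstS M (a k) *: e k) m.
    by rewrite {1}(spanr m (X m) Vx) sec_sum.
  have -> : xi m (an X m) = xi m (an (\sum_k cstS M (a k) *: e k) m).
    apply: (@tensorial _ _ _ C R^o m (fun X => xi m (an X m)) _ _ courant_framed) => //.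
    by move=> f s t; rewrite linearP secD secZ cotangentP.
  move: key; set S := \sum_j _ => key.
  rewrite tX.
  elim: (index_enum _) => [|k l IH].
    rewrite !big_nil linear0.
    have P0 : ca_form C m (S m) ((0 : section C) m) = 0 :=
      congr1 (fun f : smooth_fun M => f m) (pf0r S).
    have X0 : xi m ((0 : vector_field M) m) = 0 :=
      congr1 (fun f : smooth_fun M => f m) (contract0 xi).
    by rewrite X0 mulr0.
  rewrite !big_cons linearP secD secZ pair_linearr IH cotangentP mulrDr.
  have := key k; rewrite mxE smfM => K.
  congr (_ + _); rewrite [RHS]mulrCA; congr (_ * _); exact: K.
- by exists s => X m; exact: sP.
Qed.

Lemma coanchorP xi : @is_coanchor _ _ _ C xi (coanchor C xi).
Proof.
rewrite /coanchor; case: xgetP => [_ -> //|].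
by have [s /[swap] /[apply]] := coanchor_exists xi.
Qed.

Local Notation coa := (coanchor C).

Lemma coaE xi X : <[coa xi, X]> = half * contract xi (an X).
Proof. by apply: smooth_fun_eq => m; exact: coanchorP. Qed.

Lemma coaD xi eta : coa (xi + eta) = coa xi + coa eta.
Proof. by apply: pf_nondeg => X; rewrite !(coaE, pfE, contractDl); ring. Qed.

Lemma coaZ f xi : coa (f *: xi) = f *: coa xi.
Proof. by apply: pf_nondeg => X; rewrite !(coaE, pfE, contractZl); ring. Qed.


Lemma coa0 : coa 0 = 0.
Proof. by apply: pf_nondeg => X; rewrite !(coaE, pfE, contract0l); ring. Qed.

Lemma an_coa xi : an (coa xi) = 0. Proof. exact: ca_anchor_coanchor. Qed.

Lemma brDl X Y Z : br (X + Y) Z = br X Z + br Y Z.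
Proof. exact: (leibniz_addl (ca_leibniz HC)). Qed.
Lemma brDr X Y Z : br Z (X + Y) = br Z X + br Z Y.
Proof. exact: (leibniz_addr (ca_leibniz HC)). Qed.
Lemma br0l Z : br 0 Z = 0.
Proof.
have := brDl 0 0 Z; rewrite addr0 => /eq_double0 //.
Qed.
Lemma br0r Z : br Z 0 = 0.
Proof.
have := brDr 0 0 Z; rewrite addr0 => /eq_double0 //.
Qed.
Lemma brNr X Z : br Z (- X) = - br Z X.
Proof. by apply/eqP; rewrite -addr_eq0 -brDr addNr br0r. Qed.

Lemma br_inv X Y Z : vf_app (an X) <[Y, Z]> = <[br X Y, Z]> + <[Y, br X Z]>.
Proof. exact: (ca_invariant HC). Qed.

Lemma an_br X Y : an (br X Y) = lie_bracket (an X) (an Y).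
Proof. exact: (ca_anchor_bracket HC). Qed.

Lemma br_jacobi X Y Z : br X (br Y Z) = br (br X Y) Z + br Y (br X Z).
Proof. exact: (leibniz_jacobi (ca_leibniz HC)). Qed.

Lemma diffD f g : diff (f + g) = diff f + diff g :> oneform M.
Proof. by apply: oneform_eq => V; rewrite contractDl !contract_diff vf_appD. Qed.

(** Polarization of the axiom for [X, X]. *)
Lemma br_sym X Y : br X Y + br Y X = coa (diff <[X, Y]>) + coa (diff <[X, Y]>).
Proof.
have := ca_square HC (X + Y).
rewrite brDl !brDr !pfE (pfC Y X) !diffD !coaD -!(ca_square HC).
set a := br X X; set b := br Y Y => H.
by apply: (addrI a); apply: (addIr b); rewrite !addrA in H *.
Qed.

(** Invariance of the form, tested against every Z. *)
Lemma br_Zr X f Y : br X (f *: Y) = f *: br X Y + vf_app (an X) f *: Y.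
Proof.
apply: pf_nondeg => Z; rewrite !pfE.
have H1 := br_inv X (f *: Y) Z; have H2 := br_inv X Y Z.
rewrite !pfE vf_appM H2 in H1.
apply: (addIr (f * <[Y, br X Z]>)); rewrite -H1; ring.
Qed.

End CourantAlgebra.

(** * Coordinates of a jet section *)

Section JetForm.
Context {R : realType} {n : nat} {M : manifold R n} {E : bundle M}.
Hypothesis fE : framed E.
Implicit Types (f : smooth_fun M) (V : vector_field M) (mu nu : section (jet_bundle E)).

Definition jet_form mu : {linear vector_field M -> section E} :=
  sval (cid (jet_decomposition fE mu)).

Lemma jet_formP mu m (d : gauge E) :
  mu m d = d (jet_base mu) m + jet_form mu (symbol d) m.
Proof. exact: (svalP (cid (jet_decomposition fE mu))). Qed.

Lemma linear_tensorial (w : {linear vector_field M -> section E}) m V V' :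
  V m = V' m -> w V m = w V' m.
Proof.
apply: (@tensorial _ _ _ (tangent_bundle M) (E m) m (fun V => w V m)).
  exact: tangent_framed.
by move=> f s t; rewrite linearP.
Qed.

(** To compute w V it is enough to look at derivations with the symbol V at
    the given point. *)
Lemma jet_formE mu V (s : section E) :
  (forall m (d : gauge E), symbol d m = V m -> mu m d = d (jet_base mu) m + s m) ->
  jet_form mu V = s.
Proof.
move=> H; apply: section_eq => m; have [d dV] := gauge_exists fE V m.
apply: (addrI (d (jet_base mu) m)); rewrite -(H m d dV) jet_formP.
by congr (_ + _); apply: linear_tensorial.
Qed.

Lemma jet_eq mu nu : jet_base mu = jet_base nu ->
  (forall V, jet_form mu V = jet_form nu V) -> mu = nu.
Proof.
by move=> B F; apply: jet_section_eq => m d; rewrite !jet_formP B F.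
Qed.

Lemma jet_baseD mu nu : jet_base (mu + nu) = jet_base mu + jet_base nu.
Proof. exact: section_eq. Qed.
Lemma jet_baseZ f mu : jet_base (f *: mu) = f *: jet_base mu.
Proof. exact: section_eq. Qed.
Lemma jet_baseN mu : jet_base (- mu) = - jet_base mu.
Proof. exact: section_eq. Qed.
Lemma jet_base0 : jet_base (0 : section (jet_bundle E)) = 0.
Proof. exact: section_eq. Qed.

Lemma jet_formD mu nu V : jet_form (mu + nu) V = jet_form mu V + jet_form nu V.
Proof.
apply: jet_formE => m d dV.
have -> : (mu + nu) m d = mu m d + nu m d by [].
rewrite jet_baseD gaugeD !secD !jet_formP addrACA.
by rewrite (linear_tensorial (jet_form mu) dV) (linear_tensorial (jet_form nu) dV).
Qed.

(** The Spencer decomposition is not C^oo(M)-linear: f d X = d (f X) - df (x) X. *)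
Lemma jet_formZ f mu V :
  jet_form (f *: mu) V = f *: jet_form mu V - vf_app V f *: jet_base mu.
Proof.
apply: jet_formE => m d dV.
have -> : (f *: mu) m d = f m *: mu m d by [].
rewrite secB !secZ -(linear_tensorial (jet_form mu) dV).
have -> : vf_app V f m = vf_app (symbol d) f m.
  by rewrite -[LHS]/(V m f) -dV.
rewrite jet_formP jet_baseZ gaugeL secD !secZ scalerDr.
by rewrite -addrA; congr (_ + _); rewrite addrC subrK.
Qed.

Lemma jet_form0 V : jet_form 0 V = 0.
Proof.
have := jet_formD 0 0 V; rewrite addr0 => /eq_double0 //.
Qed.

Lemma jet_formN mu V : jet_form (- mu) V = - jet_form mu V.
Proof. by apply/eqP; rewrite -addr_eq0 -jet_formD addNr jet_form0. Qed.

Lemma jet_base_prolong s : jet_base (prolong s : section (jet_bundle E)) = s.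
Proof. exact: section_eq. Qed.

Lemma jet_form_prolong s V : jet_form (prolong s) V = 0.
Proof. by apply: jet_formE => m d dV; rewrite jet_base_prolong sec0 addr0. Qed.

Lemma jet_base_tens xi s : jet_base (tens xi s : section (jet_bundle E)) = 0.
Proof.
apply: section_eq => m.
rewrite -[LHS]/(xi m ((0 : vector_field M) m) *: s m).
have -> : xi m ((0 : vector_field M) m) = 0 :=
  congr1 (fun f : smooth_fun M => f m) (contract0 xi).
exact: scale0r.
Qed.

Lemma gauge0 (d : gauge E) : d 0 = 0.
Proof.
have := gaugeD d 0 0; rewrite addr0 => /eq_double0 //.
Qed.

Lemma jet_form_tens xi s V : jet_form (tens xi s) V = contract xi V *: s.
Proof.
apply: jet_formE => m d dV; rewrite jet_base_tens gauge0 sec0 add0r secZ.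
by rewrite -[LHS]/(xi m (symbol d m) *: s m) dV.
Qed.

Lemma jet_base_mkjet s (w : {linear vector_field M -> section E}) :
  jet_base (mkjet s w) = s.
Proof.
apply: section_eq => m; rewrite -[LHS]/(s m + w 0 m).
by rewrite linear0 sec0 addr0.
Qed.

Lemma jet_form_mkjet s (w : {linear vector_field M -> section E}) V :
  jet_form (mkjet s w) V = w V.
Proof.
apply: jet_formE => m d dV; rewrite jet_base_mkjet -(linear_tensorial w dV).
by [].
Qed.

Definition linear_of (F : vector_field M -> section E) (lF : linear F) :
    {linear vector_field M -> section E} :=
  HB.pack F (GRing.isLinear.Build _ _ _ _ F lF).

End JetForm.

(** By tensoriality in each argument. *)
Lemma pairing_of (R : realType) (n : nat) (M : manifold R n) (K E : bundle M)
    (P : section K -> section K -> section E) : framed K ->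
  (forall f s t u, P (f *: s + t) u = f *: P s u + P t u) ->
  (forall f s t u, P u (f *: s + t) = f *: P u s + P u t) ->
  exists p : pairing K E, forall s t, pair_sec p s t = P s t.
Proof.
move=> fK Pl Pr.
have [ext extE] := choice (fun mx : {m : M & K m} => framed_extend (projT2 mx) fK).
pose p0 m (x y : K m) : E m := P (ext (existT _ m x)) (ext (existT _ m y)) m.
have p0E m (s t : section K) : p0 m (s m) (t m) = P s t m.
  rewrite /p0.
  transitivity (P s (ext (existT _ m (t m))) m).
    apply: (@tensorial _ _ _ K (E m) m (fun s => P s _ m) _ _ fK).
      by move=> f u v; rewrite Pl.
    exact: (extE (existT _ m (s m))).
  apply: (@tensorial _ _ _ K (E m) m (fun t => P s t m) _ _ fK).
    by move=> f u v; rewrite Pr.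
  exact: (extE (existT _ m (t m))).
have pl m a x x' y : p0 m (a *: x + x') y = a *: p0 m x y + p0 m x' y.
  have [s <-] := framed_extend x fK; have [s' <-] := framed_extend x' fK.
  have [t <-] := framed_extend y fK.
  rewrite -[a *: s m + s' m]/((cstS M a *: s + s') m) !p0E Pl.
  by [].
have pr m a x y y' : p0 m x (a *: y + y') = a *: p0 m x y + p0 m x y'.
  have [s <-] := framed_extend x fK; have [t <-] := framed_extend y fK.
  have [t' <-] := framed_extend y' fK.
  rewrite -[a *: t m + t' m]/((cstS M a *: t + t') m) !p0E Pr.
  by [].
have ps (s t : section K) : smooth_section E (fun m => p0 m (s m) (t m)).
  have -> : (fun m => p0 m (s m) (t m)) = P s t.
    by apply: functional_extensionality_dep => m; exact: p0E.
  exact: sectionP.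
by exists (Pairing pl pr ps) => s t; apply: section_eq => m; exact: p0E.
Qed.

(** * Pairing, anchor and bracket on the jets of C *)

Section JetCourantAlgebra.
Context {R : realType} {n : nat} {M : manifold R n}.
Variable C : courant_data M.
Hypothesis HC : is_courant C.
Local Notation JC := (jet_bundle C).
Implicit Types (f g : smooth_fun M) (X Y Z : section C) (U V : vector_field M).
Implicit Types (xi eta : oneform M) (mu nu kap : section JC).

Local Notation an := (ca_anchor C).
Local Notation "<[ X , Y ]>" := (pair_fun (ca_form C) X Y).
Local Notation br := (ca_bracket C).
Local Notation coa := (coanchor C).
Let fC : framed C := courant_framed HC.
(* [b mu] and [w mu] are the Spencer components of mu. *)
Local Notation b := jet_base.
Local Notation w := (jet_form fC).

(** Twice the coanchor, so that <sharp xi, X> = xi (a X) without a factor 1/2.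
    It is locked because a sum would be split by the expansion of the form. *)
Definition sharp xi : section C := locked (coa xi + coa xi).
Lemma sharpE xi : sharp xi = coa xi + coa xi.
Proof. by rewrite /sharp -lock. Qed.

Lemma pf_sharpl xi X : <[sharp xi, X]> = contract xi (an X).
Proof. by rewrite sharpE pfDl !(coaE HC) half2. Qed.
Lemma pf_sharpr xi X : <[X, sharp xi]> = contract xi (an X).
Proof. by rewrite (pfC HC) pf_sharpl. Qed.
Lemma an_sharp xi : an (sharp xi) = 0.
Proof. by rewrite sharpE linearD !(an_coa HC) addr0. Qed.
Lemma br_sharp X Y : br X Y + br Y X = sharp (diff <[X, Y]>).
Proof. by rewrite sharpE; exact: br_sym. Qed.
Lemma sharpD xi eta : sharp (xi + eta) = sharp xi + sharp eta.
Proof. by rewrite !sharpE (coaD HC) addrACA. Qed.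


Lemma jpair_exists mu nu : exists xi : oneform M, forall V, contract xi V =
  vf_app V <[b mu, b nu]> + <[b mu, w nu V]> + <[w mu V, b nu]>.
Proof.
apply: oneform_of => f V V'.
rewrite !linearP !(pfE HC, vf_appDl, vf_appZl); ring.
Qed.
Definition jpair mu nu : oneform M := sval (cid (jpair_exists mu nu)).
Lemma jpairE mu nu V : contract (jpair mu nu) V =
  vf_app V <[b mu, b nu]> + <[b mu, w nu V]> + <[w mu V, b nu]>.
Proof. exact: (svalP (cid (jpair_exists mu nu))). Qed.

Lemma jpairC mu nu : jpair mu nu = jpair nu mu.
Proof.
apply: oneform_eq => V; rewrite !jpairE (pfC HC (b nu)) (pfC HC (b nu) (w mu V)).
by rewrite (pfC HC (w nu V)) addrAC.
Qed.

Lemma jpair_linl f mu mu' nu : jpair (f *: mu + mu') nu = f *: jpair mu nu + jpair mu' nu.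
Proof.
apply: oneform_eq => V; rewrite contractDl contractZl !jpairE.
rewrite jet_baseD jet_baseZ jet_formD jet_formZ !(pfE HC, vf_appD, vf_appM); ring.
Qed.

Lemma jpair_linr f mu mu' nu : jpair nu (f *: mu + mu') = f *: jpair nu mu + jpair nu mu'.
Proof. by rewrite !(jpairC nu) jpair_linl. Qed.

Lemma anchor_op_exists mu xi : exists eta : oneform M, forall V, contract eta V =
  vf_app (an (b mu)) (contract xi V) - contract xi (lie_bracket (an (b mu)) V) +
  contract xi (an (w mu V)).
Proof.
apply: oneform_of => f V V'.
rewrite lieDr lieZr !linearP !(contractD, contractZ, vf_appD, vf_appM); ring.
Qed.
(** The Lie derivative along a X, plus the transpose of a o w. *)
Definition anchor_op mu xi : oneform M := sval (cid (anchor_op_exists mu xi)).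
Lemma rhoE mu xi V : contract (anchor_op mu xi) V =
  vf_app (an (b mu)) (contract xi V) - contract xi (lie_bracket (an (b mu)) V) +
  contract xi (an (w mu V)).
Proof. exact: (svalP (cid (anchor_op_exists mu xi))). Qed.

Lemma rho_gauge mu : is_gauge (anchor_op mu, an (b mu)).
Proof.
split=> [xi eta|c xi|f xi] /=; apply: oneform_eq => V.
- by rewrite contractDl !rhoE !contractDl vf_appD; ring.
- by rewrite contractZl !rhoE !contractZl vf_appZ; ring.
- by rewrite contractDl !contractZl !rhoE !contractZl vf_appM; ring.
Qed.

Definition anchor_gauge mu : gauge (cotangent_bundle M) := mk_gauge (rho_gauge mu).

Lemma lieZl U f V : lie_bracket (f *: U) V = f *: lie_bracket U V - vf_app V f *: U.
Proof.
by apply: vf_eq => g; rewrite !(lie_app, vf_appDl, vf_appNl, vf_appZl, vf_appM); ring.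
Qed.
Lemma lieDl U U' V : lie_bracket (U + U') V = lie_bracket U V + lie_bracket U' V.
Proof.
by apply: vf_eq => g; rewrite !(lie_app, vf_appDl, vf_appD); ring.
Qed.

Lemma rho_linear : linear anchor_gauge.
Proof.
move=> f mu nu; apply: gauge_eq => [xi|].
  apply: oneform_eq => V; rewrite gaugeDE gaugeZE contractDl contractZl.
  rewrite -![contract (anchor_gauge _ _) _]/(contract (anchor_op _ _) _) !rhoE.
  rewrite jet_baseD jet_baseZ jet_formD jet_formZ.
  rewrite !(linearD, linearN, linearZ) /= lieDl lieZl.
  rewrite !(vf_appDl, vf_appZl, contractD, contractN, contractZ).
  ring.
by rewrite /= /symbol /= jet_baseD jet_baseZ linearP.
Qed.

Definition rho : {linear section JC -> gauge (cotangent_bundle M)} :=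
  HB.pack anchor_gauge (GRing.isLinear.Build _ _ _ _ anchor_gauge rho_linear).

Lemma rho_symbol mu : symbol (rho mu) = an (b mu). Proof. by []. Qed.

Lemma iota_d_exists V xi : exists eta : oneform M, forall U, contract eta U =
  vf_app V (contract xi U) - vf_app U (contract xi V) - contract xi (lie_bracket V U).
Proof.
apply: oneform_of => f U U'.
rewrite lieDr lieZr !(contractD, contractZ, vf_appD, vf_appM, vf_appDl, vf_appZl).
ring.
Qed.
(** The contraction of the exterior derivative of xi with V. *)
Definition iota_d V xi : oneform M := sval (cid (iota_d_exists V xi)).
Lemma iota_dE V xi U : contract (iota_d V xi) U =
  vf_app V (contract xi U) - vf_app U (contract xi V) - contract xi (lie_bracket V U).
Proof. exact: (svalP (cid (iota_d_exists V xi))). Qed.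

Lemma iota_d_lin xi f V V' : iota_d (f *: V + V') xi = f *: iota_d V xi + iota_d V' xi.
Proof.
apply: oneform_eq => U; rewrite contractDl contractZl !iota_dE lieDl lieZl.
rewrite !(contractD, contractN, contractZ, vf_appD, vf_appM, vf_appDl, vf_appZl).
ring.
Qed.

Lemma iota_dD V xi eta : iota_d V (xi + eta) = iota_d V xi + iota_d V eta.
Proof.
by apply: oneform_eq => U; rewrite contractDl !iota_dE !contractDl !vf_appD; ring.
Qed.

Lemma iota_d_diff V f : iota_d V (diff f) = 0.
Proof.
by apply: oneform_eq => U; rewrite iota_dE !contract_diff lie_app contract0l; ring.
Qed.

Lemma rho_star_d_linear xi : linear (fun V => - coa (iota_d V xi)).
Proof. by move=> f V V'; rewrite iota_d_lin (coaD HC) (coaZ HC) opprD scalerN. Qed.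
(** The element rho^*(d xi) of the jet bundle of C, in Spencer components; it is
    characterized by [jpair_rho_star_d]. *)
Definition rho_star_d xi : section JC := mkjet (coa xi) (linear_of (rho_star_d_linear xi)).
Lemma rho_star_d_base xi : b (rho_star_d xi) = coa xi. Proof. exact: jet_base_mkjet. Qed.
Lemma rho_star_d_form xi V : w (rho_star_d xi) V = - coa (iota_d V xi).
Proof. exact: jet_form_mkjet. Qed.

Lemma rho_star_dD xi eta : rho_star_d (xi + eta) = rho_star_d xi + rho_star_d eta.
Proof.
apply: (@jet_eq _ _ _ _ fC) => [|V]; first by rewrite jet_baseD !rho_star_d_base (coaD HC).
by rewrite jet_formD !rho_star_d_form iota_dD (coaD HC) opprD.
Qed.

Lemma rho_star_d_diff f : rho_star_d (diff f) = prolong (coa (diff f)).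
Proof.
apply: (@jet_eq _ _ _ _ fC) => [|V]; first by rewrite rho_star_d_base jet_base_prolong.
by rewrite rho_star_d_form jet_form_prolong iota_d_diff (coa0 HC) oppr0.
Qed.

Lemma jpair_rho_star_d xi kap : jpair (rho_star_d xi) kap = half *: rho kap xi.
Proof.
apply: oneform_eq => V; rewrite contractZl -[rho kap xi]/(anchor_op kap xi) rhoE jpairE.
rewrite rho_star_d_base rho_star_d_form pfNl !(coaE HC) iota_dE (lie_anti V) contractN.
rewrite [vf_app V (half * _)]vf_appZ -/half; ring.
Qed.

Lemma form_pair_exists mu Y : exists xi : oneform M, forall V, contract xi V = <[w mu V, Y]>.
Proof. by apply: oneform_of => f V V'; rewrite linearP !(pfE HC). Qed.
Definition form_pair mu Y : oneform M := sval (cid (form_pair_exists mu Y)).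
Lemma form_pairE mu Y V : contract (form_pair mu Y) V = <[w mu V, Y]>.
Proof. exact: (svalP (cid (form_pair_exists mu Y))). Qed.

Definition jbracket_form mu nu V : section C :=
  br (b mu) (w nu V) - w nu (lie_bracket (an (b mu)) V)
  - (br (b nu) (w mu V) - w mu (lie_bracket (an (b nu)) V))
  + (w nu (an (w mu V)) - w mu (an (w nu V)))
  - sharp (iota_d V (form_pair mu (b nu))).

Lemma jbracket_linear mu nu : linear (jbracket_form mu nu).
Proof.
move=> f V V'; rewrite /jbracket_form !linearP !lieDr !lieZr !(linearD, linearZ) /=.
rewrite iota_d_lin !(brDr HC) !(br_Zr HC).
apply: (pf_nondeg HC) => Z; rewrite !(pf_sharpl, pfE HC, contractDl, contractZl).
ring.
Qed.

Definition jbracket mu nu : section JC :=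
  mkjet (br (b mu) (b nu) + sharp (form_pair mu (b nu))) (linear_of (jbracket_linear mu nu)).

Lemma jbracket_base mu nu : b (jbracket mu nu) = br (b mu) (b nu) + sharp (form_pair mu (b nu)).
Proof. exact: jet_base_mkjet. Qed.
Lemma jbracket_formE mu nu V : w (jbracket mu nu) V = jbracket_form mu nu V.
Proof. exact: jet_form_mkjet. Qed.

(** The terms of the bracket in [a X, V] and in the composites of w with a are
    antisymmetric and cancel. There remain the symmetric part of the bracket of
    C and the terms in <w, Y>. *)
Lemma jbracket_sym mu nu : jbracket mu nu + jbracket nu mu =
  rho_star_d (jpair mu nu) + rho_star_d (jpair mu nu).
Proof.
have E : jpair mu nu = diff <[b mu, b nu]> + (form_pair nu (b mu) + form_pair mu (b nu)).
  apply: oneform_eq => V; rewrite jpairE !contractDl contract_diff !form_pairE.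
  by rewrite (pfC HC (b mu) (w nu V)) addrA.
apply: (@jet_eq _ _ _ _ fC) => [|V].
  rewrite !jet_baseD !jbracket_base rho_star_d_base -sharpE E !sharpD -br_sharp.
  by rewrite addrACA; congr (_ + _); exact: addrC.
rewrite !jet_formD !jbracket_formE !rho_star_d_form E !iota_dD iota_d_diff add0r.
rewrite /jbracket_form; apply: (pf_nondeg HC) => Z.
rewrite !(pf_sharpl, pfE HC, coaE HC, contractDl) -[RHS]opprD half2; ring.
Qed.

(** Both components of rho^* d xi take values in the image of a^*, and
    a a^* = 0. *)
Lemma rho_rho_star_d xi : rho (rho_star_d xi) = 0.
Proof.
have a0 : an (b (rho_star_d xi)) = 0 by rewrite rho_star_d_base (an_coa HC).
apply: gauge_eq => [eta|]; last by rewrite rho_symbol a0.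
apply: oneform_eq => V; rewrite -[rho _ _]/(anchor_op _ _) rhoE a0 rho_star_d_form.
rewrite linearN (an_coa HC) oppr0 contract0 addr0 vf_app0l.
have -> : lie_bracket 0 V = 0.
  by apply: vf_eq => g; rewrite lie_app !vf_app0l vf_app0 subrr.
by rewrite contract0 subrr contract0l.
Qed.

Lemma rho_bracket mu nu : rho (jbracket mu nu) = gauge_bracket (rho mu) (rho nu).
Proof.
have aE : an (b (jbracket mu nu)) = lie_bracket (an (b mu)) (an (b nu)).
  by rewrite jbracket_base linearD an_sharp addr0 (an_br HC).
apply: gauge_eq => [xi|]; last by rewrite rho_symbol aE.
apply: oneform_eq => V; rewrite -[rho _ _]/(anchor_op _ _) rhoE aE jbracket_formE.
rewrite -[gauge_bracket _ _ _]/(anchor_op mu (anchor_op nu xi) -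
  anchor_op nu (anchor_op mu xi)).
rewrite contractDl contractNl !rhoE lie_jacobi /jbracket_form.
rewrite !(linearB, linearD, linearN) /= !an_sharp !(an_br HC).
rewrite !(vf_appD, vf_appN, contractD, contractN, contract0, lie_app).
ring.
Qed.

(** Apart from the invariance of the form on C, the computation uses
    a(w V)<Y, Z> = <w V, [Y, Z] + [Z, Y]>, the symmetric part of the bracket. *)
Lemma jpair_invariant mu nu kap :
  rho mu (jpair nu kap) = jpair (jbracket mu nu) kap + jpair nu (jbracket mu kap).
Proof.
apply: oneform_eq => V; rewrite -[rho _ _]/(anchor_op _ _) rhoE contractDl !jpairE.
rewrite !jbracket_base !jbracket_formE /jbracket_form.
set X := b mu; set Y := b nu; set Z := b kap.
(* This derivative is expanded by the symmetric part of the bracket of C, all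
   other derivatives along the anchor by the invariance of the form. *)
have H1 : vf_app (an (w mu V)) <[Y, Z]> = <[w mu V, br Z Y]> + <[w mu V, br Y Z]>.
  by rewrite -pfDr// br_sharp pf_sharpr contract_diff (pfC HC Z).
have H2 : vf_app (an Z) <[w mu V, Y]> = <[Y, br Z (w mu V)]> + <[w mu V, br Z Y]>.
  by rewrite (br_inv HC) (pfC HC Y).
rewrite H1 !(pf_sharpl, pf_sharpr, pfE HC, iota_dE, form_pairE) H2.
rewrite !(lie_anti V) !(linearN, pfE HC) !(pfC HC Y (w mu _)).
rewrite !(vf_appD, lie_app) !(br_inv HC) !(vf_appD); ring.
Qed.

End JetCourantAlgebra.

Section RecordEqualities.
Context {R : realType} {n : nat} {M : manifold R n}.

Lemma pairing_eq (K E : bundle M) (p q : pairing K E) :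
  (forall m x y, p m x y = q m x y) -> p = q.
Proof.
case: p q => p pl pr ps [q ql qr qs] /= pq.
have E1 : p = q.
  apply: functional_extensionality_dep => m.
  by apply/funext => x; apply/funext => y; exact: pq.
by subst q; congr Pairing; exact: Prop_irrelevance.
Qed.

Lemma linear_eq (A : pzRingType) (U V : lmodType A) (f g : {linear U -> V}) :
  f =1 g -> f = g.
Proof.
case: f g => f [[f1] [f2]] [g [[g1] [g2]]] /= /funext fg.
subst g; congr GRing.Linear.Pack.
by rewrite (Prop_irrelevance f1 g1) (Prop_irrelevance f2 g2).
Qed.

End RecordEqualities.

(** * Nondegeneracy, Jacobi identity and uniqueness *)

Section JetCourant.
Context {R : realType} {n : nat} {M : manifold R n}.
Hypothesis n_gt0 : (0 < n)%N.
Variable C : courant_data M.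
Hypothesis HC : is_courant C.
Local Notation JC := (jet_bundle C).
Implicit Types (f g : smooth_fun M) (X Y Z : section C) (U V : vector_field M).
Implicit Types (xi eta : oneform M) (mu nu kap : section JC).

Local Notation an := (ca_anchor C).
Local Notation "<[ X , Y ]>" := (pair_fun (ca_form C) X Y).
Local Notation br := (ca_bracket C).
Local Notation coa := (coanchor C).
Let fC : framed C := courant_framed HC.
Let fJ : framed JC := jet_framed fC.
Local Notation b := jet_base.
Local Notation w := (jet_form fC).
Local Notation jpair := (jpair HC).
Local Notation rho := (rho HC).
Local Notation rho_star_d := (rho_star_d HC).
Local Notation jbracket := (jbracket HC).
Local Notation sharp := (@sharp _ _ _ C).

(** This is where the positive dimension of M enters. *)
Lemma unit_coordinate (m : M) : exists f V, vf_app V f m = 1.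
Proof.
have [V [x [D [_ Vm _ dual]]]] := local_coordinates m.
pose i := Ordinal n_gt0.
by exists (x i), (D i); rewrite -[LHS]/(D i m (x i)) dual// eqxx.
Qed.

(** Pairing with df (x) Z, for f with df nonzero at m, gives X m = 0. Pairing
    with d Z then gives the vanishing of d X + w V at m, since
    V<X, Z> - <d X, Z> is C^oo(M)-linear in X, for d of symbol V. *)
Lemma jpair_nondeg0 mu m : (forall nu V, contract (jpair mu nu) V m = 0) -> mu m = 0.
Proof.
move=> H.
have bm : b mu m = 0.
  apply: (form_nondeg HC) => Z; have [f [V Vf]] := unit_coordinate m.
  have := H (tens (diff f) Z) V.
  rewrite jpairE jet_base_tens jet_form_tens (pf0r HC) vf_app0 add0r (pf0r HC) addr0.
  rewrite (pfZr HC) contract_diff smfM Vf mul1r => K.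
  transitivity (<[b mu, Z]> m) => //; rewrite K.
  exact: (esym (congr1 (fun f : smooth_fun M => f m) (pf0l Z))).
apply/val_inj/funext => d; rewrite -[LHS]/(mu m d) -[RHS]/(0 : C m).
rewrite (jet_formP fC); apply: (form_nondeg HC) => Z.
pose V := symbol d.
pose G X := vf_app V <[X, Z]> - <[d X, Z]>.
have Glin f s t : G (f *: s + t) = f * G s + G t.
  by rewrite /G gaugeD gaugeL !(pfE HC) vf_appD vf_appM -/V; ring.
have G0 : G (b mu) m = 0.
  apply: (@tensorial0 _ _ _ C R^o m (fun X => G X m) _ fC) => // f s t.
  by rewrite Glin.
have := H (prolong Z) V.
rewrite jpairE jet_base_prolong jet_form_prolong (pf0r HC) addr0.
have /eqP := G0; rewrite /G smfB subr_eq0 => /eqP.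
rewrite smfD => -> K.
transitivity (<[d (b mu) + w mu V, Z]> m); first by [].
rewrite pfDl smfD K.
exact: (esym (congr1 (fun f : smooth_fun M => f m) (pf0l Z))).
Qed.

Lemma jpair_nondeg mu nu : (forall kap, jpair mu kap = jpair nu kap) -> mu = nu.
Proof.
move=> H; apply/eqP; rewrite -subr_eq0; apply/eqP; apply: section_eq => m.
apply: jpair_nondeg0 => kap V.
have -> : mu - nu = (-1) *: nu + mu by rewrite scaleN1r addrC.
rewrite jpair_linl H contractDl contractZl mulN1r addNr.
by [].
Qed.

Lemma jpairDl mu mu' nu : jpair (mu + mu') nu = jpair mu nu + jpair mu' nu.
Proof. by have := jpair_linl HC 1 mu mu' nu; rewrite !scale1r. Qed.
Lemma jpair0l nu : jpair 0 nu = 0.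
Proof.
have := jpairDl 0 0 nu; rewrite addr0 => /eq_double0 //.
Qed.
Lemma jpairZl f mu nu : jpair (f *: mu) nu = f *: jpair mu nu.
Proof. by have := jpair_linl HC f mu 0 nu; rewrite jpair0l !addr0. Qed.

Lemma jpairNl mu nu : jpair (- mu) nu = - jpair mu nu.
Proof. by rewrite -scaleN1r jpairZl scaleN1r. Qed.

(** Linear identities between jets: pair with a jet, contract with a vector
    field, and normalize in the ring of smooth functions. *)
Ltac jring := apply: jpair_nondeg => ?; apply: oneform_eq => ?;
  rewrite !(mulr2n, scalerBr, scalerDr, scalerN, jpairDl, jpairNl, jpairZl,
    jpair0l, contractDl, contractNl, contractZl, contract0l);
  ring.

(** Leibniz' rule, from the invariance of the pairing and nondegeneracy. *)
Lemma jbracket_linr mu f nu nu' :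
  jbracket mu (f *: nu + nu') =
  f *: jbracket mu nu + vf_app (an (b mu)) f *: nu + jbracket mu nu'.
Proof.
apply: jpair_nondeg => kap; rewrite !(jpairDl, jpairZl).
apply: (addIr (jpair (f *: nu + nu') (jbracket mu kap))).
rewrite -(jpair_invariant HC) jpairDl jpairZl gaugeD gaugeL !(jpair_invariant HC) rho_symbol.
rewrite jpairDl jpairZl scalerDr.
set A := _ *: _; set B := _ *: _; set D := _ *: jpair nu _.
set E := jpair _ _; set F := jpair nu' _.
by rewrite -!addrA; congr (_ + _); rewrite addrCA; congr (_ + _); rewrite addrCA.
Qed.

Lemma jbracketDr mu nu nu' : jbracket mu (nu + nu') = jbracket mu nu + jbracket mu nu'.
Proof.
have := jbracket_linr mu 1 nu nu'.
have -> : (1 : smooth_fun M) = cstS M 1 by exact: smooth_fun_eq.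
rewrite vf_app_cst scale0r addr0.
have -> : cstS M 1 = 1 by exact: smooth_fun_eq.
by rewrite !scale1r.
Qed.

Lemma jbracket0r mu : jbracket mu 0 = 0.
Proof.
have := jbracketDr mu 0 0; rewrite addr0 => /eq_double0 //.
Qed.

Lemma jbracketZr mu f nu :
  jbracket mu (f *: nu) = f *: jbracket mu nu + vf_app (an (b mu)) f *: nu.
Proof. by have := jbracket_linr mu f nu 0; rewrite jbracket0r !addr0. Qed.


Lemma jbracket_swap mu nu : jbracket mu nu =
  rho_star_d (jpair mu nu) + rho_star_d (jpair mu nu) - jbracket nu mu.
Proof. by rewrite -jbracket_sym addrK. Qed.

Lemma jbracketDl mu mu' nu : jbracket (mu + mu') nu = jbracket mu nu + jbracket mu' nu.
Proof.
rewrite !(jbracket_swap _ nu) jbracketDr jpairDl !rho_star_dD opprD.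
jring.
Qed.


(** A jet xi (x) Z only sees the base component of the other argument. *)
Lemma jpair_tens xi Z kap : jpair (tens xi Z) kap = <[Z, b kap]> *: xi.
Proof.
apply: oneform_eq => V; rewrite jpairE contractZl jet_base_tens jet_form_tens.
by rewrite !pf0l vf_app0 !add0r pfZl mulrC.
Qed.

Lemma rho_star_d_scale f xi :
  rho_star_d (f *: xi) = f *: rho_star_d xi + tens xi (coa (diff f)).
Proof.
apply: jpair_nondeg => kap; rewrite jpairDl jpairZl jpair_tens !jpair_rho_star_d.
rewrite gaugeL rho_symbol.
by rewrite scalerDr !scalerA (coaE HC) contract_diff [f * _]mulrC.
Qed.

(** From Leibniz' rule on the right and [jbracket_sym], with
    rho^* d (f xi) = f rho^* d xi + xi (x) a^* df. *)
Lemma jbracketZl f mu nu : jbracket (f *: mu) nu = f *: jbracket mu nu -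
  vf_app (an (b nu)) f *: mu + tens (jpair mu nu) (coa (diff f)) *+ 2.
Proof.
rewrite !(jbracket_swap _ nu) jbracketZr jpairZl rho_star_d_scale mulr2n.
jring.
Qed.

(** By invariance both sides have the same pairing with kap: the commutator of
    rho(mu) and rho(kap) on the left is rho of their bracket. *)
Lemma jbracket_rho_star_d mu xi : jbracket mu (rho_star_d xi) = rho_star_d (rho mu xi).
Proof.
apply: jpair_nondeg => kap.
apply: (addIr (jpair (rho_star_d xi) (jbracket mu kap))).
rewrite -(jpair_invariant HC) !jpair_rho_star_d rho_bracket gaugeZ -scalerDr; congr (_ *: _).
by rewrite -[gauge_bracket _ _ _]/(rho mu (rho kap xi) - rho kap (rho mu xi)) addrC subrK.
Qed.

Lemma jbracket_rho_star_dl xi nu : jbracket (rho_star_d xi) nu = 0.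
Proof.
rewrite jbracket_swap jbracket_rho_star_d jpair_rho_star_d -rho_star_dD.
have -> : half *: rho nu xi + half *: rho nu xi = rho nu xi.
  by apply: oneform_eq => V; rewrite contractDl !contractZl half2.
exact: subrr.
Qed.

Definition jacobiator mu nu kap :=
  jbracket mu (jbracket nu kap) - jbracket (jbracket mu nu) kap - jbracket nu (jbracket mu kap).

(** The symmetric part of the bracket brackets to zero from the left. *)
Lemma jacobiator_anti12 mu nu kap : jacobiator mu nu kap = - jacobiator nu mu kap.
Proof.
apply/eqP; rewrite -addr_eq0; apply/eqP; rewrite /jacobiator.
have H : jbracket (jbracket mu nu) kap + jbracket (jbracket nu mu) kap = 0.
  by rewrite -jbracketDl jbracket_sym jbracketDl !jbracket_rho_star_dl addr0.
set a := jbracket mu (jbracket nu kap); set c := jbracket nu (jbracket mu kap).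
move/eqP: H; rewrite addr_eq0 => /eqP ->; rewrite opprK.
jring.
Qed.

(** The symmetric part of [nu, kap] is 2 rho^* d (nu, kap), and mu acts on it
    through rho(mu), which is a derivation of the pairing. *)
Lemma jacobiator_anti23 mu nu kap : jacobiator mu nu kap = - jacobiator mu kap nu.
Proof.
have H : jbracket mu (jbracket nu kap) + jbracket mu (jbracket kap nu) =
    jbracket (jbracket mu nu) kap + jbracket kap (jbracket mu nu) +
    (jbracket nu (jbracket mu kap) + jbracket (jbracket mu kap) nu).
  rewrite -jbracketDr !jbracket_sym jbracketDr !jbracket_rho_star_d.
  rewrite (jpair_invariant HC) !rho_star_dD.
  rewrite [jpair nu (jbracket mu kap)](jpairC HC) [X in _ = _ + X]addrC.
  by rewrite addrACA.
move/eqP: H; rewrite -subr_eq0 => /eqP H.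
apply/eqP; rewrite -subr_eq0; apply/eqP; rewrite -[RHS]H /jacobiator; jring.
Qed.

Lemma jacobiatorDl mu mu' nu kap :
  jacobiator (mu + mu') nu kap = jacobiator mu nu kap + jacobiator mu' nu kap.
Proof. by rewrite /jacobiator !jbracketDl !jbracketDr; jring. Qed.
Lemma jacobiatorDm mu nu nu' kap :
  jacobiator mu (nu + nu') kap = jacobiator mu nu kap + jacobiator mu nu' kap.
Proof. by rewrite !(jacobiator_anti12 mu) jacobiatorDl opprD. Qed.
Lemma jacobiatorDr mu nu kap kap' :
  jacobiator mu nu (kap + kap') = jacobiator mu nu kap + jacobiator mu nu kap'.
Proof. by rewrite jacobiator_anti23 jacobiatorDm opprD -!jacobiator_anti23. Qed.

Lemma form_pair_eq0 mu Y : (forall V, w mu V = 0) -> form_pair HC mu Y = 0.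
Proof. by move=> H; apply: oneform_eq => V; rewrite form_pairE H pf0l contract0l. Qed.

Lemma form_pair0 mu : form_pair HC mu 0 = 0.
Proof. by apply: oneform_eq => V; rewrite form_pairE (pf0r HC) contract0l. Qed.

Lemma iota_d0 V : iota_d V 0 = 0.
Proof.
apply: oneform_eq => U; rewrite iota_dE !contract0l !vf_app0; ring.
Qed.

Lemma sharp0 : sharp 0 = 0.
Proof. by apply: (pf_nondeg HC) => Z; rewrite (pf_sharpl HC) contract0l pf0l. Qed.

Lemma jbracket_dd X Y : jbracket (prolong X) (prolong Y) = prolong (br X Y).
Proof.
have L Z : form_pair HC (prolong X) Z = 0 by apply: form_pair_eq0 => V; exact: jet_form_prolong.
apply: (@jet_eq _ _ _ _ fC) => [|V].
  by rewrite jbracket_base L sharp0 addr0 !jet_base_prolong.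
rewrite jbracket_formE /jbracket_form L iota_d0 sharp0 !jet_form_prolong !(br0r HC).
by rewrite !subr0 addr0.
Qed.

Lemma jbracket_dh_base X nu : b nu = 0 -> b (jbracket (prolong X) nu) = 0.
Proof. by move=> bn; rewrite jbracket_base bn form_pair0 sharp0 addr0 (br0r HC). Qed.

Lemma jbracket_dh_form X nu V : b nu = 0 -> w (jbracket (prolong X) nu) V =
  br X (w nu V) - w nu (lie_bracket (an X) V).
Proof.
move=> bn; rewrite jbracket_formE /jbracket_form bn form_pair0 iota_d0 sharp0 jet_base_prolong.
by rewrite !jet_form_prolong (br0l HC) !(linear0, addr0, subr0).
Qed.

Lemma jbracket_hh_base mu nu : b mu = 0 -> b nu = 0 -> b (jbracket mu nu) = 0.
Proof. by move=> bm bn; rewrite jbracket_base bn form_pair0 sharp0 addr0 (br0r HC). Qed.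

Lemma lie0l V : lie_bracket 0 V = 0.
Proof. by apply: vf_eq => f; rewrite lie_app !vf_app0l vf_app0 subr0. Qed.

Lemma jbracket_hh_form mu nu V : b mu = 0 -> b nu = 0 -> w (jbracket mu nu) V =
  w nu (an (w mu V)) - w mu (an (w nu V)).
Proof.
move=> bm bn; rewrite jbracket_formE /jbracket_form bm bn form_pair0 iota_d0 sharp0.
by rewrite linear0 lie0l !(br0l HC) !(linear0, add0r, addr0, subr0).
Qed.

Ltac cring := apply: (pf_nondeg HC) => ?; rewrite !(pfE HC); ring.

Lemma wD mu V V' : w mu (V + V') = w mu V + w mu V'.
Proof. exact: linearD. Qed.
Lemma wN mu V : w mu (- V) = - w mu V.
Proof. exact: linearN. Qed.
Lemma anD X Y : an (X + Y) = an X + an Y.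
Proof. exact: linearD. Qed.
Lemma anN X : an (- X) = - an X.
Proof. exact: linearN. Qed.

Lemma jacobiator_ddd X Y Z : jacobiator (prolong X) (prolong Y) (prolong Z) = 0.
Proof.
rewrite /jacobiator !jbracket_dd; apply: (@jet_eq _ _ _ _ fC) => [|V].
  rewrite !(jet_baseD, jet_baseN, jet_base_prolong) jet_base0 (br_jacobi HC).
  by cring.
by rewrite !(jet_formD, jet_formN, jet_form_prolong) jet_form0 !subr0.
Qed.

Lemma jacobiator_ddh X Y kap : b kap = 0 -> jacobiator (prolong X) (prolong Y) kap = 0.
Proof.
move=> bk; rewrite /jacobiator jbracket_dd; apply: (@jet_eq _ _ _ _ fC) => [|V].
  by rewrite !(jet_baseD, jet_baseN) !jbracket_dh_base ?jbracket_dh_base// jet_base0 !subr0.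
rewrite !(jet_formD, jet_formN) jet_form0 !jbracket_dh_form ?jbracket_dh_base//.
rewrite (an_br HC) lie_jacobi !(wD, wN, brDr HC, brNr HC).
by rewrite (br_jacobi HC X Y); cring.
Qed.

Lemma jacobiator_dhh X nu kap : b nu = 0 -> b kap = 0 -> jacobiator (prolong X) nu kap = 0.
Proof.
move=> bn bk.
have Bn := jbracket_dh_base X bn; have Bk := jbracket_dh_base X bk.
have Bnk := jbracket_hh_base bn bk.
rewrite /jacobiator; apply: (@jet_eq _ _ _ _ fC) => [|V].
  rewrite !(jet_baseD, jet_baseN) jet_base0.
  by rewrite (jbracket_dh_base X Bnk) (jbracket_hh_base Bn bk) (jbracket_hh_base bn Bk) !subr0.
rewrite !(jet_formD, jet_formN) jet_form0.
rewrite (jbracket_dh_form X V Bnk) (jbracket_hh_form V Bn bk) (jbracket_hh_form V bn Bk).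
rewrite !(jbracket_hh_form _ bn bk) !(jbracket_dh_form X _ bn) !(jbracket_dh_form X _ bk).
rewrite !(wD, wN, anD, anN, an_br HC, brDr HC, brNr HC).
by cring.
Qed.

Lemma jacobiator_hhh mu nu kap : b mu = 0 -> b nu = 0 -> b kap = 0 -> jacobiator mu nu kap = 0.
Proof.
move=> bm bn bk; rewrite /jacobiator; apply: (@jet_eq _ _ _ _ fC) => [|V].
  by rewrite !(jet_baseD, jet_baseN) jet_base0 !jbracket_hh_base ?jbracket_hh_base// !subr0.
rewrite !(jet_formD, jet_formN) jet_form0 !jbracket_hh_form ?jbracket_hh_base//.
rewrite !(wD, wN, anD, anN).
by cring.
Qed.

(** By trilinearity and antisymmetry only four types of triples matter. *)
Lemma jacobiator_eq0 mu nu kap : jacobiator mu nu kap = 0.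
Proof.
have split_jet la : exists X la', la = prolong X + la' /\ b la' = 0.
  exists (b la), (la - prolong (b la)); split; first by rewrite addrC subrK.
  by rewrite jet_baseD jet_baseN jet_base_prolong subrr.
have [X [mu' [-> bm]]] := split_jet mu.
have [Y [nu' [-> bn]]] := split_jet nu.
have [Z [kap' [-> bk]]] := split_jet kap.
rewrite !(jacobiatorDl, jacobiatorDm, jacobiatorDr).
(* Move the arguments without base component to the right. *)
rewrite (jacobiator_anti23 (prolong X) nu' (prolong Z)).
rewrite (jacobiator_anti12 mu' (prolong Y) (prolong Z)).
rewrite (jacobiator_anti23 (prolong Y) mu' (prolong Z)).
rewrite (jacobiator_anti12 mu' (prolong Y) kap').
rewrite (jacobiator_anti23 mu' nu' (prolong Z)) (jacobiator_anti12 mu' (prolong Z) nu').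
rewrite jacobiator_ddd !jacobiator_ddh// !jacobiator_dhh// jacobiator_hhh//.
by rewrite !oppr0 !addr0.
Qed.

Lemma jet_pairing_exists : exists p : pairing JC (cotangent_bundle M),
  forall mu nu, pair_sec p mu nu = jpair mu nu.
Proof. exact: (pairing_of fJ (jpair_linl HC) (fun f s t u => jpair_linr HC f s t u)). Qed.
Definition jet_pairing := sval (cid jet_pairing_exists).
Lemma jet_pairingE mu nu : pair_sec jet_pairing mu nu = jpair mu nu.
Proof. exact: (svalP (cid jet_pairing_exists)). Qed.
Lemma jet_pairing_at mu nu m : jet_pairing m (mu m) (nu m) = jpair mu nu m.
Proof. by rewrite -jet_pairingE. Qed.

Definition jet_courant : ecourant_data (cotangent_bundle M) JC :=
  ECourantData jet_pairing jbracket rho.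

Lemma jet_pairing_sym : symmetric_pairing jet_pairing.
Proof.
move=> m x y; have [mu <-] := framed_extend x fJ; have [nu <-] := framed_extend y fJ.
by rewrite !jet_pairing_at jpairC.
Qed.

Lemma jet_pairing_nondeg : nondegenerate_pairing jet_pairing.
Proof.
move=> m x H; have [mu mux] := framed_extend x fJ; rewrite -mux.
apply: jpair_nondeg0 => nu V; have := H (nu m); rewrite -mux jet_pairing_at.
by move=> E; rewrite -[LHS]/(jpair mu nu m (V m)) E.
Qed.

Lemma diff_cst c : diff (cstS M c) = 0 :> oneform M.
Proof. by apply: oneform_eq => V; rewrite contract_diff vf_app_cst contract0l. Qed.

Lemma tens0r xi : tens xi 0 = 0 :> section JC.
Proof.
apply: jet_section_eq => m d; rewrite -[LHS]/(xi m (symbol d m) *: (0 : C m)).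
by rewrite scaler0.
Qed.

Lemma jbracket_leibniz : leibniz_algebra jbracket.
Proof.
split.
- exact: jbracketDl.
- exact: jbracketDr.
- move=> c mu nu.
  by rewrite jbracketZl vf_app_cst diff_cst (coa0 HC) tens0r scale0r subr0 mul0rn addr0.
- by move=> c mu nu; rewrite jbracketZr vf_app_cst scale0r addr0.
- move=> mu nu kap; apply/eqP; rewrite -subr_eq0 opprD addrA.
  by apply/eqP; exact: jacobiator_eq0.
Qed.

(** The case mu = nu of [jbracket_sym], halved. *)
Lemma jbracket_square mu : jbracket mu mu = rho_star_d (jpair mu mu).
Proof.
apply: jpair_nondeg => kap; apply: oneform_eq => V; apply: half_inj.
by rewrite -!contractDl -!jpairDl jbracket_sym.
Qed.

Lemma is_rho_starP (mu : section (jet_bundle (cotangent_bundle M))) k :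
  (forall kap m, jpair k kap m = 2^-1 *: mu m (rho kap)) -> is_rho_star jet_courant mu k.
Proof. by move=> H kap m; rewrite -H -jet_pairing_at. Qed.

Lemma rho_star_eq (mu : section (jet_bundle (cotangent_bundle M))) k :
  (forall kap m, jpair k kap m = 2^-1 *: mu m (rho kap)) -> rho_star jet_courant mu = k.
Proof.
move=> H; have Hk := is_rho_starP H; rewrite /rho_star; case: xgetP => [k' _ Hk'|/(_ k)//].
apply: jpair_nondeg => kap; apply: section_eq => m.
by rewrite H -jet_pairing_at; exact: Hk'.
Qed.

(** For mu = d xi + W, the element is rho^* d xi plus the form that sends V
    to a^* (U |-> (W U) V). *)
Lemma rho_star_exists (mu : section (jet_bundle (cotangent_bundle M))) :
  exists k, (forall kap m, jpair k kap m = 2^-1 *: mu m (rho kap)) /\ rho k = 0.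
Proof.
have [xi [W ->]] := mkjet_surj (@cotangent_framed R n M) mu.
have exT V : exists eta : oneform M, forall U, contract eta U = contract (W U) V.
  by apply: oneform_of => f U U'; rewrite linearP contractDl contractZl.
have [T TE] := choice exT.
have lT : linear (fun V => coa (T V)).
  move=> f V V'; rewrite -(coaZ HC) -(coaD HC); congr (coa _).
  by apply: oneform_eq => U; rewrite contractDl contractZl !TE contractD contractZ.
pose th : section JC := mkjet 0 (linear_of lT).
have thb : b th = 0 by exact: jet_base_mkjet.
have thw V : w th V = coa (T V) by exact: jet_form_mkjet.
exists (rho_star_d xi + th); split.
  move=> kap m.
  have -> : jpair (rho_star_d xi + th) kap = half *: (rho kap xi + W (symbol (rho kap))).
    rewrite jpairDl jpair_rho_star_d scalerDr; congr (_ + _).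
    apply: oneform_eq => V; rewrite jpairE thb thw pf0l vf_app0 pf0l !add0r.
    by rewrite (coaE HC) TE contractZl.
  by [].
rewrite linearD rho_rho_star_d add0r; apply: gauge_eq => [eta|]; last first.
  by rewrite rho_symbol thb linear0.
apply: oneform_eq => V; rewrite -[rho _ _]/(anchor_op HC _ _) rhoE thb thw.
by rewrite linear0 lie0l vf_app0l (an_coa HC) !contract0 subr0 addr0 contract0l.
Qed.

Lemma jet_courant_ecourant : is_ecourant jet_courant.
Proof.
split.
- exact/framed_vector_bundle/cotangent_framed.
- exact: framed_vector_bundle fJ.
- exact: jet_pairing_sym.
- exact: jet_pairing_nondeg.
- exact: jbracket_leibniz.
- by move=> mu nu; exact: rho_bracket.
- move=> mu; rewrite /= jbracket_square jet_pairingE; apply/esym/rho_star_eq => kap m.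
  by rewrite jpair_rho_star_d.
- by move=> mu nu kap; rewrite /= !jet_pairingE; exact: jpair_invariant.
- by move=> mu; have [k [/is_rho_starP Hk _]] := rho_star_exists mu; exists k.
- by move=> mu; have [k [/rho_star_eq -> Hk]] := rho_star_exists mu.
Qed.

Lemma jpair_dd X Y : jpair (prolong X) (prolong Y) = diff <[X, Y]>.
Proof.
apply: oneform_eq => V; rewrite jpairE !jet_base_prolong !jet_form_prolong.
by rewrite pf0l (pf0r HC) !addr0 contract_diff.
Qed.

Lemma jbracket_dt X Y f : jbracket (prolong X) (tens (diff f) Y) =
  tens (diff f) (br X Y) + tens (diff (vf_app (an X) f)) Y.
Proof.
have tb (xi : oneform M) Z : b (tens xi Z) = 0 by exact: jet_base_tens.
apply: (@jet_eq _ _ _ _ fC) => [|V].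
  by rewrite jbracket_dh_base// jet_baseD !tb addr0.
rewrite jbracket_dh_form// jet_formD !jet_form_tens !contract_diff (br_Zr HC) lie_app.
by cring.
Qed.

Lemma jet_courant_is_jet_courant : is_jet_courant jet_courant.
Proof.
split => /=.
- exact: jet_pairing_sym.
- by move=> X Y; rewrite jet_pairingE jpair_dd.
- move=> X Y f; rewrite jet_pairingE jpairC jpair_tens jet_base_prolong.
  by rewrite (pfC HC).
- by move=> X Y f g; rewrite jet_pairingE jpair_tens jet_base_tens (pf0r HC) scale0r.
- move=> X xi V; rewrite -[anchor_gauge _ _ _]/(anchor_op HC _ _) rhoE.
  by rewrite jet_base_prolong jet_form_prolong linear0 contract0 addr0.
- move=> X f xi; apply: oneform_eq => V.
  rewrite -[anchor_gauge _ _ _]/(anchor_op HC _ _) rhoE jet_base_tens jet_form_tens.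
  rewrite linear0 lie0l vf_app0l contract0 subr0 add0r linearZ contractZ.
  by rewrite contractZl mulrC.
- exact: jbracket_dd.
- exact: jbracket_dt.
- move=> X Y f.
  have E : jbracket (tens (diff f) Y) (prolong X) =
      rho_star_d (<[X, Y]> *: diff f) + rho_star_d (<[X, Y]> *: diff f) -
      jbracket (prolong X) (tens (diff f) Y).
    by rewrite jbracket_swap jpair_tens jet_base_prolong (pfC HC Y).
  rewrite E jbracket_dt rho_star_d_scale rho_star_d_diff.
  have tD Z Z' : tens (diff f) (Z + Z') = tens (diff f) Z + tens (diff f) Z' :> section JC.
    apply: jet_section_eq => m d.
    by rewrite -[LHS]/(diff f m (symbol d m) *: (Z m + Z' m)) scalerDr.
  have H : tens (diff f) (br X Y) + tens (diff f) (br Y X) =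
      tens (diff f) (coa (diff <[X, Y]>)) + tens (diff f) (coa (diff <[X, Y]>)) :> section JC.
    by rewrite -!tD (br_sym HC).
  have H' : tens (diff f) (br X Y) =
      tens (diff f) (coa (diff <[X, Y]>)) + tens (diff f) (coa (diff <[X, Y]>))
      - tens (diff f) (br Y X) :> section JC by rewrite -H addrK.
  rewrite H' mulr2n scalerDl; jring.
- move=> X Y f g.
  apply: (@jet_eq _ _ _ _ fC) => [|V].
    rewrite jbracket_hh_base ?jet_base_tens// jet_baseD jet_baseN !jet_baseZ !jet_base_tens.
    by rewrite !scaler0 subr0.
  rewrite jbracket_hh_form ?jet_base_tens// jet_formD jet_formN !jet_formZ !jet_base_tens.
  rewrite !scaler0 !subr0 !jet_form_tens !contract_diff !linearZ /=.
  rewrite !vf_appZl; by cring.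
- exact: jbracketDl.
- exact: jbracketDr.
- by move=> f mu nu; rewrite jbracketZr.
- by move=> f mu nu; rewrite jbracketZl jet_pairingE.
Qed.

(** Leibniz' rule with a one-form that does not vanish at the given point. *)
Lemma symbol_determined (d d' : gauge (cotangent_bundle M)) :
  (forall xi, d xi = d' xi) -> symbol d = symbol d'.
Proof.
move=> H; apply: vf_eq => f; apply: smooth_fun_eq => m.
have [g [V Vg]] := unit_coordinate m.
have := H (f *: diff g); rewrite !gaugeL H => /addrI E.
have := congr1 (fun xi => contract xi V m) E.
by rewrite !contractZl !contract_diff !smfM Vg !mulr1.
Qed.

(** Two such structures have the same pairing; then the same anchor; and then, by
    the two Leibniz rules, brackets with a C^oo(M)-bilinear difference. Each
    time it remains to compare the values on the generators. *)
Lemma jet_courant_unique S : is_jet_courant S -> S = jet_courant.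
Proof.
case: S => p' br' r' [/= psym pdd pdt ptt ad at_ bdd bdt btd btt bDl bDr bZr bZl].
have [_ qdd qdt qtt ad' at' cdd cdt ctd ctt _ _ _ _] := jet_courant_is_jet_courant.
rewrite /= in qdd qdt qtt ad' at' cdd cdt ctd ctt.
have pE : p' = jet_pairing.
  apply: pairing_eq => m x y.
  have [mu <-] := framed_extend x fJ; have [nu <-] := framed_extend y fJ.
  pose D mu nu : cotangent_bundle M m := p' m (mu m) (nu m) - jet_pairing m (mu m) (nu m).
  have Dl nu' f s t : D (f *: s + t) nu' = f m *: D s nu' + D t nu'.
    by rewrite /D secD secZ !pair_linearl scalerBr opprD addrACA.
  have Dr nu' f s t : D nu' (f *: s + t) = f m *: D nu' s + D nu' t.
    by rewrite /D secD secZ !pair_linearr scalerBr opprD addrACA.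
  have eqD s t : pair_sec p' s t = pair_sec jet_pairing s t -> D s t = 0.
    move=> E; apply/eqP; rewrite subr_eq0; apply/eqP.
    exact: (congr1 (fun xi : oneform M => xi m) E).
  have Dsym s t : D s t = D t s by rewrite /D psym jet_pairing_sym.
  suff : D mu nu = 0 by move/eqP; rewrite subr_eq0 => /eqP.
  apply: (jet_generated fC (F := D^~ nu)); first exact: Dl.
    move=> X; apply: (jet_generated fC (F := D (prolong X))); first exact: Dr.
      by move=> Y; apply: eqD; rewrite pdd qdd.
    by move=> f Y; apply: eqD; rewrite pdt qdt.
  move=> f X; apply: (jet_generated fC (F := D (tens (diff f) X))); first exact: Dr.
    by move=> Y; rewrite Dsym; apply: eqD; rewrite pdt qdt.
  by move=> g Y; apply: eqD; rewrite ptt qtt.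
have rE : r' = rho.
  apply: linear_eq => mu.
  have op xi : r' mu xi = rho mu xi.
    apply: section_eq => m.
    pose D nu : cotangent_bundle M m := r' nu xi m - rho nu xi m.
    suff : D mu = 0 by move/eqP; rewrite subr_eq0 => /eqP.
    apply: (jet_generated fC (F := D)).
    - have L (r : {linear section JC -> gauge (cotangent_bundle M)}) f s t :
          r (f *: s + t) xi m = f m *: r s xi m + r t xi m by rewrite linearP.
      by move=> f s t; rewrite /D !L scalerBr opprD addrACA.
    - move=> X; rewrite /D (_ : r' (prolong X) xi = rho (prolong X) xi) ?subrr//.
      by apply: oneform_eq => V; rewrite ad -ad'.
    - by move=> f X; rewrite /D at_ -at' subrr.
  by apply: gauge_eq => //; exact: symbol_determined.
subst p' r'.
have bE : br' = jbracket.
  apply/funext => mu; apply/funext => nu; apply: section_eq => m.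
  pose D mu nu : JC m := br' mu nu m - jbracket mu nu m.
  have Dr nu' f s t : D nu' (f *: s + t) = f m *: D nu' s + D nu' t.
    have E : br' nu' (f *: s + t) - jbracket nu' (f *: s + t) =
        f *: (br' nu' s - jbracket nu' s) + (br' nu' t - jbracket nu' t).
      by rewrite bDr bZr jbracketDr jbracketZr rho_symbol; jring.
    exact: (congr1 (fun la : section JC => la m) E).
  have Dl nu' f s t : D (f *: s + t) nu' = f m *: D s nu' + D t nu'.
    have E : br' (f *: s + t) nu' - jbracket (f *: s + t) nu' =
        f *: (br' s nu' - jbracket s nu') + (br' t nu' - jbracket t nu').
      by rewrite bDl bZl jet_pairingE jbracketDl jbracketZl rho_symbol; jring.
    exact: (congr1 (fun la : section JC => la m) E).
  have eqD s t : br' s t = jbracket s t -> D s t = 0 by rewrite /D => ->; rewrite subrr.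
  suff : D mu nu = 0 by move/eqP; rewrite subr_eq0 => /eqP.
  apply: (jet_generated fC (F := D^~ nu)); first exact: Dl.
    move=> X; apply: (jet_generated fC (F := D (prolong X))); first exact: Dr.
      by move=> Y; apply: eqD; rewrite bdd cdd.
    by move=> f Y; apply: eqD; rewrite bdt cdt.
  move=> f X; apply: (jet_generated fC (F := D (tens (diff f) X))); first exact: Dr.
    by move=> Y; apply: eqD; rewrite btd ctd.
  by move=> g Y; apply: eqD; rewrite btt ctt.
by subst br'.
Qed.

End JetCourant.

Theorem theorem2p13 (R : realType) (n : nat) (n_gt0 : (0 < n)%N)
  (M : manifold R n) (C : courant_data M) (C_courant : is_courant C) :
  exists S : ecourant_data (cotangent_bundle M) (jet_bundle C),
    [/\ is_jet_courant S,
        forall S', is_jet_courant S' -> S' = S &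
        is_ecourant S].
Proof.
exists (jet_courant C_courant); split.
- exact: jet_courant_is_jet_courant.
- by move=> S'; exact: jet_courant_unique.
- exact: jet_courant_ecourant.
Qed.
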